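(* Let $d\ge 1$, let $D$ be the open unit ball in $\mathbb{R}^d$ centred at the origin, and let $0<t<(\psi,1)$. Let $f\in V_t$ be such that $\beta_t=J(f)$. Then $f$ possesses circular cap symmetry, i.e. there exists $\omega\in S^{d-1}$ such that $f=C_\omega f$ $m$-a.e. on $D$.
   Context: $m$ is Lebesgue measure on $D$, and $(\cdot,\cdot)$ is the standard inner product of the real Hilbert space $\mathscr{H}=L^2(D,m)$. $G$ is the Green operator of the non-negative Dirichlet Laplacian $-\Delta$: for $f\in\mathscr{H}$, $u=Gf$ is the unique element of $W^{1,2}_0(D)$ with $\int_D\nabla u\cdot\nabla v\,dm=(f,v)$ for all $v\in W^{1,2}_0(D)$. The torsion function is $\psi:=G\chi_D$. For $f\in\mathscr{H}$, $J(f):=(f,Gf)$. For $0<t<(\psi,1)$, $$V_t:=\{f\in\mathscr{H}:\ 0\le f\le 1\ m\text{-a.e. on }D\text{ and }(f,\psi)\le t\},\qquad \beta_t:=\sup\{J(f): f\in V_t\}.$$ Spherical cap symmetrisation. Let $\omega\in S^{d-1}$; let $B(x,\rho)$ be the open ball of radius $\rho$ centred at $x$, and let $\sigma_r$ be the surface area measure on $\partial B(0,r)$ (counting measure if $d=1$). For a Borel set $A\subseteq D$, its spherical cap symmetrisation with respect to $\omega$ is the set $A^*\subseteq D$ with $A^*\cap\{0\}=A\cap\{0\}$ and, for each $r\in(0,1)$, $A^*\cap\partial B(0,r)=B(r\omega,\rho)\cap\partial B(0,r)$ for some $\rho=\rho(r)\ge 0$ chosen so that $\sigma_r(A^*\cap\partial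 B(0,r))=\sigma_r(A\cap\partial B(0,r))$. For a non-negative $f\in L^1(D,m)$, choose a Borel version of $f$; then $C_\omega f=f^*$ is the function (unique as an $m$-equivalence class) such that $\{f^*>t\}=\{f>t\}^*$ up to $m$-null sets for every $t\in\mathbb{R}$. *)

(* Defs.v *)
From HB Require Import structures.
From mathcomp Require Import all_boot all_order all_algebra.
From mathcomp Require Import all_classical all_reals all_analysis.
From mathcomp Require Import measurable_realfun.

Set Implicit Arguments.
Unset Strict Implicit.
Unset Printing Implicit Defensive.
Import Order.TTheory GRing.Theory Num.Theory.
Import numFieldNormedType.Exports.

Local Open Scope classical_set_scope.
Local Open Scope ring_scope.

(* R^d is 'rV[R]_d with its Borel sigma-algebra; the library's norm on it is
   the sup norm, so the Euclidean norm is introduced separately below. *)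
HB.instance Definition _ (R : realType) (d : nat) :=
  Measurable.copy 'rV[R]_d (g_sigma_algebraType (@open 'rV[R]_d)).

Section borel_rV.
Context {R : realType}.
Implicit Type d : nat.

Lemma open_measurable_rV d (U : set 'rV[R]_d) : open U -> measurable U.
Proof. by move=> oU; exact: sub_sigma_algebra. Qed.

Lemma continuous_measurable_rV d (f : 'rV[R]_d -> R) :
  continuous f -> measurable_fun setT f.
Proof.
move=> /continuousP cf; apply: (measurability _ (RGenOInfty.measurableE R)).
move=> _ [_ [r ->] <-]; rewrite setTI; apply: open_measurable_rV.
by apply: cf; exact: rray_open.
Qed.

Lemma measurable_fun_rV (disp : measure_display) (T : measurableType disp) d
    (f : T -> 'rV[R]_d) :
  (forall i, measurable_fun setT (fun x => f x 0 i)) -> measurable_fun setT f.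
Proof.
move=> mf; apply: (@measurability _ _ T 'rV[R]_d setT f open) => //.
move=> _ [U oU <-]; rewrite setTI.
pose B (q : 'rV[rat]_d * nat) : set 'rV[R]_d :=
  [set x | forall i, `|ratr (q.1 0 i) - x 0 i| < q.2.+1%:R^-1].
have UE : U = \bigcup_(q in [set q | B q `<=` U]) B q.
  apply/seteqP; split=> [x Ux|x [q /= BU Bx]]; last exact: BU.
  have /nbhs_ballP[e /= e0 xU] := open_nbhs_nbhs (conj oU Ux).
  have [k ke] : exists k : nat, k.+1%:R^-1 < e / 2.
    have e20 : 0 < e / 2 by rewrite divr_gt0.
    have [k _ /(_ k (leqnn _)) ke] := near_infty_natSinv_lt (PosNum e20).
    by exists k.
  have k0 : 0 < k.+1%:R^-1 :> R by rewrite invr_gt0.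
  have qP i : exists q : rat, `|ratr q - x 0 i| < k.+1%:R^-1.
    have [|q] := @rat_in_itvoo R (x 0 i) (x 0 i + k.+1%:R^-1).
      by rewrite ltrDl.
    rewrite in_itv/= => /andP[q1 q2]; exists q.
    by rewrite gtr0_norm ?subr_gt0// ltrBlDl.
  exists (\row_i sval (cid (qP i)), k); last first.
    by move=> i /=; rewrite mxE; case: cid.
  move=> y /= By; apply: xU; split=> // i j; rewrite ord1 /ball/=.
  have := By j; rewrite /= mxE; case: cid => q /= qx qy.
  rewrite (_ : x 0 j - y 0 j = (x 0 j - ratr q) + (ratr q - y 0 j)); last first.
    by rewrite addrA subrK.
  rewrite (le_lt_trans (ler_normD _ _))// [e]splitr ltrD//.
    by rewrite distrC (lt_trans qx).
  by rewrite (lt_trans qy).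
rewrite UE preimage_bigcup.
rewrite (_ : \bigcup_(_ in _) _ = \bigcup_q
    (if pselect (B q `<=` U) then f @^-1` B q else set0)); last first.
  apply/seteqP; split=> [x [q /= BU Bx]|x [q _]].
    by exists q => //; case: pselect.
  by case: pselect => // BU Bx; exists q.
apply: countable_bigcupT_measurable => [|q].
  exact: (@countableP ('rV[rat]_d * nat)%type).
case: (pselect (B q `<=` U)) => BU /=; last exact: measurable0.
rewrite (_ : _ @^-1` _ = \bigcap_(i in setT)
   (fun x => f x 0 i) @^-1` ball (ratr (q.1 0 i) : R) q.2.+1%:R^-1); last first.
  by apply/seteqP; split=> x /= Bx i => [_|]; exact: Bx.
apply: fin_bigcap_measurable => // i _.
rewrite -[X in measurable X]setTI; apply: mf => //.
by apply: open_measurable; exact: ball_open.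
Qed.

Lemma measurable_coord d (i : 'I_d) :
  measurable_fun setT (fun x : 'rV[R]_d => x 0 i).
Proof. by apply: continuous_measurable_rV => x; exact: coord_continuous. Qed.

End borel_rV.

Definition rcons_rV {R : realType} {d : nat} (p : 'rV[R]_d * R) : 'rV[R]_d.+1 :=
  \row_i if unlift ord_max i is Some j then p.1 0 j else p.2.

Lemma measurable_rcons_rV {R : realType} {d : nat} :
  measurable_fun setT (@rcons_rV R d).
Proof.
apply: measurable_fun_rV => i; rewrite /rcons_rV.
case: (unliftP ord_max i) => [j|] ->.
  under eq_fun do rewrite mxE liftK.
  exact: (measurableT_comp (measurable_coord j) measurable_fst).
under eq_fun do rewrite mxE unlift_none.
exact: measurable_snd.
Qed.

Fixpoint lebesgue_rV (R : realType) (d : nat) :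
    {measure set 'rV[R]_d -> \bar R} :=
  if d is d'.+1 then
    measure_function_pushforward__canonical__measure_function_Measure
      (lebesgue_rV R d' \x @lebesgue_measure R)%E measurable_rcons_rV
  else \d_ (0 : 'rV[R]_0).

Lemma lebesgue_rV_box (R : realType) d (a b : 'rV[R]_d) :
  (forall i, a 0 i <= b 0 i) ->
  lebesgue_rV R d [set x | forall i, a 0 i <= x 0 i <= b 0 i] =
  (\prod_i (b 0 i - a 0 i))%:E.
Proof.
elim: d a b => [|d IH] a b ab.
  rewrite big_ord0 /= diracE mem_set//=.
  by case.
pose a' : 'rV_d := \row_j a 0 (lift ord_max j).
pose b' : 'rV_d := \row_j b 0 (lift ord_max j).
have boxE : @rcons_rV R d @^-1` [set x | forall i, a 0 i <= x 0 i <= b 0 i] =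
    [set x : 'rV[R]_d | forall i, a' 0 i <= x 0 i <= b' 0 i] `*`
    `[a 0 ord_max, b 0 ord_max]%classic.
  apply/seteqP; split=> [[x y] /= xab|[x y] /= [xab yab] i].
    split=> [j|]; last by have := xab ord_max; rewrite mxE unlift_none in_itv.
    by have := xab (lift ord_max j); rewrite !mxE liftK.
  rewrite mxE; case: (unliftP ord_max i) => [j|] ->.
    by have := xab j; rewrite !mxE.
  by move: yab; rewrite in_itv.
rewrite /= /pushforward boxE product_measure1E//; last first.
  rewrite (_ : [set _ | _] = \bigcap_(i in setT)
      (fun x : 'rV[R]_d => x 0 i) @^-1` `[a' 0 i, b' 0 i]%classic); last first.
    by apply/seteqP; split=> x xab i => [_|]; have := xab i;
      rewrite /preimage/= in_itv//=; apply.
  apply: fin_bigcap_measurable => // i _.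
  by rewrite -[X in measurable X]setTI; exact: measurable_coord.
rewrite IH; last by move=> i; rewrite !mxE.
rewrite [X in (_ * X)%E]lebesgue_measure_itv/= lte_fin big_ord_recr/= EFinM; congr (_ * _)%E.
  congr EFin; apply: eq_bigr => i _; rewrite !mxE.
  by have -> : lift ord_max i = widen_ord (leqnSn d) i
    by apply: val_inj; rewrite /= /bump leqNgt ltn_ord.
have := ab ord_max; rewrite le_eqVlt => /predU1P[->|->//].
by rewrite ltxx subrr.
Qed.

Section euclidean.
Context {R : realType} {d : nat}.
Implicit Types (x c : 'rV[R]_d) (r : R).

Definition enorm x : R := Num.sqrt (\sum_i x 0 i ^+ 2).
Definition eball c r : set 'rV[R]_d := [set x | enorm (x - c) < r].
Definition esphere r : set 'rV[R]_d := [set x | enorm x = r].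
Definition unit_ball : set 'rV[R]_d := eball 0 1.

Lemma measurable_enorm : measurable_fun setT enorm.
Proof.
apply: (measurableT_comp (continuous_measurable_fun (@sqrt_continuous R))).
apply: measurable_sum => i; apply: measurable_funX; exact: measurable_coord.
Qed.

Lemma measurable_unit_ball : measurable unit_ball.
Proof.
rewrite (_ : unit_ball = enorm @^-1` `]-oo, 1[); last first.
  by apply/seteqP; split=> x; rewrite /unit_ball /eball/= in_itv/= subr0.
rewrite -[X in measurable X]setTI.
exact: measurable_enorm.
Qed.

End euclidean.
Arguments unit_ball R d : clear implicits.

(* The measure m of the unit ball D, as a measure on R^d carried by D; an
   element of L^2(D, m) is represented by a Borel function on R^d, whose
   values off D are irrelevant. *)
Definition lebesgue_ball (R : realType) (d : nat) :
    {measure set 'rV[R]_d -> \bar R} :=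
  mrestr (lebesgue_rV R d) (@measurable_unit_ball R d).

Section dirichlet.
Context {R : realType} {d : nat}.
Local Notation D := (unit_ball R d).
Local Notation m := (lebesgue_ball R d).
Implicit Types (f u v phi : 'rV[R]_d -> R) (g : 'I_d -> 'rV[R]_d -> R).

Definition L2 : {pred 'rV[R]_d -> R} := Lfun m 2%:E.

Definition inner f u : R := \int[m]_x (f x * u x).

Definition partial (i : 'I_d) phi : 'rV[R]_d -> R := 'D_(delta_mx 0 i) phi.

Definition smooth phi : Prop := forall s : seq 'I_d,
  let dphi := foldr partial phi s in
  continuous dphi /\ forall i x, derivable dphi x (delta_mx 0 i).

(* C_c^oo(D) *)
Definition test_function phi : Prop :=
  let supp := closure [set x | phi x != 0] in
  [/\ smooth phi, compact supp & supp `<=` D].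

Definition weak_gradient u g : Prop :=
  (forall i, g i \in L2) /\
  forall phi, test_function phi ->
    forall i, inner u (partial i phi) = - inner (g i) phi.

(* W^{1,2}_0(D), the closure of C_c^oo(D) in W^{1,2}(D) *)
Definition W120 u : Prop :=
  u \in L2 /\
  exists2 g, weak_gradient u g &
  exists phi_ : nat -> 'rV[R]_d -> R,
    [/\ forall n, test_function (phi_ n),
        'N[m]_2%:E[EFin \o (phi_ n \- u)%R]%E @[n --> \oo] --> 0%E &
        forall i, 'N[m]_2%:E[EFin \o (partial i (phi_ n) \- g i)%R]%E
          @[n --> \oo] --> 0%E].

Definition is_green f u : Prop :=
  exists gu, [/\ W120 u, weak_gradient u gu &
    forall v gv, W120 v -> weak_gradient v gv ->
      \sum_i inner (gu i) (gv i) = inner f v].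

(* For f in L^2 such a u exists and is unique up to m-a.e. equality. *)
Definition green f : 'rV[R]_d -> R := xget (cst 0) [set u | is_green f u].

Definition torsion : 'rV[R]_d -> R := green \1_D.

Definition J f : R := inner f (green f).

Definition V (t : R) : set ('rV[R]_d -> R) :=
  [set f | [/\ f \in L2, {ae m, forall x, 0 <= f x <= 1} &
               inner f torsion <= t]].

Definition beta (t : R) : \bar R := ereal_sup [set (J f)%:E | f in V t].

End dirichlet.

Section cap_symmetrisation.
Context {R : realType} {d : nat}.
Local Notation D := (unit_ball R d).
Local Notation mRd := (lebesgue_rV R d).
Implicit Types (A B E : set 'rV[R]_d) (w : 'rV[R]_d) (f g : 'rV[R]_d -> R).

(* Surface area of E in the sphere of radius r > 0.  In polar coordinates the
   cone {s *: y | y in E, 0 < s < 1} has volume r / d times the area of E.  For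
   d = 1 this is the counting measure on {-r, r}. *)
Definition surface_measure (r : R) E : \bar R :=
  ((d%:R / r)%:E *
   mRd [set x | (0 < enorm x < r)%R /\ E ((r / enorm x) *: x)%R])%E.

(* B is a spherical cap symmetrisation of A with respect to w; it is determined
   by A and w only up to the point - r *: w of the spheres that A fills up to
   a null set. *)
Definition cap_symmetrisation_set w A B : Prop :=
  [/\ B `<=` D, B `&` [set 0] = A `&` [set 0] &
      forall r, 0 < r < 1 ->
      exists rho, [/\ 0 <= rho,
        B `&` esphere r = eball (r *: w) rho `&` esphere r &
        surface_measure r (B `&` esphere r) =
        surface_measure r (A `&` esphere r)]].

Definition null_eq A B : Prop := mRd.-negligible ((A `\` B) `|` (B `\` A)).

Definition is_cap_symmetrisation w f g : Prop :=
  measurable_fun setT g /\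
  forall t : R, exists2 B,
    cap_symmetrisation_set w (D `&` [set x | t < f x]) B &
    null_eq (D `&` [set x | t < g x]) B.

(* C_w f, for f Borel on R^d, integrable and non-negative on D; it is
   determined up to m-a.e. equality. *)
Definition cap_symmetrisation w f : 'rV[R]_d -> R :=
  xget (cst 0) [set g | is_cap_symmetrisation w f g].

End cap_symmetrisation.

(* Main.v *)
(* For a unit vector e let f^e be the polarisation of f with respect to the
   hyperplane orthogonal to e.  Polarisation maps V_t to itself (the torsion
   function is radial) and does not decrease J, because
   J f = sup (2 (f, phi) - |grad phi|^2) over test functions phi, and passing
   from (f, phi) to (f^e, phi^e) increases the inner product and preserves the
   Dirichlet energy.  Hence J(f^e) = J(f) for a maximiser f, and this forces
   G(f^e) = (G f)^e.  With u = G f, the positive part of u o refl e - u is then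
   superharmonic on the half ball {(x, e) > 0}, so by the strong maximum principle
   it vanishes, which gives f >= f o refl e there, or is positive throughout.  The
   second case cannot occur for both e and -e, hence f >= f o refl e or
   f <= f o refl e almost everywhere on the half ball.  The sign of the moment of f
   along e tells which case occurs, so the direction w of the vector moment is an
   axis such that f >= f o refl e whenever (e, w) > 0.  The superlevel sets of f
   then agree up to null sets with sets which, on every sphere, are upward
   closed in the direction w, that is, with their cap symmetrisations. *)

From HB Require Import structures.
Require Import Defs.
From mathcomp Require Import all_boot all_order all_algebra.
From mathcomp Require Import all_classical all_reals all_analysis.
From mathcomp Require Import measurable_realfun ring lra.

Set Implicit Arguments.
Unset Strict Implicit.
Unset Printing Implicit Defensive.
Import Order.TTheory GRing.Theory Num.Theory.
Import numFieldNormedType.Exports.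
Local Open Scope classical_set_scope.
Local Open Scope ring_scope.

(** * Euclidean geometry and reflections *)

(** The maximiser is only an equivalence class, so no step relies on regularity of [green f]. The
    Sobolev space enters through test functions alone: the gap between [J f] and the functional at
    [phi] is a squared distance of gradients, which Poincare's inequality turns into an L^2
    distance. A nearly optimal [phi] for f then polarises to a nearly optimal one for f^e, and
    G(f^e) = (G f)^e follows in the limit. Since polarisation destroys smoothness, a smoothed
    version is used whose energy still does not grow. The maximum principle is distributional:
    kernel averages that increase as the radius shrinks replace point values, and an L^1
    differentiation theorem recovers almost everywhere values. At the end, each reflection carries
    its own null set and there are uncountably many; comparing the measures of a set inside two
    balls of equal radius removes these exceptional sets. Surface measure is the volume of a cone,
    so null sets in polar coordinates are treated by scalings and Tonelli. Dimension one is
    separate, because there single points of a sphere have positive measure. *)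

Section pointwise_continuity.
Context {R : realType} {T : topologicalType}.
Implicit Types f g : T -> R.

Lemma cont_cst (c : R) : continuous (fun _ : T => c).
Proof. by move=> t; exact: cvg_cst. Qed.

Lemma cont_add f g :
  continuous f -> continuous g -> continuous (fun t => f t + g t).
Proof. by move=> cf cg t; exact: (continuousD (cf t) (cg t)). Qed.

Lemma cont_opp f : continuous f -> continuous (fun t => - f t).
Proof. by move=> cf t; exact: (continuousN (cf t)). Qed.

Lemma cont_sub f g :
  continuous f -> continuous g -> continuous (fun t => f t - g t).
Proof. by move=> cf cg; apply: cont_add => //; exact: cont_opp. Qed.

Lemma cont_mul f g :
  continuous f -> continuous g -> continuous (fun t => f t * g t).
Proof. by move=> cf cg t; exact: (continuousM (cf t) (cg t)). Qed.

Lemma cont_comp (h : R -> R) f :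
  continuous h -> continuous f -> continuous (fun t => h (f t)).
Proof. by move=> ch cf t; apply: continuous_comp; [exact: cf|exact: ch]. Qed.

Lemma cont_sum (I : Type) (s : seq I) (f : I -> T -> R) :
  (forall i, continuous (f i)) -> continuous (fun t => \sum_(i <- s) f i t).
Proof.
move=> cf; elim: s => [|i s IH].
  by under eq_fun do rewrite big_nil; exact: cont_cst.
by under eq_fun do rewrite big_cons; exact: cont_add.
Qed.

End pointwise_continuity.

Section dot_product.
Context {R : realType} {d : nat}.
Implicit Types (x y z e : 'rV[R]_d) (a b : R).

Definition dot x y : R := \sum_i x 0 i * y 0 i.

Lemma dotC x y : dot x y = dot y x.
Proof. by apply: eq_bigr => i _; rewrite mulrC. Qed.

Lemma dotDl x y z : dot (x + y) z = dot x z + dot y z.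
Proof. by rewrite -big_split; apply: eq_bigr => i _; rewrite mxE mulrDl. Qed.

Lemma dotZl a x y : dot (a *: x) y = a * dot x y.
Proof. by rewrite mulr_sumr; apply: eq_bigr => i _; rewrite mxE mulrA. Qed.

Lemma dotNl x y : dot (- x) y = - dot x y.
Proof. by rewrite -scaleN1r dotZl mulN1r. Qed.

Lemma dotBl x y z : dot (x - y) z = dot x z - dot y z.
Proof. by rewrite dotDl dotNl. Qed.

Lemma dotDr x y z : dot x (y + z) = dot x y + dot x z.
Proof. by rewrite dotC dotDl !(dotC x). Qed.

Lemma dotZr a x y : dot x (a *: y) = a * dot x y.
Proof. by rewrite dotC dotZl (dotC x). Qed.

Lemma dotNr x y : dot x (- y) = - dot x y.
Proof. by rewrite dotC dotNl (dotC x). Qed.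

Lemma dotBr x y z : dot x (y - z) = dot x y - dot x z.
Proof. by rewrite dotDr dotNr. Qed.

Lemma dot0l x : dot 0 x = 0.
Proof. by rewrite -(scale0r x) dotZl mul0r. Qed.

Lemma dot_ge0 x : 0 <= dot x x.
Proof. by apply: sumr_ge0 => i _; rewrite -expr2 sqr_ge0. Qed.

Lemma dot_eq0 x : dot x x = 0 -> x = 0.
Proof.
move=> /eqP; rewrite psumr_eq0 => [/allP x0|i _]; last first.
  by rewrite -expr2 sqr_ge0.
apply/rowP => i; rewrite mxE.
by have := x0 i (mem_index_enum _); rewrite /= mulf_eq0 orbb => /eqP.
Qed.

Lemma dot_delta x i : dot x (delta_mx 0 i) = x 0 i.
Proof.
rewrite /dot (bigD1 i)//= big1 => [|j ji]; rewrite !mxE ?eqxx ?mulr1 ?addr0//.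
by rewrite (negbTE ji) mulr0.
Qed.

Lemma enorm_ge0 x : 0 <= enorm x.
Proof. exact: sqrtr_ge0. Qed.

Lemma enorm_dot x : enorm x ^+ 2 = dot x x.
Proof.
rewrite sqr_sqrtr; last by apply: sumr_ge0 => i _; exact: sqr_ge0.
by apply: eq_bigr => i _; rewrite expr2.
Qed.

Lemma enormE x : enorm x = Num.sqrt (dot x x).
Proof. by rewrite -enorm_dot sqrtr_sqr ger0_norm// enorm_ge0. Qed.

Lemma enorm0 : enorm (0 : 'rV[R]_d) = 0.
Proof. by rewrite enormE dot0l sqrtr0. Qed.

Lemma enorm_eq0 x : enorm x = 0 -> x = 0.
Proof. by move=> x0; apply: dot_eq0; rewrite -enorm_dot x0 expr0n. Qed.

Lemma enorm_gt0 x : x != 0 -> 0 < enorm x.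
Proof.
move=> x0; rewrite lt_neqAle enorm_ge0 andbT eq_sym.
by apply: contra_neq x0; exact: enorm_eq0.
Qed.

Lemma enormZ a x : enorm (a *: x) = `|a| * enorm x.
Proof.
by rewrite !enormE dotZl dotZr mulrA -expr2 sqrtrM ?sqr_ge0// sqrtr_sqr.
Qed.

Lemma enormN x : enorm (- x) = enorm x.
Proof. by rewrite -scaleN1r enormZ normrN1 mul1r. Qed.

Lemma enorm_distC x y : enorm (x - y) = enorm (y - x).
Proof. by rewrite -enormN opprB. Qed.

(** Cauchy-Schwarz: the squared length of [|x|^2 y - (x.y) x] equals [|x|^2] times the gap
    [|x|^2 |y|^2 - (x.y)^2]. *)
Lemma dot_le x y : dot x y <= enorm x * enorm y.
Proof.
have [->|x0] := eqVneq x 0; first by rewrite dot0l enorm0 mul0r.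
have xx : 0 < dot x x.
  by rewrite -enorm_dot exprn_gt0// enorm_gt0.
apply: le_trans (ler_norm _) _; rewrite -(@ler_pXn2r _ 2)// ?nnegrE ?mulr_ge0 ?enorm_ge0//.
rewrite exprMn !enorm_dot real_normK ?num_real//.
have := dot_ge0 (dot x x *: y - dot x y *: x).
rewrite !(dotBl, dotBr, dotZl, dotZr) (dotC y x).
rewrite (_ : _ - _ = dot x x * (dot x x * dot y y - dot x y ^+ 2)); last by ring.
by rewrite pmulr_rge0// subr_ge0.
Qed.

Lemma dot_norm_le x y : `|dot x y| <= enorm x * enorm y.
Proof.
by rewrite ler_norml lerNl -dotNr -(enormN y) dot_le enormN dot_le.
Qed.

Lemma enormD x y : enorm (x + y) <= enorm x + enorm y.
Proof.
rewrite -(@ler_pXn2r _ 2)// ?nnegrE ?addr_ge0 ?enorm_ge0//.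
rewrite sqrrD !enorm_dot !(dotDl, dotDr) (dotC y x).
have := dot_le x y; lra.
Qed.

Lemma enormB x y : enorm (x - y) <= enorm x + enorm y.
Proof. by rewrite (le_trans (enormD _ _))// enormN. Qed.

Lemma coord_le_enorm x i : `|x 0 i| <= enorm x.
Proof.
rewrite -sqrtr_sqr ler_wsqrtr// (bigD1 i)//= lerDl.
by apply: sumr_ge0 => j _; exact: sqr_ge0.
Qed.

Lemma enorm_le_sum x : enorm x <= \sum_i `|x 0 i|.
Proof.
have s0 : 0 <= \sum_i `|x 0 i| by apply: sumr_ge0.
rewrite -(@ler_pXn2r _ 2)// ?nnegrE ?enorm_ge0// enorm_dot expr2 mulr_suml.
apply: ler_sum => i _; rewrite (le_trans (ler_norm _))// normrM ler_wpM2l//.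
by rewrite (bigD1 i)//= lerDl; apply: sumr_ge0.
Qed.

(** The library norm is the sup norm; the comparison transfers boundedness, and with it the
    compactness of closed Euclidean balls. *)
Lemma norm_le_enorm x : `|x| <= enorm x.
Proof.
rewrite /Num.norm/= mx_normrE; apply: bigmax_le => [|[i j] _ /=].
  exact: enorm_ge0.
by rewrite ord1; exact: coord_le_enorm.
Qed.

Lemma continuous_dotr y : continuous (fun x => dot x y).
Proof.
apply: cont_sum => i; apply: cont_mul; last exact: cont_cst.
exact: coord_continuous.
Qed.

Lemma continuous_dotxx : continuous (fun x => dot x x).
Proof. by apply: cont_sum => i; apply: cont_mul; exact: coord_continuous. Qed.

Lemma continuous_enorm : continuous (@enorm R d).
Proof.
move=> x; rewrite (_ : @enorm R d = Num.sqrt \o (fun x => dot x x)); last first.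
  by apply/funext => y /=; rewrite enormE.
apply: continuous_comp; first exact: continuous_dotxx.
exact: sqrt_continuous.
Qed.

Lemma open_eball x r : open (eball x r).
Proof.
rewrite (_ : eball x r = (fun y => enorm (y - x)) @^-1` [set z | z < r])//.
apply: open_comp; last exact: open_lt.
move=> y _; apply: (@continuous_comp _ _ _ (fun y => y - x) (@enorm R d)).
  by apply: continuousB; [move=> ?; exact: cvg_id|exact: cst_continuous].
exact: continuous_enorm.
Qed.

Lemma measurable_eball x r : measurable (eball x r).
Proof. by apply: open_measurable_rV; exact: open_eball. Qed.

Definition refl e x : 'rV[R]_d := x - (2 * dot x e) *: e.

Lemma reflD e x y : refl e (x + y) = refl e x + refl e y.
Proof. by rewrite /refl dotDl mulrDr scalerDl opprD addrACA. Qed.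

Lemma reflZ e a x : refl e (a *: x) = a *: refl e x.
Proof. by rewrite /refl dotZl scalerBr scalerA mulrCA. Qed.

Lemma reflN e x : refl e (- x) = - refl e x.
Proof. by rewrite -scaleN1r reflZ scaleN1r. Qed.

Lemma reflB e x y : refl e (x - y) = refl e x - refl e y.
Proof. by rewrite reflD reflN. Qed.

Lemma dot_refl e x : enorm e = 1 -> dot (refl e x) e = - dot x e.
Proof.
move=> e1; rewrite /refl dotBl dotZl -enorm_dot e1 expr1n mulr1; ring.
Qed.

Lemma reflK e : enorm e = 1 -> involutive (refl e).
Proof.
move=> e1 x; rewrite [in LHS]/refl dot_refl// /refl mulrN scaleNr opprK.
by rewrite subrK.
Qed.

Lemma dot_refl2 e x y : enorm e = 1 -> dot (refl e x) (refl e y) = dot x y.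
Proof.
move=> e1; rewrite /refl !(dotBl, dotBr, dotZl, dotZr) -(enorm_dot e) e1.
rewrite (dotC e y); ring.
Qed.

Lemma enorm_refl e x : enorm e = 1 -> enorm (refl e x) = enorm x.
Proof. by move=> e1; rewrite !enormE dot_refl2. Qed.

Lemma reflNe e x : refl (- e) x = refl e x.
Proof. by rewrite /refl dotNr scalerN mulrN scaleNr opprK. Qed.

Lemma continuous_rV (T : topologicalType) (f : T -> 'rV[R]_d) :
  (forall i, continuous (fun t => f t 0 i)) -> continuous f.
Proof.
move=> cf t; apply/cvg_ballP => r r0.
have H i : \forall u \near t, ball (f t 0 i) r (f u 0 i).
  by move/cvg_ballP : (cf i t) => /(_ r r0).
near=> u; split=> // i j; rewrite ord1.
by move: j; near: u; apply: filter_forall.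
Unshelve. all: by end_near. Qed.

Lemma continuous_refl e : continuous (refl e).
Proof.
apply: continuous_rV => i.
rewrite (_ : (fun t => _) = (fun t : 'rV[R]_d => t 0 i - 2 * dot t e * e 0 i)); last first.
  by apply/funext => t; rewrite !mxE.
apply: cont_sub; first exact: coord_continuous.
apply: cont_mul; last exact: cont_cst.
by apply: cont_mul; [exact: cont_cst|exact: continuous_dotr].
Qed.

End dot_product.

Lemma continuous_measurable_rVV {R : realType} {d d' : nat}
  (f : 'rV[R]_d -> 'rV[R]_d') : continuous f -> measurable_fun setT f.
Proof.
move=> cf; apply: measurable_fun_rV => i; apply: continuous_measurable_rV => x.
apply: (@continuous_comp _ _ _ f (fun y : 'rV[R]_d' => y 0 i)); first exact: cf.
exact: coord_continuous.
Qed.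

(** * Lebesgue measure under translations and linear maps *)

Section lebesgue_rV_sigma_finite.
Context {R : realType} {d : nat}.
Local Notation V := 'rV[R]_d.

(** A named copy of Lebesgue measure, to which the sigma-finite structure required by Tonelli's
    theorem is attached. *)
Definition leb : set V -> \bar R := lebesgue_rV R d.

HB.instance Definition _ := Measure.copy leb (lebesgue_rV R d).

Definition cube (r : R) : set V := [set x | forall i, - r <= x 0 i <= r].

Lemma measurable_cube r : measurable (cube r).
Proof.
rewrite (_ : cube r = \bigcap_(i in setT)
    (fun x : V => x 0 i) @^-1` `[- r, r]%classic); last first.
  by apply/seteqP; split=> x xr i => [_|]; have := xr i;
    rewrite /preimage/= in_itv//=; apply.
apply: fin_bigcap_measurable => // i _.
by rewrite -[X in measurable X]setTI; exact: measurable_coord.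
Qed.

Lemma leb_cube r : 0 <= r -> leb (cube r) = ((2 * r) ^+ d)%:E.
Proof.
move=> r0; have /= := @lebesgue_rV_box R d (const_mx (- r)) (const_mx r).
move=> leE; have -> : cube r = [set x : V | forall i,
    (const_mx (- r) : V) 0 i <= x 0 i <= (const_mx r : V) 0 i].
  by apply/seteqP; split => x H i; have := H i; rewrite !mxE.
rewrite [LHS]leE; last by move=> i; rewrite !mxE; lra.
congr EFin; under eq_bigr do rewrite !mxE.
by rewrite prodr_const card_ord; congr (_ ^+ _); ring.
Qed.

Lemma cube_cover : \bigcup_n cube n%:R = setT.
Proof.
apply/seteqP; split=> // x _; exists (Num.Def.truncn (enorm x)).+1 => // i.
rewrite -ler_norml (le_trans (coord_le_enorm x i))// ltW//.
by rewrite truncnS_gt.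
Qed.

Lemma sigma_finite_leb : sigma_finite setT leb.
Proof.
exists (fun n => cube n%:R) => [|n]; first by rewrite cube_cover.
by split; [exact: measurable_cube|rewrite leb_cube// ltry].
Qed.

HB.instance Definition _ := Measure_isSigmaFinite.Build _ _ _ leb sigma_finite_leb.

End lebesgue_rV_sigma_finite.

Arguments leb R d : clear implicits.

Section translation_invariance.
Context {R : realType}.

Lemma lebesgue_measure_shift (h : R) (A : set R) : measurable A ->
  lebesgue_measure ((fun x => x + h) @^-1` A) = lebesgue_measure A.
Proof.
move=> mA; have mf : measurable_fun setT (fun x : measurableTypeR R => x + h : measurableTypeR R).
  exact: measurable_funD.
pose nu := measure_function_pushforward__canonical__measure_function_Measure
  (@lebesgue_measure R) mf.
suff H : forall X, ocitv X -> lebesgue_measure X = nu X.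
  exact/esym/(lebesgue_measure_unique H mA).
move=> X [[a b] _ <-].
rewrite /nu/= /pushforward/= (_ : _ @^-1` _ = `]a - h, b - h]%classic); last first.
  by apply/seteqP; split => x; rewrite /= !in_itv/= ltrBlDr lerBrDr.
rewrite !lebesgue_measure_itv/= !lte_fin ltrD2r; case: ifPn => // _.
by congr EFin; lra.
Qed.

Lemma measurable_shift d (h : 'rV[R]_d) :
  measurable_fun setT (fun x : 'rV[R]_d => x + h).
Proof.
apply: continuous_measurable_rVV => x; apply: continuousD.
  by move=> ?; exact: cvg_id.
exact: cst_continuous.
Qed.

(** Induction on the dimension: shifting the last coordinate preserves the length of each section,
    and shifting the others preserves the outer integral. *)
Lemma leb_shift d (h : 'rV[R]_d) (A : set 'rV[R]_d) : measurable A ->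
  leb R d ((fun x => x + h) @^-1` A) = leb R d A.
Proof.
elim: d h A => [|d IH] h A mA.
  congr leb; apply/seteqP; split => x /=; by rewrite !(flatmx0, thinmx0).
rewrite /leb/= /pushforward/=.
pose h' : 'rV[R]_d := \row_j h 0 (lift ord_max j).
pose hl := h 0 ord_max.
have rE (x : 'rV[R]_d) (y : R) :
    rcons_rV (x, y) + h = rcons_rV (x + h', y + hl).
  apply/rowP => i; rewrite /rcons_rV/= !mxE.
  by case: unliftP => [j ->|->//]; rewrite !mxE.
have mrA : measurable (@rcons_rV R d @^-1` A).
  by rewrite -[X in measurable X]setTI; exact: measurable_rcons_rV.
have shE (x : 'rV[R]_d) :
   xsection (@rcons_rV R d @^-1` ((fun x => x + h) @^-1` A)) x =
   (fun y => y + hl) @^-1` xsection (@rcons_rV R d @^-1` A) (x + h').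
  by apply/seteqP; split => y; rewrite /xsection/= !inE/= rE.
rewrite /product_measure1/=.
under eq_integral => x _.
  rewrite shE lebesgue_measure_shift; last exact: measurable_xsection.
  over.
pose F x := lebesgue_measure (xsection (@rcons_rV R d @^-1` A) x).
have mF : measurable_fun setT F.
  exact: measurable_fun_xsection.
have msh : measurable_fun setT (fun x : 'rV[R]_d => x + h') by exact: measurable_shift.
have F0 : {in [set: 'rV[R]_d], forall y, (0 <= F y)%E}.
  by move=> y _; exact: measure_ge0.
have /= pE := @ge0_integral_pushforward _ _ _ _ R _ msh (leb R d) setT F
  measurableT mF F0.
rewrite preimage_setT in pE; etransitivity; first exact/esym/pE.
by apply: eq_measure_integral => B mB _; exact: IH.
Qed.

End translation_invariance.

Section measure_preserving.
Context {disp : measure_display} {T : measurableType disp} {R : realType}.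
Variables (mu : {measure set T -> \bar R}) (phi : T -> T).
Hypotheses (mphi : measurable_fun setT phi)
  (phiP : forall A, measurable A -> mu (phi @^-1` A) = mu A).
Local Open Scope ereal_scope.

Lemma ge0_integral_mpres (f : T -> \bar R) : measurable_fun setT f ->
  (forall x, 0 <= f x) -> \int[mu]_x f (phi x) = \int[mu]_x f x.
Proof.
move=> mf f0; have f0' : {in [set: T], forall y, 0 <= f y} by move=> y _.
have /= pE := @ge0_integral_pushforward _ _ _ _ R _ mphi mu setT f
  measurableT mf f0'.
rewrite preimage_setT in pE; etransitivity; first exact/esym/pE.
by apply: eq_measure_integral => B mB _; exact: phiP.
Qed.

Lemma integral_mpres (f : T -> \bar R) : measurable_fun setT f ->
  \int[mu]_x f (phi x) = \int[mu]_x f x.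
Proof.
move=> mf; rewrite integralE [RHS]integralE; congr (_ - _).
rewrite -(ge0_integral_mpres (measurable_funepos mf) (funepos_ge0 f)).
  by apply: eq_integral => x _; rewrite (funepos_comp f phi).
rewrite -(ge0_integral_mpres (measurable_funeneg mf) (funeneg_ge0 f)).
by apply: eq_integral => x _; rewrite (funeneg_comp f phi).
Qed.

Lemma integrable_mpres (f : T -> \bar R) :
  mu.-integrable setT f -> mu.-integrable setT (f \o phi).
Proof.
move=> /integrableP[mf fi]; apply/integrableP; split.
  exact: measurableT_comp.
rewrite (ge0_integral_mpres (f := fun x => `|f x|))//.
exact: measurableT_comp.
Qed.

Lemma Rintegral_mpres (f : T -> R) : measurable_fun setT f ->
  (\int[mu]_x f (phi x) = \int[mu]_x f x)%R.
Proof.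
move=> mf; rewrite /Rintegral; congr fine.
by apply: (integral_mpres (f := EFin \o f)); exact/measurable_EFinP.
Qed.

End measure_preserving.

(** * Uniqueness of translation-invariant measures *)

Section translation_invariant_measures.
Context {R : realType} {d : nat}.
Local Notation V := 'rV[R]_d.
Local Open Scope ereal_scope.

Lemma measurable_fun_addV disp (T : measurableType disp) (f g : T -> V) :
  measurable_fun setT f -> measurable_fun setT g ->
  measurable_fun setT (fun t => f t + g t)%R.
Proof.
move=> mf mg; apply: measurable_fun_rV => i.
rewrite (_ : (fun _ => _) = (fun t => f t 0 i + g t 0 i)%R); last first.
  by apply/funext => z; rewrite mxE.
by apply: measurable_funD; exact: (measurableT_comp (measurable_coord i)).
Qed.

Lemma measurable_oppV : measurable_fun setT (@GRing.opp V).
Proof. by apply: continuous_measurable_rVV => x; exact: opp_continuous. Qed.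

Lemma measurable_fun_subV disp (T : measurableType disp) (f g : T -> V) :
  measurable_fun setT f -> measurable_fun setT g ->
  measurable_fun setT (fun t => f t - g t)%R.
Proof.
move=> mf mg; apply: measurable_fun_addV => //.
exact: (measurableT_comp measurable_oppV).
Qed.

(** Uniqueness of Haar measure in product form. The double integral of [1_A(x) 1_B(x + y)] gives the
    left side when [x] is fixed first; substituting [x - y] for [x] at fixed [y] gives the right
    side. *)
Lemma translation_invariant_mul (mu nu : {sigma_finite_measure set V -> \bar R})
    (A B : set V) :
  (forall h (E : set V), measurable E -> mu ((fun x => x + h)%R @^-1` E) = mu E) ->
  (forall h (E : set V), measurable E -> nu ((fun x => x + h)%R @^-1` E) = nu E) ->
  measurable A -> measurable B ->
  mu A * nu B = mu B * nu (-%R @^-1` A).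
Proof.
move=> muP nuP mA mB.
have mN := measurable_oppV.
have mNA : measurable (-%R @^-1` A) by rewrite -[X in measurable X]setTI; exact: mN.
pose f (z : V * V) : \bar R := (\1_A z.1 * \1_B (z.1 + z.2)%R)%:E.
have mf : measurable_fun setT f.
  apply/measurable_EFinP; apply: measurable_funM.
    exact: (measurableT_comp (measurable_indic mA) measurable_fst).
  exact: (measurableT_comp (measurable_indic mB)
    (measurable_fun_addV measurable_fst measurable_snd)).
have f0 z : 0 <= f z by rewrite lee_fin mulr_ge0.
have fT := @fubini_tonelli _ _ _ _ R mu nu f mf f0.
pose g (z : V * V) : \bar R := (\1_A (z.2 - z.1)%R * \1_B z.2)%:E.
have mg : measurable_fun setT g.
  apply/measurable_EFinP; apply: measurable_funM.
    exact: (measurableT_comp (measurable_indic mA)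
      (measurable_fun_subV measurable_snd measurable_fst)).
  exact: (measurableT_comp (measurable_indic mB) measurable_snd).
have g0 z : 0 <= g z by rewrite lee_fin mulr_ge0.
have gT := @fubini_tonelli _ _ _ _ R nu mu g mg g0.
have L : \int[mu]_x \int[nu]_y f (x, y) = mu A * nu B.
  transitivity (\int[mu]_x ((\1_A x)%:E * nu B)).
    apply: eq_integral => x _.
    under eq_integral do rewrite /f/= EFinM.
    have m1 : measurable_fun setT (fun y : V => (\1_B (x + y)%R)%:E : \bar R).
      apply/measurable_EFinP; apply: (measurableT_comp (measurable_indic mB)).
      exact: measurable_fun_addV.
    rewrite ge0_integralZl//.
    congr (_ * _).
    rewrite -[RHS](nuP x)// -[in RHS](setIT (_ @^-1` _)) -integral_indic//; last first.
      by rewrite -[X in measurable X]setTI; exact: measurable_shift.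
    apply: eq_integral => y _; rewrite !indicE; congr (_%:R%:E).
    by congr nat_of_bool; apply/idP/idP => /set_mem/= H; apply/mem_set => /=;
      rewrite addrC.
  rewrite ge0_integralZr//; last 1 first.
  - by apply/measurable_EFinP; exact: measurable_indic.
  by rewrite integral_indic// setIT.
have G : \int[mu]_y \int[nu]_x g (x, y) = mu B * nu (-%R @^-1` A).
  transitivity (\int[mu]_x ((\1_B x)%:E * nu (-%R @^-1` A))).
    apply: eq_integral => x _.
    under eq_integral do rewrite /g/= mulrC EFinM.
    have m1 : measurable_fun setT (fun y : V => (\1_A (x - y)%R)%:E : \bar R).
      apply/measurable_EFinP; apply: (measurableT_comp (measurable_indic mA)).
      exact: measurable_fun_subV.
    rewrite ge0_integralZl//.
    congr (_ * _).
    rewrite -[RHS](nuP (- x)%R)// -[in RHS](setIT (_ @^-1` _)) -integral_indic//; last first.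
      by rewrite -[X in measurable X]setTI; exact: measurable_shift.
    apply: eq_integral => y _; rewrite !indicE; congr (_%:R%:E).
    by congr nat_of_bool; apply/idP/idP => /set_mem/= H; apply/mem_set => /=;
      move: H; rewrite opprB.
  rewrite ge0_integralZr//; last 1 first.
  - by apply/measurable_EFinP; exact: measurable_indic.
  by rewrite integral_indic// setIT.
rewrite -L -G fT -gT; apply: eq_integral => y _.
have := @ge0_integral_mpres _ _ R mu (fun x : V => x - y)%R (measurable_shift (- y)%R)
  (muP (- y)%R) (fun x => f (x, y)).
move=> <-; last 2 first.
- exact: measurableT_comp.
- by [].
by apply: eq_integral => x _; rewrite /f/g/= subrK.
Qed.

End translation_invariant_measures.

(** * Lebesgue measure of linear preimages *)

Section linear_images.
Context {R : realType} {d : nat}.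
Local Notation V := 'rV[R]_d.

Lemma preimage_measurable disp disp' (T : measurableType disp)
    (U : measurableType disp') (f : T -> U) (A : set U) :
  measurable_fun setT f -> measurable A -> measurable (f @^-1` A).
Proof. by move=> mf mA; rewrite -[X in measurable X]setTI; exact: mf. Qed.

Lemma eball_sub_cube (r : R) : eball (0 : V) r `<=` cube r.
Proof.
move=> x; rewrite /eball/= subr0 => xr i; rewrite -ler_norml.
by rewrite (le_trans (coord_le_enorm x i))// ltW.
Qed.

(** Dividing by [d + 1] instead of [d] makes the final inequality strict and covers dimension
    zero. *)
Lemma cube_sub_eball (r : R) : 0 < r -> cube (r / d.+1%:R) `<=` eball (0 : V) r.
Proof.
move=> r0 x xr; rewrite /eball/= subr0 (le_lt_trans (enorm_le_sum x))//.
apply: (@le_lt_trans _ _ (\sum_(i < d) (r / d.+1%:R))).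
  by apply: ler_sum => i _; rewrite ler_norml.
rewrite sumr_const card_ord -[_ *+ d]mulr_natr -mulrA gtr_pMr//.
by rewrite mulrC ltr_pdivrMr// mul1r ltr_nat.
Qed.

Lemma leb_eball_ltoo (x : V) r : (leb R d (eball x r) < +oo)%E.
Proof.
have -> : eball x r = (fun y => y + (- x)) @^-1` eball 0 r.
  by apply/seteqP; split => y; rewrite /eball/= subr0.
rewrite leb_shift; last exact: measurable_eball.
apply: (@le_lt_trans _ _ (leb R d (cube `|r|))); last first.
  by rewrite leb_cube// ltry.
apply: le_measure; rewrite ?inE; [exact: measurable_eball|exact: measurable_cube|].
by move=> y /eball_sub_cube yr i; have /andP[] := yr i;
  have := ler_norm r; lra.
Qed.

Lemma leb_eball_gt0 (x : V) r : 0 < r -> (0 < leb R d (eball x r))%E.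
Proof.
move=> r0; have -> : eball x r = (fun y => y + (- x)) @^-1` eball 0 r.
  by apply/seteqP; split => y; rewrite /eball/= subr0.
rewrite leb_shift; last exact: measurable_eball.
apply: (@lt_le_trans _ _ (leb R d (cube (r / d.+1%:R)))).
  by rewrite leb_cube ?divr_ge0 ?(ltW r0)// lte_fin exprn_gt0// mulr_gt0// divr_gt0.
apply: le_measure; rewrite ?inE; [exact: measurable_cube|exact: measurable_eball|].
exact: cube_sub_eball.
Qed.

(** The pushforward of Lebesgue measure under an additive surjection is translation invariant, so
    the product identity applies. Taking for [A] a symmetric set whose measure and preimage are
    known yields the volume factor of [phi] without determinants. *)
Lemma leb_preimage_mul (phi : V -> V) (A B : set V) :
  continuous phi -> {morph phi : x y / x + y} ->
  (forall y, exists x, phi x = y) ->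
  (forall n, (leb R d (phi @^-1` cube n%:R) < +oo)%E) ->
  measurable A -> measurable B ->
  (leb R d A * leb R d (phi @^-1` B) =
   leb R d B * leb R d (phi @^-1` (-%R @^-1` A)))%E.
Proof.
move=> cphi phiD phis phif mA mB.
have mphi : measurable_fun setT phi by exact: continuous_measurable_rVV.
pose nu0 := measure_function_pushforward__canonical__measure_function_Measure
  (leb R d) mphi.
have sf : sigma_finite setT nu0.
  exists (fun n => cube n%:R) => [|n]; first by rewrite cube_cover.
  by split; [exact: measurable_cube|exact: phif].
pose nu : {sigma_finite_measure set V -> \bar R} :=
  HB.pack (Measure.sort nu0) (Measure.class nu0) (Measure_isSigmaFinite.Build _ _ _ nu0 sf).
have nuP h (E : set V) : measurable E -> nu ((fun x => x + h) @^-1` E) = nu E.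
  move=> mE; have [k kh] := phis h.
  rewrite /nu/= /pushforward/= -[RHS](leb_shift k); last exact: preimage_measurable.
  by congr leb; apply/seteqP; split => x /=; rewrite phiD kh.
exact: (@translation_invariant_mul _ _ (leb R d) nu A B (@leb_shift R d) nuP mA mB).
Qed.

Lemma eq_pmule (a b c : \bar R) : (0 < a < +oo)%E -> (a * b = a * c)%E -> b = c.
Proof.
move=> /andP[a0 aoo] abc; have af : a \is a fin_num by rewrite gt0_fin_numE.
by apply/eqP; rewrite eq_le -(lee_pmul2l af a0 b c) -(lee_pmul2l af a0 c b) abc lexx.
Qed.

(** The reference set is the unit ball, which the reflection maps to itself, so the volume factor is
    1. *)
Lemma leb_refl (e : V) (A : set V) : enorm e = 1 -> measurable A ->
  leb R d (refl e @^-1` A) = leb R d A.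
Proof.
move=> e1 mA.
have pE (r : R) : refl e @^-1` eball 0 r = eball 0 r.
  by apply/seteqP; split => x; rewrite /eball/= !subr0 enorm_refl.
have mB : measurable (eball (0 : V) 1) by exact: measurable_eball.
have fin n : (leb R d (refl e @^-1` cube n%:R) < +oo)%E.
  apply: (@le_lt_trans _ _ (leb R d (eball 0 (d.+1%:R * n.+1%:R)))).
    apply: le_measure; rewrite ?inE.
    - apply: preimage_measurable; last exact: measurable_cube.
      exact: (continuous_measurable_rVV (@continuous_refl _ _ e)).
    - exact: measurable_eball.
    - move=> x /= xn; rewrite -pE; apply: (@cube_sub_eball (d.+1%:R * n.+1%:R)).
        by rewrite mulr_gt0.
      move=> i; have /andP[] := xn i.
      have -> : d.+1%:R * n.+1%:R / d.+1%:R = n%:R + 1 :> R.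
        by rewrite mulrAC divff// mul1r -natr1.
      lra.
  exact: leb_eball_ltoo.
have surj y : exists x, refl e x = y by exists (refl e y); rewrite reflK.
have := leb_preimage_mul (@continuous_refl _ _ e) (reflD e) surj fin mB mA.
have -> : -%R @^-1` eball (0 : V) 1 = eball 0 1.
  by apply/seteqP; split => x; rewrite /eball/= !subr0 enormN.
rewrite pE.
rewrite (muleC (leb R d A)) => /eq_pmule; apply.
by rewrite leb_eball_gt0// leb_eball_ltoo.
Qed.

Lemma leb_scale (s : R) (A : set V) : 0 < s -> measurable A ->
  leb R d ( *:%R s @^-1` A) = ((s^-1 ^+ d)%:E * leb R d A)%E.
Proof.
move=> s0 mA.
have cE (r : R) : *:%R s @^-1` cube r = cube (s^-1 * r) :> set V.
  apply/seteqP; split => x /= H i; have := H i; rewrite !mxE.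
    by rewrite -!ler_norml normrM gtr0_norm// ler_pdivlMl.
  by rewrite -!ler_norml normrM gtr0_norm// ler_pdivlMl.
have mB : measurable (cube 1 : set V) by exact: measurable_cube.
have surj (y : V) : exists x, s *: x = y.
  by exists (s^-1 *: y); rewrite scalerA mulfV ?gt_eqF// scale1r.
have fin n : (leb R d ( *:%R s @^-1` cube n%:R) < +oo)%E.
  by rewrite cE leb_cube ?ltry// mulr_ge0// invr_ge0 ltW.
have := leb_preimage_mul (@scaler_continuous _ _ s) (scalerDr s) surj fin mB mA.
have -> : -%R @^-1` cube 1 = cube 1 :> set V.
  by apply/seteqP; split => x H i; have := H i; rewrite !mxE; lra.
rewrite cE.
rewrite !leb_cube ?mulr_ge0 ?invr_ge0 ?(ltW s0)// !mulr1 exprMn EFinM.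
rewrite (muleC (leb R d A)) -muleA => /eq_pmule; apply.
by rewrite lte_fin exprn_gt0//= ltry.
Qed.

Lemma leb_opp (A : set V) : measurable A -> leb R d (-%R @^-1` A) = leb R d A.
Proof.
move=> mA.
have NE (r : R) : -%R @^-1` cube r = cube r :> set V.
  by apply/seteqP; split => x H i; have := H i; rewrite !mxE; lra.
have mB : measurable (cube 1 : set V) by exact: measurable_cube.
have cN : continuous (@GRing.opp V) by move=> x; exact: opp_continuous.
have surj (y : V) : exists x, - x = y by exists (- y); rewrite opprK.
have fin n : (leb R d (-%R @^-1` cube n%:R) < +oo)%E by rewrite NE leb_cube ?ltry.
have := leb_preimage_mul cN (@opprD _) surj fin mB mA.
rewrite !NE.
rewrite (muleC (leb R d A)) => /eq_pmule; apply.
by rewrite leb_cube// lte_fin exprn_gt0//= ?ltry// mulr1.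
Qed.

End linear_images.

(** * Square integrable functions *)

Section square_integrable.
Context {disp : measure_display} {T : measurableType disp} {R : realType}.
Variable mu : {measure set T -> \bar R}.
Implicit Types f g h : T -> R.

(** Working form of membership in L^2 for a general measure; [sq_Lfun] links it to the library
    predicate. *)
Definition sq f : Prop :=
  measurable_fun setT f /\ mu.-integrable setT (fun x => (f x ^+ 2)%:E).

Definition l2ip f g : R := \int[mu]_x (f x * g x).

Definition l2nrm f : R := Num.sqrt (l2ip f f).

Lemma sq_meas f : sq f -> measurable_fun setT f. Proof. by case. Qed.

Lemma sq_le f g : measurable_fun setT f -> sq g ->
  (forall x, `|f x| <= `|g x|) -> sq f.
Proof.
move=> mf [mg ig] fg; split => //; apply: le_integrable ig => //.
  by apply/measurable_EFinP; exact: measurable_funX.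
move=> x _; rewrite !abse_EFin lee_fin !normrX.
by rewrite ler_pXn2r// nnegrE.
Qed.

Lemma sqM f g : sq f -> sq g -> mu.-integrable setT (fun x => (f x * g x)%:E).
Proof.
move=> [mf fi] [mg gi].
have fgi := integrableD measurableT fi gi.
apply: (le_integrable _ _ _ fgi) => //.
  by apply/measurable_EFinP; exact: measurable_funM.
move=> x _; rewrite !abse_EFin lee_fin normrM [`|_ + _|]ger0_norm ?addr_ge0 ?sqr_ge0//.
rewrite -[f x ^+ 2]real_normK ?num_real// -[g x ^+ 2]real_normK ?num_real//.
have := sqr_ge0 (`|f x| - `|g x|); have := normr_ge0 (f x); have := normr_ge0 (g x).
nra.
Qed.

Lemma sqZ a f : sq f -> sq (fun x => a * f x).
Proof.
move=> [mf fi]; split; first exact: measurable_funM.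
rewrite (_ : (fun _ => _) = (fun x => (a ^+ 2)%:E * (f x ^+ 2)%:E)%E).
  exact: integrableZl.
by apply/funext => x; rewrite exprMn.
Qed.

Lemma sqD f g : sq f -> sq g -> sq (fun x => f x + g x).
Proof.
move=> sf sg; have [mf fi] := sf; have [mg gi] := sg.
split; first exact: measurable_funD.
rewrite (_ : (fun _ => _) =
  (fun x => ((f x ^+ 2)%:E + 2%:E * (f x * g x)%:E) + (g x ^+ 2)%:E)%E).
  apply: integrableD => //; apply: integrableD => //.
  by apply: integrableZl => //; exact: sqM.
apply/funext => x; rewrite -EFinM -!EFinD; congr EFin; ring.
Qed.

Lemma sqN f : sq f -> sq (fun x => - f x).
Proof. by move=> /(sqZ (-1)); under eq_fun do rewrite mulN1r. Qed.

Lemma sqB f g : sq f -> sq g -> sq (fun x => f x - g x).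
Proof. by move=> sf sg; apply: sqD => //; exact: sqN. Qed.

Lemma sq0 : sq (fun=> 0).
Proof.
split=> //; rewrite (_ : (fun _ => _) = cst 0%E); first exact: integrable0.
by apply/funext => x; rewrite expr0n.
Qed.

Lemma ipC f g : l2ip f g = l2ip g f.
Proof. by apply: eq_Rintegral => x _; rewrite mulrC. Qed.

Lemma ipDl f g h : sq f -> sq g -> sq h ->
  l2ip (fun x => f x + g x) h = l2ip f h + l2ip g h.
Proof.
move=> sf sg sh; rewrite /l2ip; under eq_Rintegral do rewrite mulrDl.
by rewrite RintegralD//; exact: sqM.
Qed.

Lemma ipZl a f g : sq f -> sq g -> l2ip (fun x => a * f x) g = a * l2ip f g.
Proof.
move=> sf sg; rewrite /l2ip; under eq_Rintegral do rewrite -mulrA.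
by rewrite RintegralZl//; exact: sqM.
Qed.

Lemma ipNl f g : sq f -> sq g -> l2ip (fun x => - f x) g = - l2ip f g.
Proof.
move=> sf sg; rewrite -mulN1r -ipZl//.
by apply: eq_Rintegral => x _; rewrite mulN1r.
Qed.

Lemma ipBl f g h : sq f -> sq g -> sq h ->
  l2ip (fun x => f x - g x) h = l2ip f h - l2ip g h.
Proof. by move=> sf sg sh; rewrite ipDl// ?ipNl//; exact: sqN. Qed.

Lemma ipDr f g h : sq f -> sq g -> sq h ->
  l2ip h (fun x => f x + g x) = l2ip h f + l2ip h g.
Proof. by move=> *; rewrite ipC ipDl// ipC (ipC g). Qed.

Lemma ipZr a f g : sq f -> sq g -> l2ip g (fun x => a * f x) = a * l2ip g f.
Proof. by move=> *; rewrite ipC ipZl// ipC. Qed.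

Lemma ipBr f g h : sq f -> sq g -> sq h ->
  l2ip h (fun x => f x - g x) = l2ip h f - l2ip h g.
Proof. by move=> *; rewrite ipC ipBl// ipC (ipC g). Qed.

Lemma ip_ge0 f : 0 <= l2ip f f.
Proof. by apply: Rintegral_ge0 => x _; rewrite -expr2 sqr_ge0. Qed.

Lemma nrm_ge0 f : 0 <= l2nrm f. Proof. exact: sqrtr_ge0. Qed.

Lemma nrm_sqr f : l2nrm f ^+ 2 = l2ip f f.
Proof. by rewrite sqr_sqrtr// ip_ge0. Qed.

Lemma nrmN f : l2nrm (fun x => - f x) = l2nrm f.
Proof. by congr Num.sqrt; apply: eq_Rintegral => x _; rewrite mulrNN. Qed.

Lemma nrm_distC f g : l2nrm (fun x => f x - g x) = l2nrm (fun x => g x - f x).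
Proof. by rewrite -nrmN; under eq_fun do rewrite opprB. Qed.

Lemma ip_le f g : sq f -> sq g -> l2ip f g <= l2nrm f * l2nrm g.
Proof.
move=> sf sg.
have key a b : 0 <= a ^+ 2 * l2ip f f - 2 * a * b * l2ip f g + b ^+ 2 * l2ip g g.
  have := ip_ge0 (fun x => a * f x - b * g x).
  rewrite ipBl ?ipBr ?ipZl ?ipZr//; do ?[exact: sqZ|exact: sqB|apply: sqB].
  rewrite (ipC g f); nra.
have [f0|f0] := eqVneq (l2nrm f) 0.
  rewrite f0 mul0r leNgt; apply/negP => fg0.
  have ff : l2ip f f = 0 by rewrite -nrm_sqr f0 expr0n.
  (* With [l2ip f f = 0] the quadratic form is affine in the first coefficient, and this value would
     make it equal to -1. *)
  have := key ((l2ip g g + 1) / (2 * l2ip f g)) 1.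
  rewrite ff mulr0 add0r expr1n mul1r mulr1 => H.
  have E : 2 * ((l2ip g g + 1) / (2 * l2ip f g)) * l2ip f g = l2ip g g + 1.
    by field; rewrite gt_eqF.
  rewrite E in H; lra.
have [g0|g0] := eqVneq (l2nrm g) 0.
  rewrite g0 mulr0 leNgt; apply/negP => fg0.
  have gg : l2ip g g = 0 by rewrite -nrm_sqr g0 expr0n.
  have := key 1 ((l2ip f f + 1) / (2 * l2ip f g)).
  rewrite gg mulr0 addr0 expr1n mul1r mulr1 => H.
  have E : 2 * ((l2ip f f + 1) / (2 * l2ip f g)) * l2ip f g = l2ip f f + 1.
    by field; rewrite gt_eqF.
  rewrite E in H; lra.
have nf : 0 < l2nrm f by rewrite lt_neqAle eq_sym f0 nrm_ge0.
have ng : 0 < l2nrm g by rewrite lt_neqAle eq_sym g0 nrm_ge0.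
have := key (l2nrm g) (l2nrm f); rewrite -!nrm_sqr => H.
have {}H : 0 <= (2 * (l2nrm f * l2nrm g)) * (l2nrm f * l2nrm g - l2ip f g) by nra.
rewrite pmulr_rge0 in H; first lra.
by rewrite !mulr_gt0.
Qed.

Lemma ip_norm_le f g : sq f -> sq g -> `|l2ip f g| <= l2nrm f * l2nrm g.
Proof.
move=> sf sg; rewrite ler_norml ip_le// andbT lerNl -ipNl//.
by rewrite -[l2nrm f]nrmN ip_le//; exact: sqN.
Qed.

Lemma nrmZ a f : sq f -> l2nrm (fun x => a * f x) = `|a| * l2nrm f.
Proof.
move=> sf; rewrite /l2nrm ipZl ?ipZr//; last exact: sqZ.
by rewrite mulrA -expr2 sqrtrM ?sqr_ge0// sqrtr_sqr.
Qed.

Lemma nrmD f g : sq f -> sq g -> l2nrm (fun x => f x + g x) <= l2nrm f + l2nrm g.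
Proof.
move=> sf sg; rewrite -(@ler_pXn2r _ 2)// ?nnegrE ?addr_ge0 ?nrm_ge0//.
rewrite nrm_sqr ipDl ?ipDr//; last exact: sqD.
rewrite (ipC g f) sqrrD !nrm_sqr; have := ip_le sf sg; lra.
Qed.

Lemma nrmB f g : sq f -> sq g -> l2nrm (fun x => f x - g x) <= l2nrm f + l2nrm g.
Proof. by move=> sf sg; rewrite -(nrmN g) nrmD//; exact: sqN. Qed.

Lemma nrm_tri f g h : sq f -> sq g -> sq h ->
  l2nrm (fun x => f x - h x) <= l2nrm (fun x => f x - g x) + l2nrm (fun x => g x - h x).
Proof.
move=> sf sg sh.
rewrite (_ : (fun x => f x - h x) = (fun x => (f x - g x) + (g x - h x))).
  by apply: nrmD; exact: sqB.
by apply/funext => x; rewrite addrA subrK.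
Qed.

Lemma nrm_le f g : sq f -> sq g -> (forall x, `|f x| <= `|g x|) ->
  l2nrm f <= l2nrm g.
Proof.
move=> sf sg fg; rewrite ler_wsqrtr// le_Rintegral//; [exact: sqM|exact: sqM|].
move=> x _; rewrite -!expr2 -[f x ^+ 2]real_normK ?num_real//.
by rewrite -[g x ^+ 2]real_normK ?num_real// ler_pXn2r// nnegrE.
Qed.

Lemma ip_ae f g h : sq f -> sq g -> sq h -> {ae mu, forall x, f x = g x} ->
  l2ip f h = l2ip g h.
Proof.
move=> [mf _] [mg _] [mh _] fg; rewrite /l2ip /Rintegral; congr fine.
apply: ae_eq_integral => //.
- by apply/measurable_EFinP; exact: measurable_funM.
- by apply/measurable_EFinP; exact: measurable_funM.
- by apply: filterS fg => x /= -> _.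
Qed.

Lemma nrm_ae f g : sq f -> sq g -> {ae mu, forall x, f x = g x} ->
  l2nrm f = l2nrm g.
Proof. by move=> sf sg fg; rewrite /l2nrm (ip_ae sf sg sf fg) ipC (ip_ae sf sg sg fg). Qed.

Lemma integral_sqr f : sq f -> (\int[mu]_x (f x ^+ 2)%:E = (l2ip f f)%:E)%E.
Proof.
move=> sf; rewrite /l2ip /Rintegral fineK; last first.
  by apply: integrable_fin_num => //; exact: sqM.
by apply: eq_integral => x _; rewrite expr2.
Qed.

Lemma nrm_eq0 f : sq f -> l2nrm f = 0 -> {ae mu, forall x, f x = 0}.
Proof.
move=> sf f0.
have H : (\int[mu]_x `|(f x ^+ 2)%:E| = 0)%E.
  under eq_integral do rewrite abse_EFin ger0_norm ?sqr_ge0//.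
  by rewrite integral_sqr// -nrm_sqr f0 expr0n.
have /ae_eq_integral_abs := H; move=> /(_ measurableT); case: sf => mf _.
have mf2 : measurable_fun setT (fun x => (f x ^+ 2)%:E : \bar R).
  by apply/measurable_EFinP; exact: measurable_funX.
move=> /(_ mf2); apply: filterS => x /= /(_ I) [] /eqP.
by rewrite sqrf_eq0 => /eqP.
Qed.

Lemma sq_Lfun f : f \in Lfun mu 2%:E <-> sq f.
Proof.
split=> [Lf|[mf fi]].
  split; last exact: Lfun2_integrable_sqr.
  by move: Lf; rewrite inE => /andP[/[!inE]].
rewrite inE; apply/andP; split; first by rewrite inE.
rewrite inE/= /finite_norm unlock/=.
rewrite poweR_lty//.
have /integrableP[_] := fi.
apply: le_lt_trans; apply: ge0_le_integral => //.
- apply/measurable_EFinP; apply: (measurableT_comp (measurable_powR 2)).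
  exact: measurableT_comp.
- apply/measurable_EFinP; apply: measurableT_comp => //; exact: measurable_funX.
move=> x _; rewrite lee_fin powR_mulrn// normrX//.
Qed.

Lemma Lnorm2 f : sq f -> ('N[mu]_2%:E[EFin \o f] = (l2nrm f)%:E)%E.
Proof.
move=> sf; rewrite unlock/=.
have -> : (\int[mu]_x `|(f x)%:E| `^ 2 = (l2ip f f)%:E)%E.
  rewrite -integral_sqr//; apply: eq_integral => x _.
  by rewrite /= powR_mulrn// real_normK// num_real.
by rewrite /l2nrm/= -powR12_sqrt// ip_ge0.
Qed.

Lemma Lnorm2_cvg0 (u : nat -> T -> R) : (forall n, sq (u n)) ->
  'N[mu]_2%:E[EFin \o u n]%E @[n --> \oo] --> 0%E <->
  l2nrm (u n) @[n --> \oo] --> 0.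
Proof.
move=> su; under eq_fun do rewrite Lnorm2//.
split => [/fine_cvgP[_]|H]; first exact.
by apply/fine_cvgP; split; [exact: nearW|exact: H].
Qed.

End square_integrable.

(** * Completeness of L^2 for a finite measure *)

Section completeness.
Context {disp : measure_display} {T : measurableType disp} {R : realType}.
Variable mu : {finite_measure set T -> \bar R}.

Lemma sq_cst (c : R) : sq mu (fun=> c).
Proof.
by split => //; exact: finite_measure_integrable_cst.
Qed.

Lemma sq_bounded (f : T -> R) M : measurable_fun setT f ->
  (forall x, `|f x| <= M) -> sq mu f.
Proof.
move=> mf fM; apply: (sq_le mf (sq_cst M)) => x.
by rewrite (le_trans (fM x))// ler_norm.
Qed.

Lemma sq_integrable (f : T -> R) : sq mu f -> mu.-integrable setT (EFin \o f).
Proof.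
by move=> sf; have := sqM sf (sq_cst 1); under eq_fun do rewrite mulr1.
Qed.

(** Riesz-Fischer at a geometric rate: since the measure is finite, the increments are summable in
    L^1 and hence almost everywhere, and Fatou's lemma bounds the distance to the limit. *)
Lemma sq_complete (u : nat -> T -> R) : (forall n, sq mu (u n)) ->
  (forall n k, (n <= k)%N -> l2nrm mu (fun x => u k x - u n x) <= 2^-1 ^+ n) ->
  exists2 f, sq mu f & forall n, l2nrm mu (fun x => f x - u n x) <= 2^-1 ^+ n.
Proof.
move=> su uC.
have mu_ n : measurable_fun setT (u n) by case: (su n).
pose d_ n x : \bar R := (`|u n.+1 x - u n x|)%:E.
have md n : measurable_fun setT (d_ n).
  by apply/measurable_EFinP; apply: measurableT_comp => //; exact: measurable_funB.
have d0 n x : (0 <= d_ n x)%E by rewrite lee_fin.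
pose C := l2nrm mu (fun=> 1).
have dle n : (\int[mu]_x d_ n x <= (C * 2^-1 ^+ n)%:E)%E.
  have sB : sq mu (fun x => u n.+1 x - u n x) by exact: sqB.
  have sN : sq mu (fun x => `|u n.+1 x - u n x|).
    apply: (sq_le _ sB) => [|x]; last by rewrite normr_id.
    by apply: measurableT_comp => //; exact: measurable_funB.
  have := ip_le (sq_cst 1) sN => H.
  rewrite (_ : (\int[mu]_x _)%E = (l2ip mu (fun=> 1) (fun x => `|u n.+1 x - u n x|))%:E).
    rewrite lee_fin (le_trans H)// ler_wpM2l ?nrm_ge0//.
    apply: le_trans (uC n n.+1 (leqnSn n)).
    by apply: nrm_le => // x; rewrite normr_id.
  rewrite /l2ip /Rintegral fineK; last first.
    by apply: integrable_fin_num => //; exact: (sqM (sq_cst 1) sN).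
  by apply: eq_integral => x _; rewrite mul1r.
have S_lty : (\int[mu]_x (\sum_(n <oo) d_ n x) < +oo)%E.
  rewrite integral_nneseries//.
  apply: (@le_lt_trans _ _ (\sum_(n <oo) ((C * 2^-1 ^+ n)%:E : \bar R))%E).
    by apply: lee_nneseries => // i _ _; exact: integral_ge0.
  apply: (@le_lt_trans _ _ (2 * C)%:E); last by rewrite ltry.
  apply: lime_le.
    by apply: is_cvg_nneseries => n _ _; rewrite lee_fin mulr_ge0// ?nrm_ge0// exprn_ge0.
  apply: nearW => n; rewrite sumEFin lee_fin.
  have -> : \sum_(0 <= k < n) C * 2^-1 ^+ k = 2 * C * (1 - 2^-1 ^+ n).
    elim: n => [|n IH]; first by rewrite big_geq// expr0 subrr mulr0.
    by rewrite big_nat_recr//= IH exprS; field.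
  have q0 : 0 <= 2^-1 ^+ n :> R by exact: exprn_ge0.
  have C0 : 0 <= C by exact: nrm_ge0.
  nra.
have mS : measurable_fun setT (fun x => \sum_(n <oo) d_ n x)%E.
  by apply: ge0_emeasurable_sum.
have iS : mu.-integrable setT (fun x => \sum_(n <oo) d_ n x)%E.
  apply/integrableP; split => //.
  by under eq_integral do rewrite gee0_abs ?nneseries_ge0//.
have uc : {ae mu, forall x, cvgn (u^~ x)}.
  have := integrable_ae measurableT iS; apply: filterS => x /(_ I) Sx.
  have sc : cvgn [normed series (telescope (u^~ x))].
    apply: nondecreasing_is_cvgn.
      by apply: nondecreasing_series => k _ _; exact: normr_ge0.
    exists (fine (\sum_(n <oo) d_ n x)%E) => _ [n _ <-].
    rewrite -lee_fin fineK//.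
    rewrite (_ : [normed series _] n = \sum_(0 <= k < n) `|u k.+1 x - u k x|).
      by rewrite -sumEFin; exact: nneseries_lim_ge.
    by rewrite /normed_series_of /= /series/=; apply: eq_bigr.
  have -> : u^~ x = (fun n => u 0%N x + series (telescope (u^~ x)) n).
    by apply/funext => n; rewrite -(eq_sum_telescope (u^~ x)).
  by apply: is_cvgD; [exact: is_cvg_cst|exact: normed_cvg].
(* The upper limit is measurable on the whole space and equals the limit wherever the sequence
   converges. *)
pose f x := fine (limn_esup (fun n => (u n x)%:E)).
have mf : measurable_fun setT f.
  have mfine : measurable_fun [set: \bar R] (@fine R) by exact: fine_measurable.
  apply: (measurableT_comp mfine).
  by apply: measurable_fun_limn_esup => n; exact/measurable_EFinP.
have fu x : cvgn (u^~ x) -> u n x @[n --> \oo] --> f x.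
  move=> cx; have H : (u n x)%:E @[n --> \oo] --> (limn (u^~ x))%:E.
    by apply: cvg_EFin; [exact: nearW|exact: cx].
  by rewrite /f (cvg_limn_einf_sup H).2.
have fn n : (\int[mu]_x ((f x - u n x) ^+ 2)%:E <= ((2^-1 ^+ n) ^+ 2)%:E)%E.
  have -> : (\int[mu]_x ((f x - u n x) ^+ 2)%:E =
      \int[mu]_x limn_einf (fun k => ((u k x - u n x) ^+ 2)%:E))%E.
    apply: ge0_ae_eq_integral => //.
    - by apply/measurable_EFinP; apply: measurable_funX; exact: measurable_funB.
    - rewrite (_ : (fun _ => _) = (fun x => - limn_esup
          (-%E \o (fun k => ((u k x - u n x) ^+ 2)%:E)))%E); last first.
        by apply/funext => x; rewrite limn_esupN oppeK.
      apply: measurableT_comp => //.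
      apply: measurable_fun_limn_esup => k; apply: measurableT_comp => //.
      apply/measurable_EFinP.
      by apply: measurable_funX; exact: measurable_funB.
    - by move=> x _; rewrite lee_fin sqr_ge0.
    - move=> x _; rewrite limn_einf_lim; apply: lime_ge; first exact: is_cvg_einfs.
      apply: nearW => k; apply: le_ereal_inf_tmp => _ [j _ <-].
      by rewrite lee_fin sqr_ge0.
    - apply: filterS uc => x /fu cx _; apply/esym.
      apply: (cvg_limn_einf_sup _).1.
      apply: cvg_EFin; first exact: nearW.
      rewrite expr2; under eq_fun do rewrite expr2.
      by apply: cvgM; apply: cvgB => //; exact: cvg_cst.
  apply: (le_trans (fatou _ _ _ _)) => //.
  - by move=> k; apply/measurable_EFinP; apply: measurable_funX; exact: measurable_funB.
  - by move=> k x _; rewrite lee_fin sqr_ge0.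
  rewrite limn_einf_lim; apply: lime_le; first exact: is_cvg_einfs.
  (* The index [maxn k n] lies in the tail from [k] and is also large enough for the Cauchy bound at
     [n]. *)
  apply: nearW => k; apply: (@le_trans _ _
      (\int[mu]_x ((u (maxn k n) x - u n x) ^+ 2)%:E)%E).
    by apply: ereal_inf_lbound; exists (maxn k n) => //=; exact: leq_maxl.
  rewrite integral_sqr; last exact: sqB.
  rewrite -nrm_sqr lee_fin ler_pXn2r// ?nnegrE ?nrm_ge0 ?exprn_ge0//.
  exact/uC/leq_maxr.
have sfu n : sq mu (fun x => f x - u n x).
  split; first exact: measurable_funB.
  apply/integrableP; split.
    by apply/measurable_EFinP; apply: measurable_funX; exact: measurable_funB.
  under eq_integral do rewrite abse_EFin ger0_norm ?sqr_ge0//.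
  by apply: le_lt_trans (fn n) _; rewrite ltry.
exists f => [|n].
  have := sqD (sfu 0%N) (su 0%N).
  by under eq_fun do rewrite subrK.
rewrite -(@ler_pXn2r _ 2)// ?nnegrE ?nrm_ge0 ?exprn_ge0//.
by rewrite nrm_sqr -lee_fin -integral_sqr.
Qed.

End completeness.

(** * Smooth functions *)

Section lines.
Context {R : realType} {V : normedModType R}.
Implicit Types (f g : V -> R) (x v : V) (s : R).

Lemma derivable_line f x v s :
  derivable (fun h : R => f (h *: v + x)) s 1 <-> derivable f (s *: v + x) v.
Proof.
rewrite /derivable; set g1 := fun h => h^-1 *: _; set g2 := fun h => h^-1 *: _.
suff -> : g1 = g2 by [].
by rewrite funeqE /g1 /g2 => h /=; rewrite [_%:A]mulr1 scalerDl addrA.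
Qed.

Lemma derive_line f x v s :
  'D_1 (fun h : R => f (h *: v + x)) s = 'D_v f (s *: v + x).
Proof.
rewrite /derive; set g1 := fun h => h^-1 *: _; set g2 := fun h => h^-1 *: _.
suff -> : g1 = g2 by [].
by rewrite funeqE /g1 /g2 => h /=; rewrite [_%:A]mulr1 scalerDl addrA.
Qed.

Lemma is_derive_line0 f x v l :
  is_derive (0 : R) 1 (fun h : R => f (h *: v + x)) l <-> is_derive x v f l.
Proof.
have H := derivable1P f x v.
have E : 'D_1 (fun h : R => f (h *: v + x)) 0 = 'D_v f x.
  by rewrite derive_line scale0r add0r.
by split => -[D <-]; (split; [exact/H|]); [exact/esym/E|exact: E].
Qed.

Lemma is_derive_line f x v s l :
  is_derive (s *: v + x) v f l -> is_derive s 1 (fun h : R => f (h *: v + x)) l.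
Proof. by move=> [df <-]; split; [apply/derivable_line|rewrite derive_line]. Qed.

Lemma derivable_continuous1 (h : R -> R) :
  (forall s, derivable h s 1) -> continuous h.
Proof. by move=> dh s; apply/differentiable_continuous/derivable1_diffP. Qed.

Lemma line_mvt f x v a : (forall y, derivable f y v) ->
  exists2 s, `|s| <= `|a| & f (a *: v + x) - f x = a * 'D_v f (s *: v + x).
Proof.
move=> df; pose h := fun t : R => f (t *: v + x).
have dh s : is_derive s 1 h ('D_v f (s *: v + x)).
  by apply: is_derive_line; split.
have ch : continuous h by apply: derivable_continuous1 => s; have [] := dh s.
have [a0|a0] := leP 0 a.
  have [c] := @MVT_segment R h _ 0 a a0 (fun s _ => dh s) (continuous_subspaceT ch).
  rewrite in_itv/= => /andP[c0 ca] E; exists c; first by rewrite !ger0_norm.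
  by move: E; rewrite /h scale0r add0r subr0 mulrC.
have [c] := @MVT_segment R h _ a 0 (ltW a0) (fun s _ => dh s) (continuous_subspaceT ch).
rewrite in_itv/= => /andP[ca c0] E; exists c.
  by rewrite !ler0_norm ?lerN2// ltW.
move: E; rewrite /h scale0r add0r => E.
by rewrite -opprB E sub0r mulrN opprK mulrC.
Qed.

Lemma is_derive_comp1 (h : R -> R) f x v l m : is_derive x v f l ->
  is_derive (f x) 1 h m -> is_derive x v (fun y => h (f y)) (m * l).
Proof.
move=> fl hm.
have fl' := (is_derive_line0 f x v l).2 fl.
have hm' : is_derive ((fun t : R => f (t *: v + x)) 0) 1 h m.
  by rewrite /= scale0r add0r.
apply/is_derive_line0.
exact: (is_derive1_comp hm' fl').
Qed.

End lines.

Section Ck.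
Context {R : realType} {d : nat}.
Local Notation V := 'rV[R]_d.
Local Notation ev i := (delta_mx 0 i : V).
Implicit Types (f g phi : V -> R).

Definition C0d phi : Prop :=
  continuous phi /\ forall i x, derivable phi x (ev i).

(** [smooth] quantifies over sequences of directions; counting derivatives instead turns the closure
    properties into inductions on [k]. *)
Fixpoint Ck k phi : Prop :=
  C0d phi /\ if k is k'.+1 then forall i, Ck k' (partial i phi) else True.

Lemma CkS k phi : Ck k.+1 phi <-> C0d phi /\ forall i, Ck k (partial i phi).
Proof. by []. Qed.

Lemma Ck0 phi : Ck 0 phi <-> C0d phi.
Proof. by split => [[]|]. Qed.

Lemma Ck_C0d k phi : Ck k phi -> C0d phi. Proof. by case: k => [|k] []. Qed.

Lemma CkW k phi : Ck k.+1 phi -> Ck k phi.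
Proof.
elim: k phi => [|k IH] phi /CkS[c0 H]; first exact/Ck0.
by apply/CkS; split=> // i; exact/IH/H.
Qed.

Lemma foldr_rcons_partial phi s i :
  foldr partial phi (rcons s i) = foldr partial (partial i phi) s.
Proof. by elim: s => //= j s ->. Qed.

Lemma smoothP phi : smooth phi <-> forall k, Ck k phi.
Proof.
split=> [sp k|cp s].
  elim: k phi sp => [|k IH] phi sp; first exact/Ck0/(sp [::]).
  apply/CkS; split=> [|i]; first exact: (sp [::]).
  by apply: IH => s; rewrite -foldr_rcons_partial; exact: sp.
elim/last_ind: s phi cp => [|s i IH] phi cp; first exact: (Ck_C0d (cp 0%N)).
by rewrite foldr_rcons_partial; apply: IH => k; have /CkS[_] := cp k.+1; apply.
Qed.

Lemma smooth_C0d phi : smooth phi -> C0d phi.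
Proof. by move=> /smoothP/(_ 0%N)/Ck_C0d. Qed.

Lemma smooth_continuous phi : smooth phi -> continuous phi.
Proof. by move=> /smooth_C0d[]. Qed.

Lemma smooth_partial i phi : smooth phi -> smooth (partial i phi).
Proof. by move=> sp s; rewrite -foldr_rcons_partial; exact: sp. Qed.

Lemma partial_cst i (c : R) : partial i (fun _ : V => c) = fun=> 0.
Proof. by apply/funext => x; exact: (@derive_cst _ _ _ c). Qed.

Lemma C0d_cst (c : R) : C0d (fun=> c).
Proof. by split=> [|i x]; [exact: cont_cst|exact: derivable_cst]. Qed.

Lemma Ck_cst k (c : R) : Ck k (fun=> c).
Proof.
elim: k c => [|k IH] c; first exact/Ck0/C0d_cst.
by apply/CkS; split; [exact: C0d_cst|move=> i; rewrite partial_cst].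
Qed.

Lemma is_partial_coord (i j : 'I_d) (x : V) :
  is_derive x (ev i) (fun y : V => y 0 j) (i == j)%:R.
Proof.
apply/is_derive_line0.
rewrite (_ : (fun h => _) = (fun h => (i == j)%:R * h + x 0 j)).
  by apply: is_derive_eq; rewrite addr0 [_ *: _]mulr1.
by apply/funext => h; rewrite !mxE eqxx eq_sym mulrC.
Qed.

Lemma Ck_coord k (j : 'I_d) : Ck k (fun x : V => x 0 j).
Proof.
have c0 : C0d (fun x : V => x 0 j).
  split=> [|i x]; first exact: coord_continuous.
  by have [] := is_partial_coord i j x.
case: k => [|k]; first exact/Ck0.
apply/CkS; split=> // i.
rewrite (_ : partial i _ = fun=> (i == j)%:R); first exact: Ck_cst.
by apply/funext => x; have [_] := is_partial_coord i j x.
Qed.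

Lemma partial_add i f g : C0d f -> C0d g ->
  partial i (fun x => f x + g x) = fun x => partial i f x + partial i g x.
Proof. by move=> [_ df] [_ dg]; apply/funext => x; exact: deriveD. Qed.

Lemma C0d_add f g : C0d f -> C0d g -> C0d (fun x => f x + g x).
Proof.
move=> [cf df] [cg dg]; split; first exact: cont_add.
by move=> i x; exact: derivableD.
Qed.

Lemma Ck_add k f g : Ck k f -> Ck k g -> Ck k (fun x => f x + g x).
Proof.
elim: k f g => [|k IH] f g.
  by move=> /Ck0 cf /Ck0 cg; exact/Ck0/C0d_add.
move=> /CkS[cf Hf] /CkS[cg Hg]; apply/CkS; split; first exact: C0d_add.
by move=> i; rewrite partial_add//; apply: IH; [exact: Hf|exact: Hg].
Qed.

Lemma partial_mul i f g : C0d f -> C0d g ->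
  partial i (fun x => f x * g x) =
  fun x => f x * partial i g x + g x * partial i f x.
Proof. by move=> [_ df] [_ dg]; apply/funext => x; exact: deriveM. Qed.

Lemma C0d_mul f g : C0d f -> C0d g -> C0d (fun x => f x * g x).
Proof.
move=> [cf df] [cg dg]; split; first exact: cont_mul.
by move=> i x; exact: derivableM.
Qed.

Lemma Ck_mul k f g : Ck k f -> Ck k g -> Ck k (fun x => f x * g x).
Proof.
elim: k f g => [|k IH] f g.
  by move=> /Ck0 cf /Ck0 cg; exact/Ck0/C0d_mul.
move=> cf cg; have /CkS[cf0 Hf] := cf; have /CkS[cg0 Hg] := cg.
apply/CkS; split; first exact: C0d_mul.
move=> i; rewrite partial_mul//; apply: Ck_add; apply: IH.
- exact: CkW.
- exact: Hg.
- exact: CkW.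
- exact: Hf.
Qed.

Lemma Ck_opp k f : Ck k f -> Ck k (fun x => - f x).
Proof.
by move=> /(Ck_mul (Ck_cst k (-1))); under eq_fun do rewrite mulN1r.
Qed.

Lemma Ck_sub k f g : Ck k f -> Ck k g -> Ck k (fun x => f x - g x).
Proof. by move=> cf /Ck_opp; exact: Ck_add. Qed.

Lemma Ck_sum k (I : Type) (s : seq I) (f : I -> V -> R) :
  (forall i, Ck k (f i)) -> Ck k (fun x => \sum_(i <- s) f i x).
Proof.
move=> cf; elim: s => [|i s IH].
  by under eq_fun do rewrite big_nil; exact: Ck_cst.
by under eq_fun do rewrite big_cons; exact: Ck_add.
Qed.

Lemma Ck_dot k (e : V) : Ck k (fun x => dot x e).
Proof.
by apply: Ck_sum => i; apply: Ck_mul; [exact: Ck_coord|exact: Ck_cst].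
Qed.

Lemma C0d_near phi :
  (forall x, exists2 psi, C0d psi & \forall y \near (x : V), psi y = phi y) ->
  C0d phi.
Proof.
move=> H; split=> [x|i x]; have [psi [cp dp] E] := H x.
  have Ex := nbhs_singleton E.
  rewrite /continuous_at -Ex; apply: cvg_trans (cp x).
  exact: (@near_eq_cvg _ _ (nbhs x) _ psi phi E).
exact: near_eq_derivable (dp i x).
Qed.

(** Locality of smoothness, by which the two sides of [sgnp] are glued across the hyperplane. *)
Lemma Ck_near k phi :
  (forall x, exists2 psi, Ck k psi & \forall y \near (x : V), psi y = phi y) ->
  Ck k phi.
Proof.
elim: k phi => [|k IH] phi H.
  apply/Ck0/C0d_near => x; have [psi /Ck0 cp E] := H x; by exists psi.
apply/CkS; split.
  apply/C0d_near => x; have [psi /Ck_C0d cp E] := H x; by exists psi.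
move=> i; apply: IH => x; have [psi /CkS[_ cp] E] := H x.
exists (partial i psi); first exact: cp.
have := near_join E; apply: filterS => y; exact: near_eq_derive.
Qed.

(* The increment is telescoped along the coordinate axes and each step is
   controlled by the mean value theorem. *)
Lemma is_derive_dir phi (x v : V) : C0d phi ->
  (forall i, continuous (partial i phi)) ->
  is_derive x v phi (\sum_i v 0 i * partial i phi x).
Proof.
move=> [_ dphi] cp.
pose L := \sum_i v 0 i * partial i phi x.
pose w (n : nat) (h : R) : V := \row_i (if (i < n)%N then h * v 0 i else 0).
have wn h : w d h = h *: v.
  by apply/rowP => i; rewrite !mxE ltn_ord.
have w0 h : w 0%N h = 0 by apply/rowP => i; rewrite !mxE.
have wS (i : 'I_d) h : w i.+1 h = (h * v 0 i) *: ev i + w i h.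
  apply/rowP => j; rewrite !mxE eqxx/= ltnS leq_eqVlt.
  have [->|ji] := eqVneq j i; first by rewrite eqxx ltnn mulr1 addr0.
  by rewrite mulr0 add0r -val_eqE in ji *; rewrite (negbTE ji).
pose M := \sum_i `|v 0 i|.
have vM i : `|v 0 i| <= M.
  by rewrite /M (bigD1 i)//= lerDl sumr_ge0.
have M0 : 0 <= M by apply: sumr_ge0.
suff H : h^-1 *: (phi (h *: v + x) - phi x) @[h --> 0^'] --> L.
  by split; [apply/cvg_ex; exists L|exact: cvg_lim H].
apply/cvgrPdist_le => e e0.
pose eps := e / (M + 1).
have eps0 : 0 < eps by rewrite divr_gt0// ltr_wpDl.
have [r r0 Hr] : exists2 r, 0 < r &
    forall i y, `|y| < r -> `|partial i phi x - partial i phi (y + x)| <= eps.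
  have : \forall y \near x, forall i, `|partial i phi x - partial i phi y| <= eps.
    have Hi i : \forall y \near x, `|partial i phi x - partial i phi y| <= eps.
      by have /cvgrPdist_le := cp i x; apply.
    exact: (@filter_forall _ _ (fun i y => `|partial i phi x - partial i phi y| <= eps)
      (nbhs x) _ Hi).
  move=> /nbhs_normP[r /= r0 Hr]; exists r => // i y yr.
  by apply: Hr; rewrite /= opprD addrCA subrr addr0 normrN.
(* One [M] bounds the displacement in the current coordinate, the other that of the coordinates
   already moved. *)
have step (i : 'I_d) h : `|h| * (M + M) < r ->
  `|phi (w i.+1 h + x) - phi (w i h + x) - h * (v 0 i * partial i phi x)|
    <= `|h| * (`|v 0 i| * eps).
  move=> hr; rewrite wS -(addrA _ (w i h) x).
  have [s sh ->] := line_mvt (w i h + x) (h * v 0 i) (fun y => dphi i y).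
  rewrite -mulrA -mulrBr -mulrBr !normrM.
  apply: ler_wpM2l => //; apply: ler_wpM2l => //.
  rewrite distrC addrA; apply: Hr; apply: le_lt_trans hr.
  rewrite mulrDr; apply: le_trans (ler_normD _ _) _; apply: lerD.
    rewrite normrZ; apply: le_trans (_ : `|h * v 0 i| * 1 <= _).
      apply: ler_pM => //; rewrite /Num.norm/= mx_normrE; apply: bigmax_le => // -[j k] _ /=.
      by rewrite ord1 !mxE eqxx/=; case: eqP; rewrite ?normr1 ?normr0.
    by rewrite mulr1 normrM ler_wpM2l.
  rewrite [leLHS]/Num.norm/= mx_normrE; apply: bigmax_le => [|[j k] _ /=].
    exact: mulr_ge0.
  rewrite !mxE; case: ifP => _; last by rewrite normr0 mulr_ge0.
  by rewrite normrM ler_wpM2l.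
have tel h : `|h| * (M + M) < r ->
    `|phi (h *: v + x) - phi x - h * L| <= `|h| * e.
  move=> hr.
  have -> : phi (h *: v + x) - phi x - h * L =
    \sum_(i < d) (phi (w i.+1 h + x) - phi (w i h + x) - h * (v 0 i * partial i phi x)).
    rewrite sumrB -mulr_sumr; congr (_ - _).
    have := @telescope_sumr _ 0 d (fun n => phi (w n h + x)) isT.
    by rewrite big_mkord w0 add0r wn.
  apply: le_trans (ler_norm_sum _ _ _) _.
  apply: (@le_trans _ _ (\sum_(i < d) `|h| * (`|v 0 i| * eps))).
    by apply: ler_sum => i _; exact: step.
  rewrite -mulr_sumr ler_wpM2l// -mulr_suml /eps mulrA ler_pdivrMr ?ltr_wpDl//.
  by rewrite mulrC ler_wpM2l ?(ltW e0)// lerDl.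
have : \forall h \near (0 : R)^', `|h| * (M + M) < r.
  pose q := r / (M + M + 1).
  have q0 : 0 < q by rewrite divr_gt0// ltr_wpDl// addr_ge0.
  have : \forall h \near (0 : R)^', `|h| < q by apply: dnbhs0_lt.
  apply: filterS => h hq; apply: (@le_lt_trans _ _ (`|h| * (M + M + 1))).
    by rewrite ler_wpM2l// lerDl.
  by rewrite -ltr_pdivlMr// ltr_wpDl// addr_ge0.
move=> nr; near=> h.
have hr : `|h| * (M + M) < r by near: h.
have h0 : h != 0 by near: h; exact: nbhs_dnbhs_neq.
rewrite distrC [_ *: _]mulrC.
rewrite -(ler_pM2l (_ : 0 < `|h|)) ?normr_gt0// -normrM mulrBr mulrCA.
by rewrite mulfV// mulr1; exact: tel.
Unshelve. all: by end_near. Qed.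

Lemma derive_dir phi (x v : V) : Ck 1 phi ->
  'D_v phi x = \sum_i v 0 i * partial i phi x.
Proof.
move=> /CkS[c0 cp].
have cpj j : continuous (partial j phi) by have /Ck_C0d[] := cp j.
by have [] := is_derive_dir x v c0 cpj.
Qed.

Lemma partial_refl (e : V) i phi : Ck 1 phi ->
  partial i (phi \o refl e) =
  fun x => \sum_j refl e (ev i) 0 j * partial j phi (refl e x).
Proof.
move=> H; apply/funext => x; rewrite /partial.
rewrite -[in LHS](add0r x) -(scale0r (ev i)) -(derive_line (phi \o refl e)).
rewrite (_ : (fun h => _) = (fun h => phi (h *: refl e (ev i) + refl e x))); last first.
  by apply/funext => h /=; rewrite reflD reflZ.
by rewrite derive_line scale0r add0r derive_dir.
Qed.

(** One order is lost because a derivative along a reflected axis is computed from continuous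
    partial derivatives; for smooth functions this costs nothing. *)
Lemma Ck_refl (e : V) k phi : Ck k.+1 phi -> Ck k (phi \o refl e).
Proof.
elim: k phi => [|k IH] phi H.
  have /CkS[[cp dp] cpp] := H; apply/Ck0; split.
    by move=> x; apply: continuous_comp; [exact: continuous_refl|exact: cp].
  move=> i x; apply/derivable1P.
  rewrite (_ : (fun h => _) = (fun h => phi (h *: refl e (ev i) + refl e x))).
    apply: (derivable1P phi (refl e x) (refl e (ev i))).1.
    have cpj j : continuous (partial j phi) by have /Ck_C0d[] := cpp j.
    by have [] := is_derive_dir (refl e x) (refl e (ev i)) (conj cp dp) cpj.
  by apply/funext => h /=; rewrite reflD reflZ.
have C0 := Ck_C0d (IH _ (CkW H)).
apply/CkS; split=> // i; have /CkS[_ Hp] := H.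
have H1 : Ck 1 phi by elim: k {IH C0 Hp} H => [/CkW//|k IH /CkW].
rewrite partial_refl//.
apply: Ck_sum => j; apply: Ck_mul; first exact: Ck_cst.
exact/IH/Hp.
Qed.

Lemma smooth_refl (e : V) phi : smooth phi -> smooth (phi \o refl e).
Proof. by move=> /smoothP H; apply/smoothP => k; exact: Ck_refl. Qed.

Fixpoint Rk k (h : R -> R) : Prop :=
  (forall s, derivable h s 1) /\ if k is k'.+1 then Rk k' (h^`()%classic) else True.

Lemma Rk_derivable k h : Rk k h -> forall s, derivable h s 1.
Proof. by case: k => [|k] []. Qed.

Lemma partial_comp i (h : R -> R) phi : (forall s, derivable h s 1) -> C0d phi ->
  partial i (fun x => h (phi x)) = fun x => h^`()%classic (phi x) * partial i phi x.
Proof.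
move=> dh [_ dphi]; apply/funext => x.
have [_] := @is_derive_comp1 R V h phi x (ev i) _ _ (derivableP (dphi i x)) (derivableP (dh (phi x))).
by rewrite -derive1E.
Qed.

Lemma Ck_comp k (h : R -> R) phi : Rk k h -> Ck k phi -> Ck k (fun x => h (phi x)).
Proof.
have C0 (h0 : R -> R) (f : V -> R) : (forall s, derivable h0 s 1) -> C0d f -> C0d (fun x => h0 (f x)).
  move=> dh [cf df]; split.
    by apply: cont_comp => //; exact: derivable_continuous1.
  move=> i x.
  by have [] := @is_derive_comp1 R V h0 f x (ev i) _ _ (derivableP (df i x)) (derivableP (dh (f x))).
elim: k h phi => [|k IH] h phi Hh Hp.
  by apply/Ck0/C0; [exact: Rk_derivable Hh|exact: Ck_C0d Hp].
apply/CkS; split; first by apply: C0; [exact: Rk_derivable Hh|exact: Ck_C0d Hp].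
move=> i; rewrite partial_comp; last 2 first.
- exact: Rk_derivable Hh.
- exact: Ck_C0d Hp.
apply: Ck_mul; last by have /CkS[_] := Hp.
by apply: IH; [case: Hh|exact: CkW].
Qed.

End Ck.

(** * Smooth cut-off functions of one variable *)

Section bump.
Context {R : realType}.
Implicit Types (s y : R) (n k : nat).

(** The factor [s^-n] closes the family under differentiation: the derivative of a member is a
    combination of the next two, so smoothness is an induction. *)
Definition bumpn n s : R := if 0 < s then s^-1 ^+ n * expR (- s^-1) else 0.

Lemma bumpn_ge0 n s : 0 <= bumpn n s.
Proof.
rewrite /bumpn; case: ltP => // s0.
by rewrite mulr_ge0 ?expR_ge0// exprn_ge0// invr_ge0 ltW.
Qed.

Lemma bumpn_gt0 n s : 0 < s -> 0 < bumpn n s.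
Proof.
by move=> s0; rewrite /bumpn s0 mulr_gt0 ?expR_gt0// exprn_gt0// invr_gt0.
Qed.

Lemma bumpn_eq0 n s : s <= 0 -> bumpn n s = 0.
Proof. by rewrite /bumpn leNgt => /negbTE ->. Qed.

(** From [exp y >= y^(n+2) / (n+2)!] at [y = 1/s]. The quadratic bound is what makes the derivative
    at the origin vanish. *)
Lemma bumpn_le n s : 0 < s -> bumpn n s <= n.+2`!%:R * s ^+ 2.
Proof.
move=> s0; rewrite /bumpn s0 expRN ler_pdivrMr ?expR_gt0//.
have y0 : 0 <= s^-1 by rewrite invr_ge0 ltW.
have := expR_ge1Dxn n.+1 y0.
set E := expR _ => H.
have f0 : 0 < n.+2`!%:R :> R by rewrite ltr0n fact_gt0.
have {}H : s^-1 ^+ n.+2 <= n.+2`!%:R * E.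
  rewrite mulrC -ler_pdivrMr//; lra.
have -> : s^-1 ^+ n = s ^+ 2 * s^-1 ^+ n.+2.
  have s21 : s ^+ 2 * s^-1 ^+ 2 = 1 by rewrite -exprMn divff ?gt_eqF// expr1n.
  by rewrite -[n.+2]addn2 exprD mulrCA s21 mulr1.
by rewrite [in leRHS]mulrAC [leRHS]mulrC ler_wpM2l// sqr_ge0.
Qed.

Lemma is_derive_bumpn n s :
  is_derive s 1 (bumpn n) (- n%:R * bumpn n.+1 s + bumpn n.+2 s).
Proof.
have [s0|s0|s0] := ltgtP s 0; last first.
- rewrite s0 !bumpn_eq0// mulr0 addr0.
  suff H : h^-1 *: (bumpn n (h *: 1 + 0) - bumpn n 0) @[h --> 0^'] --> (0 : R).
    by split; [apply/cvg_ex; exists 0|exact: cvg_lim H].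
  apply/cvgrPdist_le => e e0.
  pose q := e / n.+2`!%:R.
  have f0 : 0 < n.+2`!%:R :> R by rewrite ltr0n fact_gt0.
  have q0 : 0 < q by rewrite divr_gt0.
  have : \forall h \near (0 : R)^', `|h| < q by apply: dnbhs0_lt.
  apply: filterS => h hq.
  rewrite sub0r normrN addr0 [_ *: 1]mulr1 [bumpn n 0]bumpn_eq0// subr0.
  have [h0|h0] := leP h 0; first by rewrite bumpn_eq0// scaler0 normr0 ltW.
  rewrite normrM ger0_norm ?invr_ge0 ?(ltW h0)// ger0_norm ?bumpn_ge0//.
  rewrite ler_pdivrMl//; apply: le_trans (bumpn_le n h0) _.
  move: hq; rewrite gtr0_norm// ltr_pdivlMr// => hq.
  rewrite expr2 mulrA [h * e]mulrC ler_wpM2r ?(ltW h0)//.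
  by rewrite mulrC ltW.
- have E : \forall t \near s, t^-1 ^+ n * expR (- t^-1) = bumpn n t.
    by near=> t; rewrite /bumpn ifT//; near: t; exact: lt_nbhsr.
  apply: (near_eq_is_derive E).
  have dV : is_derive s 1 (fun t : R => t^-1) (- s ^- 2).
    have s1 : s != 0 by rewrite gt_eqF.
    have H := @derivable_id _ R s 1.
    split; first exact: (@derivableV _ _ id s 1 s1 H).
    by rewrite (@deriveV _ _ id s 1 s1 H) derive_id /GRing.scale/= mulr1.
  have dh : is_derive (s^-1) 1 (fun y => y ^+ n * expR (- y))
      (n%:R * s^-1 ^+ n.-1 * expR (- s^-1) - s^-1 ^+ n * expR (- s^-1)).
    have dX : is_derive (s^-1) 1 (fun y : R => y ^+ n) (n%:R * s^-1 ^+ n.-1).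
      split; first exact: exprn_derivable.
      by rewrite exp_derive /GRing.scale/= mulr1.
    have dE : is_derive (s^-1) 1 (fun y : R => expR (- y)) (- expR (- s^-1)).
      have dN : is_derive (s^-1) 1 (fun y : R => - y) (- 1) by apply: is_derive_eq.
      have := is_derive_comp1 dN (is_derive_expR (- s^-1)).
      by rewrite mulrN1.
    have [D Ed] := is_deriveM dX dE.
    split; first exact: D.
    by rewrite [LHS]Ed /GRing.scale/=; ring.
  have := is_derive1_comp dh dV.
  move=> [D /= Ed]; split; first exact: D.
  rewrite [LHS]Ed /bumpn s0.
  case: n {E dh D Ed} => [|n]/=; rewrite -exprVn !exprS ?expr0; ring.
- have E : \forall t \near s, (0 : R) = bumpn n t.
    by near=> t; rewrite bumpn_eq0// ltW//; near: t; exact: lt_nbhsl.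
  rewrite !bumpn_eq0 ?ltW// mulr0 addr0.
  apply: (near_eq_is_derive E); exact: is_derive_cst.
Unshelve. all: by end_near. Qed.

Lemma derivable_bumpn n s : derivable (bumpn n) s 1.
Proof. by have [] := is_derive_bumpn n s. Qed.

Lemma continuous_bumpn n : continuous (bumpn n).
Proof. by apply: derivable_continuous1 => s; exact: derivable_bumpn. Qed.

Lemma derive1_bumpn n : (bumpn n)^`()%classic =
  fun s => - n%:R * bumpn n.+1 s + bumpn n.+2 s.
Proof.
by apply/funext => s; rewrite derive1E; have [_] := is_derive_bumpn n s.
Qed.

Lemma Rk_lin k (a b : R) (f g : R -> R) : Rk k f -> Rk k g ->
  Rk k (fun s => a * f s + b * g s).
Proof.
elim: k f g => [|k IH] f g.
  move=> [df _] [dg _]; split=> [s|//].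
  apply: derivableD; apply: derivableM; [|exact: df| |exact: dg];
    exact: derivable_cst.
move=> [df Hf] [dg Hg].
have ds s : is_derive s 1 (fun s => a * f s + b * g s)
    (a * f^`()%classic s + b * g^`()%classic s).
  have := derivableP (df s); have := derivableP (dg s) => ig if_.
  apply: is_derive_eq; rewrite !derive1E /GRing.scale/=; ring.
split=> [s|]; first by have [] := ds s.
rewrite (_ : _^`()%classic = fun s => a * f^`()%classic s + b * g^`()%classic s).
  exact: IH.
by apply/funext => s; rewrite derive1E; have [_] := ds s.
Qed.

Lemma Rk_bumpn k n : Rk k (bumpn n).
Proof.
elim: k n => [|k IH] n; first by split=> // s; exact: derivable_bumpn.
split=> [s|]; first exact: derivable_bumpn.
rewrite derive1_bumpn.
have := Rk_lin (- n%:R) 1 (IH n.+1) (IH n.+2).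
by under eq_fun do rewrite mul1r.
Qed.

Lemma bump0_le1 s : bumpn 0 s <= 1.
Proof.
rewrite /bumpn; case: ltP => // s0; rewrite mul1r -expR0 ler_expR.
by rewrite lerNl oppr0 invr_ge0 ltW.
Qed.

(* The ramp (s - dl)^+ times exp(- dl / (s - dl)); its slope is (1 + u) exp(- u)
   with u = dl / (s - dl), hence at most 1. *)
Definition theta (dl : R) s : R := (s - dl) * bumpn 0 ((s - dl) / dl).

Definition dtheta (dl : R) s : R :=
  bumpn 0 ((s - dl) / dl) + bumpn 1 ((s - dl) / dl).

Lemma theta_eq0 dl s : 0 < dl -> s <= dl -> theta dl s = 0.
Proof.
move=> dl0 sd; rewrite /theta bumpn_eq0 ?mulr0// pmulr_lle0 ?invr_gt0//.
by rewrite subr_le0.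
Qed.

Lemma theta_le dl s : 0 < dl -> 0 <= s -> theta dl s <= s.
Proof.
move=> dl0 s0; have [sd|sd] := leP s dl; first by rewrite theta_eq0.
rewrite /theta; have := bump0_le1 ((s - dl) / dl).
have := bumpn_ge0 0 ((s - dl) / dl); nra.
Qed.

(** From [exp (-u) >= 1 - u] with [u = dl / (s - dl)]. *)
Lemma theta_ge dl s : 0 < dl -> s - 2 * dl <= theta dl s.
Proof.
move=> dl0; have [sd|sd] := leP s dl.
  by rewrite theta_eq0//; lra.
have z0 : 0 < (s - dl) / dl by rewrite divr_gt0// subr_gt0.
rewrite /theta /bumpn z0 expr0 mul1r invf_div.
have H := expR_ge1Dx (- (dl / (s - dl))).
apply: (@le_trans _ _ ((s - dl) * (1 - dl / (s - dl)))); last first.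
  by rewrite ler_wpM2l// subr_ge0 ltW.
rewrite mulrBr mulr1 mulrCA divff ?mulr1; last by rewrite subr_eq0 gt_eqF.
by lra.
Qed.

Lemma dtheta_ge0 dl s : 0 <= dtheta dl s.
Proof. by rewrite addr_ge0// bumpn_ge0. Qed.

Lemma dtheta_le1 dl s : dtheta dl s <= 1.
Proof.
rewrite /dtheta; set z := _ / _; rewrite /bumpn; case: ltP => // z0.
rewrite expr0 expr1 -mulrDl expRN ler_pdivrMr ?expR_gt0// mul1r.
exact: expR_ge1Dx.
Qed.

Lemma is_derive_theta dl s : 0 < dl -> is_derive s 1 (theta dl) (dtheta dl s).
Proof.
move=> dl0.
have dz : is_derive s 1 (fun t : R => (t - dl) / dl) dl^-1.
  by apply: is_derive_eq; rewrite /GRing.scale/=; ring.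
have db := @is_derive_comp1 R R (bumpn 0) (fun t : R => (t - dl) / dl) s 1 _ _
  dz (is_derive_bumpn 0 ((s - dl) / dl)).
have dl' : is_derive s 1 (fun t : R => t - dl) 1.
  by apply: is_derive_eq; rewrite subr0.
have [D E] := is_deriveM dl' db.
split; first exact: D.
rewrite [LHS]E /dtheta /GRing.scale/= mulr1 addrC; congr (_ + _).
set z := (s - dl) / dl.
rewrite oppr0 mul0r add0r mulrA mulrAC -/z /bumpn.
case: ltP => z0; last by rewrite mulr0.
by rewrite exprS expr1 !mulrA divff ?mul1r// gt_eqF.
Qed.

End bump.

(** * Test functions on the ball *)

Section test_functions.
Context {R : realType} {d : nat}.
Local Notation V := 'rV[R]_d.
Implicit Types (phi psi : V -> R).

Lemma closed_enorm_le (r : R) : closed [set x : V | enorm x <= r].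
Proof.
apply: (@closed_comp _ _ (@enorm R d) [set z | z <= r]).
  by move=> x _; exact: continuous_enorm.
exact: closed_le.
Qed.

Lemma compact_enorm_le (r : R) : compact [set x : V | enorm x <= r].
Proof.
apply: bounded_closed_compact; last exact: closed_enorm_le.
exists r; split; first exact: num_real.
move=> M rM x /= xr; apply: le_trans (norm_le_enorm x) _.
by rewrite (le_trans xr)// ltW.
Qed.

(** The norm attains its maximum on the compact support, and that maximum is below 1; the radius is
    taken halfway between it and 1. *)
Lemma test_functionP phi : test_function phi <->
  smooth phi /\ exists2 r, 0 < r < 1 & forall x, r <= enorm x -> phi x = 0.
Proof.
split=> [[sphi csupp suppD]|[sphi [r /andP[r0 r1] Hr]]].
  split=> //; set S := closure _ in csupp suppD.
  have [[x0 Sx0]|/forallNP S0] := pselect (exists x, S x); last first.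
    exists 2^-1 => [|x _]; first by rewrite invr_gt0 ltr0n/= invf_lt1// ltr1n.
    apply/eqP/negPn/negP => px; apply: (S0 x).
    exact: subset_closure.
  have [c Sc Hc] := @compact_EVT_max _ R (@enorm R d) S (ex_intro _ x0 Sx0)
    csupp (continuous_subspaceT (@continuous_enorm R d)).
  have c1 : enorm c < 1.
    have Sc' : S c by rewrite inE in Sc.
    by have := suppD c Sc'; rewrite /unit_ball/eball/= subr0.
  have c0 := enorm_ge0 c.
  exists ((enorm c + 1) / 2); first by apply/andP; split; lra.
  move=> x xr; apply/eqP/negPn/negP => px.
  have Sx : S x by exact: subset_closure.
  have := Hc x; rewrite inE => /(_ Sx); lra.
have sub : closure [set x | phi x != 0] `<=` [set x : V | enorm x <= r].
  rewrite [X in _ `<=` X]((closure_id _).1 (@closed_enorm_le r)).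
  apply: closureS => x /= px; rewrite leNgt; apply: contra px => xr.
  by rewrite Hr// ltW.
split=> //.
  apply: subclosed_compact sub; first exact: closed_closure.
  exact: compact_enorm_le.
by move=> x /sub/= xr; rewrite /unit_ball/eball/= subr0 (le_lt_trans xr).
Qed.

Lemma test_smooth phi : test_function phi -> smooth phi.
Proof. by case/test_functionP. Qed.

Lemma test_C0d phi : test_function phi -> C0d phi.
Proof. by move=> /test_smooth/smooth_C0d. Qed.

Lemma test_continuous phi : test_function phi -> continuous phi.
Proof. by move=> /test_C0d[]. Qed.

Lemma test_measurable phi : test_function phi -> measurable_fun setT phi.
Proof. by move=> /test_continuous/continuous_measurable_rV. Qed.

Lemma test_eq0 phi x : test_function phi -> 1 <= enorm x -> phi x = 0.
Proof.
move=> /test_functionP[_ [r /andP[r0 r1] H]] x1; apply: H.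
by rewrite (le_trans (ltW r1)).
Qed.

Lemma test_add phi psi : test_function phi -> test_function psi ->
  test_function (fun x => phi x + psi x).
Proof.
move=> /test_functionP[/smoothP sp [r r01 H]] /test_functionP[/smoothP sq' [s s01 K]].
apply/test_functionP; split; first by apply/smoothP => k; exact: Ck_add.
exists (Num.max r s); first by rewrite /Num.max; case: ifP.
by move=> x; rewrite ge_max => /andP[/H -> /K ->]; rewrite addr0.
Qed.

Lemma test_mul phi psi : test_function phi -> smooth psi ->
  test_function (fun x => phi x * psi x).
Proof.
move=> /test_functionP[/smoothP sp [r r01 H]] /smoothP sq'.
apply/test_functionP; split; first by apply/smoothP => k; exact: Ck_mul.
by exists r => // x /H ->; rewrite mul0r.
Qed.

Lemma smooth_cst (c : R) : smooth (fun _ : V => c).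
Proof. by apply/smoothP => k; exact: Ck_cst. Qed.

Lemma test_scale (c : R) phi : test_function phi ->
  test_function (fun x => c * phi x).
Proof.
move=> tp; have := test_mul tp (smooth_cst c).
by rewrite (_ : (fun x => phi x * c) = (fun x => c * phi x))//; apply/funext => x; rewrite mulrC.
Qed.

Lemma test_opp phi : test_function phi -> test_function (fun x => - phi x).
Proof.
move=> /(test_scale (-1)).
by rewrite (_ : (fun x => -1 * phi x) = (fun x => - phi x))//; apply/funext => x; rewrite mulN1r.
Qed.

Lemma test_sub phi psi : test_function phi -> test_function psi ->
  test_function (fun x => phi x - psi x).
Proof. by move=> tp /test_opp; exact: test_add. Qed.

Lemma test_partial i phi : test_function phi -> test_function (partial i phi).
Proof.
move=> /test_functionP[sp [r /andP[r0 r1] H]].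
apply/test_functionP; split; first exact: smooth_partial.
exists ((r + 1) / 2) => [|x xr]; first by apply/andP; split; lra.
have E : \forall y \near x, (fun _ : V => 0 : R) y = phi y.
  have : \forall y \near x, r < enorm y.
    have /cvgr_gt := @continuous_enorm R d x; apply; lra.
  by apply: filterS => y yr; rewrite H// ltW.
by rewrite /partial -(near_eq_derive _ E); exact: (@derive_cst _ _ _ (0 : R)).
Qed.

Lemma test_refl (e : V) phi : enorm e = 1 -> test_function phi ->
  test_function (phi \o refl e).
Proof.
move=> e1 /test_functionP[sp [r r01 H]].
apply/test_functionP; split; first exact: smooth_refl.
by exists r => // x xr /=; rewrite H// enorm_refl.
Qed.

Lemma test_zero : test_function (fun _ : V => 0 : R).
Proof.
apply/test_functionP; split; first exact: smooth_cst.
by exists 2^-1 => //; rewrite invr_gt0 ltr0n/= invf_lt1// ltr1n.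
Qed.

Lemma test_bounded phi : test_function phi ->
  exists2 M, 0 <= M & forall x, `|phi x| <= M.
Proof.
move=> tp; have cn : continuous (fun x => `|phi x|).
  apply: (cont_comp (h := fun z : R => `|z|)); last exact: test_continuous.
  exact: norm_continuous.
have ne : [set x : V | enorm x <= 1] !=set0 by exists 0; rewrite /= enorm0.
have [c _ Hc] := @compact_EVT_max _ R (fun x => `|phi x|) _ ne
  (@compact_enorm_le 1) (continuous_subspaceT cn).
exists `|phi c| => // x; have [x1|x1] := leP (enorm x) 1.
  by apply: Hc; rewrite inE.
by rewrite (test_eq0 tp) ?normr0// ltW.
Qed.

Lemma test_ball0 phi x : test_function phi -> ~ unit_ball R d x -> phi x = 0.
Proof.
move=> tp /negP; rewrite /unit_ball/eball/= subr0 -leNgt => x1.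
exact: test_eq0.
Qed.

End test_functions.

(** * Dirichlet energy and the Green operator *)

Section ball_measure.
Context {R : realType} {d : nat}.
Local Notation V := 'rV[R]_d.

Definition mball : set V -> \bar R := lebesgue_ball R d.

HB.instance Definition _ := Measure.copy mball (lebesgue_ball R d).

Lemma mballE (A : set V) : mball A = leb R d (A `&` unit_ball R d).
Proof. by []. Qed.

Lemma mball_fin : fin_num_fun mball.
Proof.
move=> A mA; rewrite ge0_fin_numE//.
apply: le_lt_trans (leb_eball_ltoo (0 : V) 1).
apply: le_measure; rewrite ?inE; [|exact: measurable_eball|exact: subIsetr].
by apply: measurableI => //; exact: measurable_unit_ball.
Qed.

HB.instance Definition _ := Measure_isFinite.Build _ _ _ mball mball_fin.

(** Lebesgue measure is the sum of its restrictions to the ball and to the complement, and the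
    second one does not see [f]. *)
Lemma ge0_integral_mball (f : V -> \bar R) : measurable_fun setT f ->
  (forall x, 0 <= f x)%E -> (forall x, ~ unit_ball R d x -> f x = 0%E) ->
  (\int[mball]_x f x = \int[leb R d]_x f x)%E.
Proof.
move=> mf f0 fD.
have mD := @measurable_unit_ball R d.
have mDc : measurable (~` unit_ball R d) by exact: measurableC.
pose mc : {measure set V -> \bar R} := mrestr (leb R d) mDc.
have -> : (\int[leb R d]_x f x = \int[measure_add mball mc]_x f x)%E.
  apply: eq_measure_integral => A mA _.
  transitivity (mball A + mc A)%E; last exact/esym/measure_addE.
  rewrite mballE /mc /= /mrestr/= -measureU//.
  - by rewrite -setIUr setUCr setIT.
  - exact: measurableI.
  - exact: measurableI.
  - by rewrite setIACA setICr setI0.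
rewrite ge0_integral_measure_add//.
rewrite [X in (_ + X)%E](_ : _ = 0%E) ?adde0//.
rewrite (ge0_ae_eq_integral (g := cst 0%E))// ?integral0//.
exists (unit_ball R d); split=> //.
  by rewrite /mc/= /mrestr setICr measure0.
move=> x /= H; apply: contrapT => Dx; apply: H => _; exact: fD.
Qed.

Lemma integral_mball (f : V -> \bar R) : measurable_fun setT f ->
  (forall x, ~ unit_ball R d x -> f x = 0%E) ->
  (\int[mball]_x f x = \int[leb R d]_x f x)%E.
Proof.
move=> mf fD; rewrite integralE [RHS]integralE; congr (_ - _)%E.
  apply: ge0_integral_mball; [exact: measurable_funepos|exact: funepos_ge0|].
  by move=> x /fD; rewrite funeposE => ->; rewrite maxxx.
apply: ge0_integral_mball; [exact: measurable_funeneg|exact: funeneg_ge0|].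
by move=> x /fD; rewrite funenegE => ->; rewrite oppe0 maxxx.
Qed.

Lemma mball_refl (e : V) (A : set V) : enorm e = 1 -> measurable A ->
  mball (refl e @^-1` A) = mball A.
Proof.
move=> e1 mA; rewrite !mballE -[RHS](leb_refl e1); last first.
  by apply: measurableI => //; exact: measurable_unit_ball.
congr leb; rewrite preimage_setI; congr (_ `&` _).
by apply/seteqP; split => x; rewrite /unit_ball/eball/= !subr0 enorm_refl.
Qed.

End ball_measure.

Arguments mball R d : clear implicits.

(** * Vanishing integrals of partial derivatives *)

Section integration_by_parts.
Context {R : realType} {d : nat}.
Local Notation V := 'rV[R]_d.
Local Notation D := (unit_ball R d).
Local Notation m := (mball R d).
Local Notation ev i := (delta_mx 0 i : V).
Implicit Types (phi psi : V -> R).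

Lemma test_sq phi : test_function phi -> sq m phi.
Proof.
move=> tp; have [M _ H] := test_bounded tp.
exact: (@sq_bounded _ _ _ (m : {finite_measure set V -> \bar R}) phi M (test_measurable tp) H).
Qed.

Lemma enorm_delta (i : 'I_d) : enorm (ev i) = 1.
Proof. by rewrite enormE dot_delta mxE !eqxx sqrtr1. Qed.

Lemma test_integrable_leb phi : test_function phi ->
  (leb R d).-integrable setT (EFin \o phi).
Proof.
move=> tp; have mphi := test_measurable tp.
apply/integrableP; split; first exact/measurable_EFinP.
rewrite -ge0_integral_mball.
- by have /integrableP[_] := sq_integrable (test_sq tp).
- by apply: measurableT_comp => //; exact/measurable_EFinP.
- by move=> x; exact: abse_ge0.
- by move=> x /(test_ball0 tp) /= ->; rewrite normr0.
Qed.

(* The integral is translation invariant, so that the difference quotients of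
   phi have integral 0. *)
Lemma integral_partial phi i : test_function phi ->
  (\int[leb R d]_x (partial i phi x)%:E = 0)%E.
Proof.
move=> tp; have mphi := test_measurable tp.
have tdp := test_partial i tp.
have [M M0 HM] := test_bounded tdp.
have [_ dphi] := test_C0d tp.
pose t (n : nat) : R := n.+1%:R^-1.
have t0 n : 0 < t n by rewrite invr_gt0.
have t1 n : t n <= 1 by rewrite invf_le1// ler1n.
pose q n x := (t n)^-1 * (phi (t n *: ev i + x) - phi x).
(* The steps [t n] are at most 1, so every difference quotient vanishes outside the ball of radius
   2. *)
pose g (x : V) : \bar R := (M%:E * (\1_(eball (0 : V) 2) x)%:E)%E.
have mg : measurable_fun setT g.
  apply: emeasurable_funM => //; apply/measurable_EFinP.
  by apply: measurable_indic; exact: measurable_eball.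
have ig : (leb R d).-integrable setT g.
  apply: integrableZl => //; apply/integrableP; split.
    by apply/measurable_EFinP; apply: measurable_indic; exact: measurable_eball.
  under eq_integral do rewrite gee0_abs ?lee_fin//.
  rewrite integral_indic//; last exact: measurable_eball.
  by rewrite setIT; exact: leb_eball_ltoo.
have mshift n : measurable_fun setT (fun x => phi (t n *: ev i + x)).
  apply: (measurableT_comp mphi).
  rewrite (_ : +%R _ = (fun x : V => x + t n *: ev i)); last first.
    by apply/funext => x; rewrite addrC.
  exact: measurable_shift.
have mq n : measurable_fun setT (q n).
  by apply: measurable_funM => //; exact: measurable_funB.
have q0 n : (\int[leb R d]_x (q n x)%:E = 0)%E.
  rewrite /q; under eq_integral do rewrite EFinM EFinB.
  have ip := test_integrable_leb tp.
  have tE : (fun x => phi (t n *: ev i + x)) = phi \o (fun x => x + t n *: ev i).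
    by apply/funext => x /=; rewrite addrC.
  have ipt : (leb R d).-integrable setT (EFin \o (fun x => phi (t n *: ev i + x))).
    rewrite tE; apply: (integrable_mpres (measurable_shift (t n *: ev i))) ip.
    exact: leb_shift.
  rewrite integralZl//; last exact: (integrableB measurableT ipt ip).
  rewrite (integralB measurableT ipt ip).
  have -> : (\int[leb R d]_x (EFin \o (fun x => phi (t n *: ev i + x)%R)) x =
      \int[leb R d]_x (EFin \o phi) x)%E.
    rewrite tE.
    apply: (integral_mpres (measurable_shift (t n *: ev i))
      (leb_shift (t n *: ev i)) (f := EFin \o phi)).
    exact/measurable_EFinP.
  by rewrite subee ?mule0//; exact: integrable_fin_num.
have qc : {ae leb R d, forall x, setT x -> (q n x)%:E @[n --> \oo] --> (partial i phi x)%:E}.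
  apply: nearW => x _; apply: cvg_EFin; first exact: nearW.
  have t_cvg0 : t n @[n --> \oo] --> (0 : R) by exact: cvg_harmonic.
  have H : (fun h : R => h^-1 *: ((phi \o shift x) (h *: ev i) - phi x)) @ 0^'
      --> partial i phi x by exact: (dphi i x).
  apply: ((cvgr_dnbhsP _ _ _).1 H t); split => // n.
  by rewrite gt_eqF.
have qg : {ae leb R d, forall x n, setT x -> (`|(q n x)%:E| <= g x)%E}.
  apply: nearW => x n _; rewrite /g /q abse_EFin lee_fin.
  have [s st ->] := line_mvt x (t n) (fun y => dphi i y).
  rewrite mulrA mulVf ?gt_eqF// mul1r indicE.
  case: (boolP (x \in _)) => xB; first by rewrite mulr1; exact: HM.
  rewrite -[X in `|X|]/(partial i phi _) (test_eq0 tdp) ?normr0 ?mulr0//.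
  move: xB; rewrite notin_setE /eball/= subr0 => /negP; rewrite -leNgt => x2.
  have := enormB (s *: ev i + x) (s *: ev i).
  rewrite addrAC subrr add0r enormZ enorm_delta mulr1.
  rewrite (ger0_norm (ltW (t0 n))) in st.
  move: (t1 n) st x2; move: (t n) (enorm x) (enorm _) `|s| => a b c e h1 h2 h3 h4.
  lra.
have [_ _] := @dominated_convergence _ _ R (leb R d) setT measurableT
  (fun n x => (q n x)%:E) (fun x => (partial i phi x)%:E) g
  (fun n => (measurable_EFinP _ _).2 (mq n))
  ((measurable_EFinP _ _).2 (test_measurable tdp)) qc ig qg.
rewrite (_ : (fun n => _) = fun=> 0%E); last by apply/funext => n; exact: q0.
by move=> H; apply/esym; apply: (cvg_unique _ _ H) => //; exact: cvg_cst.
Qed.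

End integration_by_parts.

(** * Dirichlet energy and Poincare's inequality *)

Section dirichlet_energy.
Context {R : realType} {d : nat}.
Local Notation V := 'rV[R]_d.
Local Notation D := (unit_ball R d).
Local Notation m := (mball R d).
Local Notation ip := (l2ip m).
Local Notation nrm := (l2nrm m).
Implicit Types (phi psi f g u v : V -> R).

(** The product [phi psi] is a test function, so its partial derivative integrates to zero. *)
Lemma ip_partial phi psi i : test_function phi -> smooth psi -> sq m psi ->
  sq m (partial i psi) ->
  ip psi (partial i phi) = - ip (partial i psi) phi.
Proof.
move=> tp sp sqp sqdp; have tdp := test_partial i tp.
have tm := test_mul tp sp.
have := integral_partial i tm.
have mdm := test_measurable (test_partial i tm).
rewrite -integral_mball; last 2 first.
- exact/measurable_EFinP.
- by move=> x /(test_ball0 (test_partial i tm)) /= ->.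
rewrite partial_mul; [|exact: test_C0d|exact: smooth_C0d] => H.
have {}H : \int[m]_x (phi x * partial i psi x + psi x * partial i phi x) = 0.
  by rewrite /Rintegral H.
have s1 := test_sq tp; have s2 := test_sq tdp.
rewrite RintegralD// in H; last 2 first.
- exact: (sqM s1 sqdp).
- exact: (sqM sqp s2).
rewrite -/(ip phi (partial i psi)) -/(ip psi (partial i phi)) in H.
by rewrite (ipC m (partial i psi)); apply/eqP; rewrite -addr_eq0 addrC H.
Qed.

Lemma ip_partial_test phi psi i : test_function phi -> test_function psi ->
  ip psi (partial i phi) = - ip (partial i psi) phi.
Proof.
move=> tp tq; apply: ip_partial => //; first exact: test_smooth.
  exact: test_sq.
exact/test_sq/test_partial.
Qed.

(** The coordinate function has derivative 1 and is at most 1 in absolute value on the ball.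
    Integrating [x_i phi] by parts against [d_i phi] gives [|phi|^2 <= 2 |phi| |d_i phi|]. *)
Lemma poincare phi i : test_function phi -> nrm phi <= 2 * nrm (partial i phi).
Proof.
move=> tp; have tdp := test_partial i tp.
have sc : smooth (fun x : V => x 0 i) by apply/smoothP => k; exact: Ck_coord.
have txp := test_mul tp sc.
have H := ip_partial_test i tp txp.
move: H; rewrite partial_mul; [|exact: test_C0d|exact: smooth_C0d].
have -> : partial i (fun x : V => x 0 i) = fun=> 1.
  by apply/funext => x; rewrite /partial; have [_ ->] := is_partial_coord i i x; rewrite eqxx.
have tx := test_mul tdp sc.
have -> : (fun x => phi x * 1 + x 0 i * partial i phi x) =
    (fun x => phi x + partial i phi x * x 0 i).
  by apply/funext => x; rewrite mulr1 [x 0 i * _]mulrC.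
rewrite ipDl; [|exact: test_sq|exact: test_sq|exact: test_sq].
have -> : ip (fun x => partial i phi x * x 0 i) phi = ip (fun x => phi x * x 0 i) (partial i phi).
  by apply: eq_Rintegral => x _; ring.
move=> H.
have B := ip_norm_le (test_sq txp) (test_sq tdp).
have L : nrm (fun x => phi x * x 0 i) <= nrm phi.
  apply: nrm_le; [exact: test_sq|exact: test_sq|move=> x].
  have [x1|x1] := leP 1 (enorm x); first by rewrite (test_eq0 tp)// mul0r.
  by rewrite normrM ler_piMr// (le_trans (coord_le_enorm x i))// ltW.
have N0 := nrm_ge0 m phi; have N1 := nrm_ge0 m (partial i phi).
have pp : nrm phi ^+ 2 <= 2 * nrm phi * nrm (partial i phi).
  rewrite nrm_sqr.
  have : `|ip (fun x => phi x * x 0 i) (partial i phi)| <= nrm phi * nrm (partial i phi).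
    by rewrite (le_trans B)// ler_wpM2r.
  move: H; rewrite ler_norml; move: (ip _ phi) (ip _ (partial i phi)) => a b H /andP[].
  by clear B L N0 N1; move: (nrm phi) (nrm (partial i phi)) => c e h1 h2; lra.
have [n0|n0] := eqVneq (nrm phi) 0; first by rewrite n0 mulr_ge0.
have {}n0 : 0 < nrm phi by rewrite lt_neqAle eq_sym n0.
by rewrite -(ler_pM2l n0) -expr2 (le_trans pp)// mulrA mulrAC mulrC -mulrA lexx.
Qed.

Definition energy phi psi : R := \sum_i ip (partial i phi) (partial i psi).

Lemma energyC phi psi : energy phi psi = energy psi phi.
Proof. by apply: eq_bigr => i _; rewrite ipC. Qed.

Lemma energy_ge0 phi : 0 <= energy phi phi.
Proof. by apply: sumr_ge0 => i _; exact: ip_ge0. Qed.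

Lemma energyDl phi psi eta : test_function phi -> test_function psi ->
  test_function eta ->
  energy (fun x => phi x + psi x) eta = energy phi eta + energy psi eta.
Proof.
move=> tp tq te; rewrite -big_split; apply: eq_bigr => i _ /=.
rewrite partial_add; [|exact: test_C0d|exact: test_C0d].
by rewrite (ipDl (test_sq (test_partial i tp)) (test_sq (test_partial i tq))
  (test_sq (test_partial i te))).
Qed.

Lemma partial_scale c phi i : C0d phi ->
  partial i (fun x => c * phi x) = fun x => c * partial i phi x.
Proof.
move=> cp; rewrite (partial_mul i (C0d_cst c) cp).
by rewrite partial_cst; apply/funext => x; rewrite mulr0 addr0.
Qed.

Lemma energyZl c phi psi : test_function phi -> test_function psi ->
  energy (fun x => c * phi x) psi = c * energy phi psi.
Proof.
move=> tp tq; rewrite mulr_sumr; apply: eq_bigr => i _ /=.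
rewrite partial_scale; last exact: test_C0d.
by rewrite (ipZl _ (test_sq (test_partial i tp)) (test_sq (test_partial i tq))).
Qed.

Lemma energy_quad (a b : R) phi psi : test_function phi -> test_function psi ->
  energy (fun x => a * phi x + b * psi x) (fun x => a * phi x + b * psi x) =
  a ^+ 2 * energy phi phi + 2 * a * b * energy phi psi + b ^+ 2 * energy psi psi.
Proof.
move=> tp tq; have ta := test_scale a tp; have tb := test_scale b tq.
have tab := test_add ta tb.
rewrite (energyDl ta tb tab) (energyZl a tp tab) (energyZl b tq tab).
rewrite (energyC phi (fun x => _ + _)) (energyC psi (fun x => _ + _)).
rewrite (energyDl ta tb tp) (energyDl ta tb tq).
rewrite (energyZl a tp tp) (energyZl b tq tp) (energyZl a tp tq) (energyZl b tq tq).
rewrite (energyC psi phi).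
move: (energy _ _) (energy _ _) (energy _ _) => x y z; ring.
Qed.

(* J f is the supremum of this functional over the test functions. *)
Definition dfun f phi : R := 2 * ip f phi - energy phi phi.

Lemma ler_poincare phi (i : 'I_d) : test_function phi ->
  nrm phi ^+ 2 <= 4 * energy phi phi.
Proof.
move=> tp; have P := poincare i tp.
apply: (@le_trans _ _ ((2 * nrm (partial i phi)) ^+ 2)).
  by rewrite ler_pXn2r// nnegrE ?mulr_ge0 ?nrm_ge0.
rewrite exprMn nrm_sqr (_ : 2 ^+ 2 = 4 :> R); last by rewrite -natrX.
rewrite ler_wpM2l// /energy (bigD1 i)//= lerDl.
by apply: sumr_ge0 => j _; exact: ip_ge0.
Qed.

(** By Poincare the functional is at most [2 |f| |phi| - |phi|^2 / 4], which is largest at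
    [|phi| = 4 |f|]. *)
Lemma dfun_bounded f phi (i : 'I_d) : sq m f -> test_function phi ->
  dfun f phi <= 4 * nrm f ^+ 2.
Proof.
move=> sf tp; have P := ler_poincare i tp.
have B := ip_le sf (test_sq tp); rewrite /dfun.
move: P B; move: (ip _ _) (energy _ _) (nrm phi) (nrm f) => a e x y h1 h2.
have := sqr_ge0 (x - 4 * y) => h3; nra.
Qed.

End dirichlet_energy.

(** * Existence and variational characterisation of Green potentials *)

Section green_operator.
Context {R : realType} {d : nat}.
Local Notation V := 'rV[R]_d.
Local Notation D := (unit_ball R d).
Local Notation m := (mball R d).
Local Notation ip := (l2ip m).
Local Notation nrm := (l2nrm m).
Implicit Types (phi psi f u v : V -> R) (g : 'I_d -> V -> R).

Lemma partial_sub i f u : C0d f -> C0d u ->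
  partial i (fun x => f x - u x) = fun x => partial i f x - partial i u x.
Proof. by move=> [_ df] [_ du]; apply/funext => x; exact: deriveB. Qed.

Lemma cvg0_le (a : R) (b : nat -> R) : (forall n, a <= b n) ->
  b n @[n --> \oo] --> 0 -> a <= 0.
Proof.
move=> ab b0; rewrite leNgt; apply/negP => a0.
have /cvgrPdist_lt/(_ _ a0)[N _ /(_ N (leqnn N))] := b0.
rewrite /= sub0r normrN => H; have := ab N; have := ler_norm (b N).
move: H; move: (b N) `|b N| => x y *; lra.
Qed.

Lemma half_pow_cvg0 (c : R) : (c * 2^-1 ^+ n) @[n --> \oo] --> 0.
Proof. by apply: cvg_geometric; rewrite ger0_norm ?invf_lt1 ?ltr1n. Qed.

Lemma eq0_le_half_pow (a C : R) : (forall n, `|a| <= C * 2^-1 ^+ n) -> a = 0.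
Proof.
move=> H; have := cvg0_le H (half_pow_cvg0 C).
by rewrite normr_le0 => /eqP.
Qed.

(** Evaluated at [s = a / (E + 1)]; the added 1 covers the case [E = 0]. *)
Lemma eq0_quadratic (a E : R) : 0 <= E ->
  (forall s, 2 * s * a <= s ^+ 2 * E) -> a = 0.
Proof.
move=> E0 H; pose q := a / (E + 1).
have E1 : E + 1 != 0 by rewrite gt_eqF// ltr_wpDl.
have aq : a = q * (E + 1) by rewrite /q divfK.
have := H q; rewrite aq => {}H.
have : q ^+ 2 <= 0 by nra.
rewrite le_eqVlt ltNge sqr_ge0 orbF sqrf_eq0 => /eqP ->.
by rewrite mul0r.
Qed.

Lemma ip_close f u v : sq m f -> sq m u -> sq m v ->
  `|ip u f - ip v f| <= nrm f * nrm (fun x => u x - v x).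
Proof.
move=> sf su sv; rewrite -(ipBl su sv sf) mulrC.
exact: (ip_norm_le (sqB su sv) sf).
Qed.

Lemma test_weak_gradient phi : test_function phi ->
  weak_gradient phi (fun i => partial i phi).
Proof.
move=> tp; split=> [i|psi tq i]; first exact/sq_Lfun/test_sq/test_partial.
exact: (ip_partial_test i tq tp).
Qed.

Lemma test_W120 phi : test_function phi -> W120 phi.
Proof.
move=> tp; split; first exact/sq_Lfun/test_sq.
exists (fun i => partial i phi); first exact: test_weak_gradient.
have z u : (fun x => u x - u x) = (fun=> 0 : R) :> (V -> R).
  by apply/funext => x; rewrite subrr.
have n0 : nrm (fun=> 0) = 0.
  rewrite /l2nrm /l2ip; under eq_Rintegral do rewrite mulr0.
  by rewrite /Rintegral integral0 sqrtr0.
exists (fun=> phi); split=> // [|i].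
  apply/(@Lnorm2_cvg0 _ _ _ m (fun=> (phi \- phi)%R)) => [_|].
    exact: (sqB (test_sq tp) (test_sq tp)).
  by rewrite [X in nrm X]z n0; exact: cvg_cst.
have sp := test_sq (test_partial i tp).
apply/(@Lnorm2_cvg0 _ _ _ m (fun=> (partial i phi \- partial i phi)%R)) => [_|].
  exact: sqB.
by rewrite [X in nrm X]z n0; exact: cvg_cst.
Qed.

Lemma W120P v : W120 v -> sq m v /\
  exists2 g, weak_gradient v g & forall e, 0 < e ->
    exists phi, [/\ test_function phi, nrm (fun x => v x - phi x) <= e &
      forall i, nrm (fun x => g i x - partial i phi x) <= e].
Proof.
move=> [/sq_Lfun sv [g wg [phi_ [tp c0 c1]]]]; split=> //; exists g => // e e0.
have sg i : sq m (g i) by apply/sq_Lfun; have [] := wg.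
have {}c0 : nrm (fun x => phi_ n x - v x) @[n --> \oo] --> 0.
  by apply/(@Lnorm2_cvg0 _ _ _ m (fun n => (phi_ n \- v)%R)) => // n;
    exact: (sqB (test_sq (tp n)) sv).
have {}c1 i : nrm (fun x => partial i (phi_ n) x - g i x) @[n --> \oo] --> 0.
  by apply/(@Lnorm2_cvg0 _ _ _ m (fun n => (partial i (phi_ n) \- g i)%R)) => // n;
    exact: (sqB (test_sq (test_partial i (tp n))) (sg i)).
have near0 (a : nat -> R) : a n @[n --> \oo] --> 0 -> \forall n \near \oo, a n <= e.
  move=> /cvgrPdist_le/(_ _ e0); apply: filterS => n.
  by rewrite sub0r normrN; exact/le_trans/ler_norm.
have : \forall n \near \oo, nrm (fun x => phi_ n x - v x) <= e /\
   forall i, nrm (fun x => partial i (phi_ n) x - g i x) <= e.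
  apply: filterI; first exact: (near0 _ c0).
  have Hi i := near0 _ (c1 i).
  exact: (@filter_forall _ _
    (fun i n => nrm (fun x => partial i (phi_ n) x - g i x) <= e) eventually _ Hi).
move=> [N _ /(_ N (leqnn N)) /= [h0 h1]]; exists (phi_ N); split=> //.
  by rewrite nrm_distC.
by move=> i; rewrite nrm_distC.
Qed.

(** Direct method: a maximising sequence for [dfun f] is Cauchy in energy by the parallelogram
    identity, and in L^2 by Poincare. The limits of the functions and of their partial derivatives
    are [u] and its weak gradient. *)
Lemma green_exists f (i0 : 'I_d) : sq m f -> exists u, is_green f u.
Proof.
move=> sf.
pose S := sup [set dfun f phi | phi in [set phi | test_function phi]].
have hs : has_sup [set dfun f phi | phi in [set phi | test_function phi]].
  split; first by exists (dfun f (fun=> 0)); exists (fun=> 0) => //; exact: test_zero.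
  by exists (4 * nrm f ^+ 2) => _ [phi tp <-]; exact: (dfun_bounded i0 sf tp).
have dS phi : test_function phi -> dfun f phi <= S.
  by move=> tp; apply: ub_le_sup; [case: hs|exists phi].
(* Chosen so that [4 ep n = (2^-n / 2)^2]: the gradients then converge at rate [2^-n / 2], and the
   factor 2 of [poincare] still leaves [2^-n] for the functions. *)
pose ep (n : nat) : R := (2^-1 ^+ n) ^+ 2 / 16.
have ep0 n : 0 < ep n by rewrite divr_gt0// exprn_gt0// exprn_gt0.
have phi_ex n : exists phi, test_function phi /\ S - ep n <= dfun f phi.
  have [_ [phi tp <-] H] := sup_adherent (ep0 n) hs.
  by exists phi; split=> //; exact: ltW.
pose ph n := sval (cid (phi_ex n)).
have tph n : test_function (ph n) by rewrite /ph; case: cid => ? [].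
have phS n : S - ep n <= dfun f (ph n) by rewrite /ph; case: cid => ? [].
have epd n k : (n <= k)%N -> ep k <= ep n.
  move=> nk; rewrite ler_wpM2r// ler_pXn2r// ?nnegrE ?exprn_ge0//.
  by rewrite ler_wiXn2l// ?invr_ge0// invf_le1// ler1n.
have ediff n k : (n <= k)%N ->
    energy (fun x => ph k x - ph n x) (fun x => ph k x - ph n x) <= 4 * ep n.
  move=> nk; have tk := tph k; have tn := tph n.
  (* The midpoint does not exceed the supremum; this comparison is the parallelogram argument. *)
  have th := test_add (test_scale 2^-1 tk) (test_scale 2^-1 tn).
  have := dS _ th; rewrite {1}/dfun energy_quad//.
  rewrite (ipDr (test_sq (test_scale 2^-1 tk)) (test_sq (test_scale 2^-1 tn)) sf).
  rewrite (ipZr _ (test_sq tk) sf) (ipZr _ (test_sq tn) sf).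
  have -> : (fun x => ph k x - ph n x) = (fun x => 1 * ph k x + (-1) * ph n x).
    by apply/funext => x; rewrite mul1r mulN1r.
  rewrite (energy_quad 1 (-1) tk tn).
  have := phS k; have := phS n; have := epd n k nk; rewrite /dfun.
  move: (ip f (ph k)) (ip f (ph n)) (energy _ _) (energy _ _) (energy _ _).
  move: (ep k) (ep n) => e1 e2 a b c e h h1 h2 h3 h4.
  nra.
have pdiff n k i : (n <= k)%N ->
    nrm (fun x => partial i (ph k) x - partial i (ph n) x) <= 2^-1 ^+ n / 2.
  move=> nk; have E := ediff n k nk.
  have q0 : 0 <= 2^-1 ^+ n :> R by exact: exprn_ge0.
  rewrite -(@ler_pXn2r _ 2)// ?nnegrE ?nrm_ge0 ?divr_ge0//.
  rewrite nrm_sqr; apply: le_trans (_ : 4 * ep n <= _); last first.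
    by rewrite /ep; move: (2^-1 ^+ n) => q; nra.
  apply: le_trans E; rewrite /energy (bigD1 i)//=.
  rewrite (partial_sub i (test_C0d (tph k)) (test_C0d (tph n))).
  by rewrite lerDl; apply: sumr_ge0 => j _; exact: ip_ge0.
have udiff n k : (n <= k)%N -> nrm (fun x => ph k x - ph n x) <= 2^-1 ^+ n.
  move=> nk; apply: le_trans (poincare i0 (test_sub (tph k) (tph n))) _.
  rewrite (partial_sub i0 (test_C0d (tph k)) (test_C0d (tph n))).
  have := pdiff n k i0 nk; move: (l2nrm _ _) => a; lra.
have q_half n : 2^-1 ^+ n / 2 <= 2^-1 ^+ n :> R.
  have : 0 <= 2^-1 ^+ n :> R by exact: exprn_ge0.
  by move: (2^-1 ^+ n) => q; lra.
have [u su Hu] : exists2 u : V -> R, sq m u & forall n,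
    nrm (fun x => u x - ph n x) <= 2^-1 ^+ n.
  exact: sq_complete (fun n => test_sq (tph n)) udiff.
have g_ex (i : 'I_d) : exists g : V -> R, sq m g /\ forall n, nrm (fun x => g x - partial i (ph n) x) <= 2^-1 ^+ n.
  have [g sg Hg] := sq_complete (fun n => test_sq (test_partial i (tph n)))
    (fun n k nk => le_trans (pdiff n k i nk) (q_half n)).
  by exists g.
pose g i := sval (cid (g_ex i)).
have sg i : sq m (g i) by rewrite /g; case: cid => ? [].
have Hg i n : nrm (fun x => g i x - partial i (ph n) x) <= 2^-1 ^+ n.
  by rewrite /g; case: cid => ? [].
have wg : weak_gradient u g.
  split=> [i|phi tp i]; first exact/sq_Lfun/sg.
  have sp := test_sq tp; have sdp := test_sq (test_partial i tp).
  apply/eqP; rewrite -addr_eq0; apply/eqP.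
  apply: (@eq0_le_half_pow _ (nrm (partial i phi) + nrm phi)) => n.
  have H0 := ip_close sdp su (test_sq (tph n)).
  have H1 := ip_close sp (sg i) (test_sq (test_partial i (tph n))).
  have E := ip_partial_test i tp (tph n).
  have {}H0 := le_trans H0 (ler_wpM2l (nrm_ge0 _ _) (Hu n)).
  have {}H1 := le_trans H1 (ler_wpM2l (nrm_ge0 _ _) (Hg i n)).
  rewrite mulrDl; apply: le_trans (lerD H0 H1); apply: le_trans (ler_normD _ _).
  rewrite E /inner -/(l2ip m u (partial i phi)) -/(l2ip m (g i) phi).
  by rewrite le_eqVlt; apply/orP; left; apply/eqP; congr `|_|; lra.
have Wu : W120 u.
  split; first exact/sq_Lfun.
  exists g => //; exists ph; split=> // [|i].
    apply/(@Lnorm2_cvg0 _ _ _ m (fun n => (ph n \- u)%R)) => [n|].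
      exact: (sqB (test_sq (tph n)) su).
    apply: (@squeeze_cvgr _ _ _ _ (fun=> 0) (fun n => 1 * 2^-1 ^+ n)).
    - apply: nearW => n; rewrite nrm_ge0/= mul1r.
      by rewrite (nrm_distC m (ph n) u).
    - exact: cvg_cst.
    - exact: half_pow_cvg0.
  apply/(@Lnorm2_cvg0 _ _ _ m (fun n => (partial i (ph n) \- g i)%R)) => [n|].
    exact: (sqB (test_sq (test_partial i (tph n))) (sg i)).
  apply: (@squeeze_cvgr _ _ _ _ (fun=> 0) (fun n => 1 * 2^-1 ^+ n)).
  - apply: nearW => n; rewrite nrm_ge0/= mul1r.
    by rewrite (nrm_distC m (partial i (ph n)) (g i)).
  - exact: cvg_cst.
  - exact: half_pow_cvg0.
(* Euler-Lagrange equation: perturbing the sequence by [s phi] cannot raise the functional above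
   [S], for either sign of [s]. *)
have EL phi : test_function phi -> \sum_i ip (g i) (partial i phi) = ip f phi.
  move=> tp; pose G := \sum_i ip (g i) (partial i phi).
  pose C := \sum_i nrm (partial i phi).
  have Gn n : `|G - energy (ph n) phi| <= C * 2^-1 ^+ n.
    rewrite /G /energy -sumrB; apply: le_trans (ler_norm_sum _ _ _) _.
    rewrite mulr_suml; apply: ler_sum => i _.
    have := ip_close (test_sq (test_partial i tp)) (sg i) (test_sq (test_partial i (tph n))).
    by move=> /le_trans; apply; apply: ler_wpM2l (Hg i n); exact: nrm_ge0.
  have key s : 2 * s * (ip f phi - G) <= s ^+ 2 * energy phi phi.
    rewrite -subr_le0.
    apply: (@cvg0_le _ (fun n => ep n + 2 * `|s| * (C * 2^-1 ^+ n))) => [n|].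
      have tn := tph n; have := dS _ (test_add (test_scale 1 tn) (test_scale s tp)).
      rewrite {1}/dfun energy_quad//.
      rewrite (ipDr (test_sq (test_scale 1 tn)) (test_sq (test_scale s tp)) sf).
      rewrite (ipZr _ (test_sq tn) sf) (ipZr _ (test_sq tp) sf).
      have := phS n; rewrite /dfun; have := Gn n.
      have B : 2 * (s * (energy (ph n) phi - G)) <= 2 * (`|s| * `|G - energy (ph n) phi|).
        by rewrite ler_wpM2l// distrC -normrM ler_norm.
      have B2 : `|s| * `|G - energy (ph n) phi| <= `|s| * (C * 2^-1 ^+ n).
        by rewrite ler_wpM2l.
      move: B B2 => + + _.
      move: (ip f phi) (ip f (ph n)) (energy (ph n) (ph n)) (energy (ph n) phi).
      move: (energy phi phi) (C * 2^-1 ^+ n) `|s| => e1 c t a b e2 e3.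
      move: `|G - e3| (ep n) => w e4 *; nra.
    have -> : (fun n => ep n + 2 * `|s| * (C * 2^-1 ^+ n)) =
        (fun n => 16^-1 * (2^-1 ^+ n * 2^-1 ^+ n) + (2 * `|s| * C) * 2^-1 ^+ n).
      by apply/funext => n; rewrite /ep expr2; ring.
    rewrite -[0 in X in _ --> X]addr0; apply: cvgD; last exact: half_pow_cvg0.
    rewrite -[0 in X in _ --> X](mulr0 16^-1); apply: cvgMr.
    have h1 := half_pow_cvg0 1; rewrite -[0 in X in _ --> X](mulr0 0).
    by under eq_fun do rewrite -[2^-1 ^+ _]mul1r; apply: cvgM.
  apply/esym/eqP; rewrite -subr_eq0; apply/eqP.
  exact: (eq0_quadratic (energy_ge0 phi) key).
exists u; exists g; split=> // v gv /W120P[sv [g' wg' Hg']] wgv.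
have sgv i : sq m (gv i) by apply/sq_Lfun; have [] := wgv.
have sg' i : sq m (g' i) by apply/sq_Lfun; have [] := wg'.
(* The given weak gradient [gv] need not be the approximable one [g'], but both pair equally with
   test functions, and [g i] is an L^2 limit of such functions. *)
have z i phi : test_function phi -> ip (gv i) phi = ip (g' i) phi.
  move=> tp; have [_ H1] := wgv; have [_ H2] := wg'.
  have := H1 _ tp i; rewrite (H2 _ tp i) => /oppr_inj; exact: esym.
have -> : \sum_i inner (g i) (gv i) = \sum_i ip (g i) (g' i).
  apply: eq_bigr => i _; rewrite -[LHS]/(ip (g i) (gv i)).
  apply/eqP; rewrite -subr_eq0; apply/eqP.
  apply: (@eq0_le_half_pow _ (nrm (gv i) + nrm (g' i))) => n.
  have tn := test_partial i (tph n).
  have H1 := ip_close (sgv i) (sg i) (test_sq tn).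
  have H2 := ip_close (sg' i) (sg i) (test_sq tn).
  rewrite (ipC m (partial i (ph n))) (z i _ tn) in H1.
  rewrite (ipC m (partial i (ph n))) in H2.
  have {}H1 := le_trans H1 (ler_wpM2l (nrm_ge0 _ _) (Hg i n)).
  have {}H2 := le_trans H2 (ler_wpM2l (nrm_ge0 _ _) (Hg i n)).
  rewrite mulrDl; apply: le_trans (lerD H1 H2); rewrite -[X in _ <= _ + X]normrN.
  apply: le_trans (ler_normD _ _).
  by rewrite opprB addrA subrK lexx.
rewrite -[RHS]/(ip f v); apply/eqP; rewrite -subr_eq0; apply/eqP.
apply: (@eq0_le_half_pow _ (\sum_i nrm (g i) + nrm f)) => n.
have qn0 : 0 < 2^-1 ^+ n :> R by exact: exprn_gt0.
have [phi [tp p0 p1]] := Hg' _ qn0.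
have -> : \sum_i ip (g i) (g' i) - ip f v =
   (\sum_i (ip (g' i) (g i) - ip (partial i phi) (g i))) - (ip v f - ip phi f).
  rewrite sumrB (ipC m v) (ipC m phi) -(EL phi tp).
  under [X in _ = X - _ - _]eq_bigr do rewrite ipC.
  under [X in _ = _ - X - _]eq_bigr do rewrite ipC.
  by rewrite opprB addrA subrK.
rewrite mulrDl; apply: le_trans (ler_normB _ _) _; apply: lerD.
  apply: le_trans (ler_norm_sum _ _ _) _; rewrite mulr_suml; apply: ler_sum => i _.
  have := ip_close (sg i) (sg' i) (test_sq (test_partial i tp)).
  by move=> /le_trans; apply; apply: ler_wpM2l (p1 i); exact: nrm_ge0.
have := ip_close sf sv (test_sq tp).
by move=> /le_trans; apply; apply: ler_wpM2l p0; exact: nrm_ge0.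
Qed.

Definition lap phi x : R := \sum_i partial i (partial i phi) x.

Lemma test_sum (I : Type) (s : seq I) (F : I -> V -> R) :
  (forall i, test_function (F i)) -> test_function (fun x => \sum_(i <- s) F i x).
Proof.
move=> tF; elim: s => [|i s IH].
  rewrite (_ : (fun _ => _) = fun=> 0); first exact: test_zero.
  by apply/funext => x; rewrite big_nil.
rewrite (_ : (fun _ => _) = fun x => F i x + \sum_(j <- s) F j x).
  exact: test_add.
by apply/funext => x; rewrite big_cons.
Qed.

Lemma test_lap phi : test_function phi -> test_function (lap phi).
Proof. by move=> tp; apply: test_sum => i; exact/test_partial/test_partial. Qed.

Lemma ip_sumr (I : Type) (s : seq I) (F : I -> V -> R) f :
  sq m f -> (forall i, test_function (F i)) ->
  ip f (fun x => \sum_(i <- s) F i x) = \sum_(i <- s) ip f (F i).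
Proof.
move=> sf tF; elim: s => [|i s IH].
  rewrite big_nil -[RHS](mul0r (ip f f)) -ipZr//.
  by apply: eq_Rintegral => x _; rewrite big_nil mul0r.
rewrite big_cons -IH -(ipDr (test_sq (tF i)) (test_sq (test_sum s tF)) sf).
by apply: eq_Rintegral => x _; rewrite big_cons.
Qed.

(** The gap [ip f u - dfun f phi] is the squared L^2 distance of the gradients. Poincare therefore
    bounds the distance of [phi] to [u] by the gap, and approximation in the Sobolev norm makes the
    gap small. *)
Lemma is_greenP f u (i0 : 'I_d) : sq m f -> is_green f u ->
  [/\ sq m u,
      (forall phi, test_function phi ->
        nrm (fun x => u x - phi x) ^+ 2 <= 4 * (ip f u - dfun f phi)),
      (forall e, 0 < e -> exists2 phi, test_function phi &
        ip f u - dfun f phi <= e) &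
      (forall phi, test_function phi -> ip u (lap phi) = - ip f phi)].
Proof.
move=> sf [gu [Wu wgu Eu]]; have [su [g wg Hg]] := W120P Wu.
have sg i : sq m (g i) by apply/sq_Lfun; have [] := wg.
have sgu i : sq m (gu i) by apply/sq_Lfun; have [] := wgu.
have EL phi : test_function phi -> \sum_i ip (g i) (partial i phi) = ip f phi.
  move=> tp; rewrite -[RHS](Eu _ _ (test_W120 tp) (test_weak_gradient tp)).
  apply: eq_bigr => i _; rewrite -[RHS]/(ip (gu i) (partial i phi)).
  have tdp := test_partial i tp; have [_ H1] := wg; have [_ H2] := wgu.
  by have := H1 _ tdp i; rewrite (H2 _ tdp i) => /oppr_inj; exact: esym.
(* The equation tested with [u] itself, reached through test functions that approximate it. *)
have Jg : \sum_i ip (g i) (g i) = ip f u.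
  apply/eqP; rewrite -subr_eq0; apply/eqP.
  apply: (@eq0_le_half_pow _ (\sum_i nrm (g i) + nrm f)) => n.
  have qn0 : 0 < 2^-1 ^+ n :> R by exact: exprn_gt0.
  have [phi [tp p0 p1]] := Hg _ qn0.
  have -> : \sum_i ip (g i) (g i) - ip f u =
     (\sum_i (ip (g i) (g i) - ip (partial i phi) (g i))) - (ip u f - ip phi f).
    rewrite sumrB (ipC m u) (ipC m phi) -(EL phi tp).
    under [X in _ = _ - X - _]eq_bigr do rewrite ipC.
    by rewrite opprB addrA subrK.
  rewrite mulrDl; apply: le_trans (ler_normB _ _) _; apply: lerD.
    apply: le_trans (ler_norm_sum _ _ _) _; rewrite mulr_suml; apply: ler_sum => i _.
    have := ip_close (sg i) (sg i) (test_sq (test_partial i tp)).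
    by move=> /le_trans; apply; apply: ler_wpM2l (p1 i); exact: nrm_ge0.
  have := ip_close sf su (test_sq tp).
  by move=> /le_trans; apply; apply: ler_wpM2l p0; exact: nrm_ge0.
have gap phi : test_function phi ->
    ip f u - dfun f phi = \sum_i nrm (fun x => g i x - partial i phi x) ^+ 2.
  move=> tp; rewrite -Jg /dfun -(EL phi tp) /energy mulr_sumr.
  rewrite -sumrB -sumrB; apply: eq_bigr => i _; rewrite nrm_sqr.
  have tdp := test_sq (test_partial i tp).
  rewrite (ipBl (sg i) tdp (sqB (sg i) tdp)).
  rewrite (ipBr (sg i) tdp (sg i)) (ipBr (sg i) tdp tdp) (ipC m (partial i phi) (g i)).
  move: (ip _ _) (ip _ _) (ip _ _) => a b c; ring.
split=> //.
- move=> phi tp; set A := nrm (fun x => g i0 x - partial i0 phi x).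
  have A0 : 0 <= A by exact: nrm_ge0.
  have H : nrm (fun x => u x - phi x) <= 2 * A.
    rewrite -subr_le0; apply: (@cvg0_le _ (fun n => 3 * 2^-1 ^+ n)) => [n|]; last first.
      exact: half_pow_cvg0.
    have qn0 : 0 < 2^-1 ^+ n :> R by exact: exprn_gt0.
    have [psi [tq p0 p1]] := Hg _ qn0.
    have B1 := nrm_tri su (test_sq tq) (test_sq tp).
    have B2 := poincare i0 (test_sub tq tp).
    rewrite (partial_sub i0 (test_C0d tq) (test_C0d tp)) in B2.
    have B3 := nrm_tri (test_sq (test_partial i0 tq)) (sg i0) (test_sq (test_partial i0 tp)).
    rewrite (nrm_distC m (partial i0 psi) (g i0)) -/A in B3.
    move: B1 B2 B3 p0 (p1 i0); move: (nrm _) (nrm _) (nrm _) (nrm _) (nrm _).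
    move: (2^-1 ^+ n) => q a b c e h *; lra.
  rewrite gap//; apply: (@le_trans _ _ ((2 * A) ^+ 2)).
    by rewrite ler_pXn2r// nnegrE ?mulr_ge0 ?nrm_ge0.
  rewrite exprMn (_ : 2 ^+ 2 = 4 :> R); last by rewrite -natrX.
  rewrite ler_wpM2l// (bigD1 i0)//= lerDl.
  by apply: sumr_ge0 => i _; rewrite sqr_ge0.
- move=> e e0.
  have c0 : 0 < e / d.+1%:R by rewrite divr_gt0.
  have s0 : 0 < Num.sqrt (e / d.+1%:R) by rewrite sqrtr_gt0.
  have [phi [tp _ p1]] := Hg _ s0.
  exists phi => //; rewrite gap//.
  apply: (@le_trans _ _ (\sum_(i < d) (e / d.+1%:R))).
    apply: ler_sum => i _; rewrite -[leRHS](sqr_sqrtr (ltW c0)).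
    by rewrite ler_pXn2r// ?nnegrE ?nrm_ge0 ?sqrtr_ge0.
  rewrite sumr_const card_ord -[_ *+ d]mulr_natr mulrAC ler_pdivrMr//.
  by rewrite ler_pM2l// ler_nat.
- move=> phi tp.
  have -> : ip u (lap phi) = \sum_i ip u (partial i (partial i phi)).
    exact: (ip_sumr _ su (fun i => test_partial i (test_partial i tp))).
  rewrite -(EL phi tp) -sumrN; apply: eq_bigr => i _.
  by have [_ H] := wg; exact: (H _ (test_partial i tp) i).
Qed.

Lemma greenP f (i0 : 'I_d) : sq m f ->
  [/\ sq m (green f),
      (forall phi, test_function phi ->
        nrm (fun x => green f x - phi x) ^+ 2 <= 4 * (J f - dfun f phi)),
      (forall e, 0 < e -> exists2 phi, test_function phi & J f - dfun f phi <= e) &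
      (forall phi, test_function phi -> ip (green f) (lap phi) = - ip f phi)].
Proof.
move=> sf; have [u gu] := green_exists i0 sf.
have H : is_green f (green f) by exact: (xgetI (cst 0) gu).
exact: (is_greenP i0 sf H).
Qed.

End green_operator.

(** * Polarisation *)

Section polarisation.
Context {R : realType} {d : nat}.
Local Notation V := 'rV[R]_d.
Local Notation D := (unit_ball R d).
Local Notation m := (mball R d).
Local Notation ip := (l2ip m).
Local Notation nrm := (l2nrm m).
Implicit Types (phi psi f g u v : V -> R) (x : V).
Variable e : V.
Hypothesis e1 : enorm e = 1.
Local Notation tau := (refl e).

Lemma measurable_refl : measurable_fun setT tau.
Proof. exact: continuous_measurable_rVV (@continuous_refl _ _ e). Qed.

Lemma integral_refl f : measurable_fun setT f ->
  \int[m]_x f (tau x) = \int[m]_x f x.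
Proof. exact: (Rintegral_mpres measurable_refl (fun A => @mball_refl R d e A e1)). Qed.

Lemma sq_refl f : sq m f -> sq m (f \o tau).
Proof.
move=> [mf fi]; split; first exact: (measurableT_comp mf measurable_refl).
exact: (integrable_mpres measurable_refl (fun A => @mball_refl R d e A e1) fi).
Qed.

Lemma ip_refl f g : sq m f -> sq m g -> ip (f \o tau) (g \o tau) = ip f g.
Proof.
move=> [mf _] [mg _]; rewrite /l2ip.
by rewrite -(integral_refl (f := fun x => f x * g x))//; exact: measurable_funM.
Qed.

Lemma nrm_refl f : sq m f -> nrm (f \o tau) = nrm f.
Proof. by move=> sf; rewrite /l2nrm ip_refl. Qed.

Lemma refl_fix x : dot x e = 0 -> tau x = x.
Proof. by move=> xe; rewrite /refl xe mulr0 scale0r subr0. Qed.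

Lemma refl_comp2 f : f \o tau \o tau = f.
Proof. by apply/funext => x /=; rewrite reflK. Qed.

Lemma reflE x i : tau x 0 i = x 0 i - 2 * dot x e * e 0 i.
Proof. by rewrite !mxE. Qed.

Definition polarise f x : R := if 0 <= dot x e then Num.max (f x) (f (tau x))
                          else Num.min (f x) (f (tau x)).

Lemma polD f x : polarise f x + polarise f (tau x) = f x + f (tau x).
Proof.
rewrite /polarise dot_refl// reflK// oppr_ge0.
have [x0|x0|x0] := ltgtP (dot x e) 0.
- by rewrite maxC addrC addr_max_min addrC.
- by rewrite [X in _ + X]minC addr_max_min.
- by rewrite refl_fix// maxxx.
Qed.

Lemma measurable_pol f : measurable_fun setT f -> measurable_fun setT (polarise f).
Proof.
move=> mf; have mft := measurableT_comp mf measurable_refl.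
apply: measurable_fun_ifT.
- apply: measurable_fun_ler => //; apply: continuous_measurable_rV.
  exact: continuous_dotr.
- exact: measurable_maxr.
- exact: measurable_minr.
Qed.

Lemma sq_pol f : sq m f -> sq m (polarise f).
Proof.
move=> sf; have [mf _] := sf; have sft := sq_refl sf.
have sa : sq m (fun x => `|f x|).
  by apply: (sq_le _ sf) => [|x]; [exact: measurableT_comp|rewrite normr_id].
have sat : sq m (fun x => `|f (tau x)|).
  apply: (sq_le _ sft) => [|x]; last by rewrite normr_id.
  by apply: measurableT_comp => //; exact: sq_meas sft.
apply: (sq_le (measurable_pol mf) (sqD sa sat)) => x.
rewrite [leRHS]ger0_norm ?addr_ge0// /polarise /Num.max /Num.min.
by case: ifP => _; case: ifP => _; rewrite ?lerDl ?lerDr.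
Qed.

Lemma pol_contract f g x :
  `|polarise f x - polarise g x| <= `|f x - g x| + `|f (tau x) - g (tau x)|.
Proof.
have ab a b : `|a - b| = Num.max (a - b) (b - a) :> R.
  have [ab|ab] := leP b a.
    by rewrite ger0_norm ?subr_ge0// max_l//; lra.
  by rewrite ltr0_norm ?subr_lt0// max_r ?opprB//; lra.
rewrite /polarise /Num.max /Num.min.
have h1 := ler_norm (f x - g x); have h2 := ler_norm (f (tau x) - g (tau x)).
have h3 := ler_norm (g x - f x); have h4 := ler_norm (g (tau x) - f (tau x)).
have h5 := normr_ge0 (f x - g x); have h6 := normr_ge0 (f (tau x) - g (tau x)).
rewrite (distrC (g x)) in h3; rewrite (distrC (g (tau x))) in h4.
rewrite ler_norml; move: h1 h2 h3 h4 h5 h6.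
move: (f x) (g x) (f (tau x)) (g (tau x)) `|_| `|_| => a b c c' p q *.
by case: ifP => _; case: ltP => ?; case: ltP => ?; apply/andP; split; lra.
Qed.

(** Two-point rearrangement: two pairs of numbers have the larger sum of products when they are
    ordered alike. *)
Lemma pol_rearrangement f g x :
  f x * g x + f (tau x) * g (tau x) <=
  polarise f x * polarise g x + polarise f (tau x) * polarise g (tau x).
Proof.
rewrite /polarise dot_refl// reflK// oppr_ge0 /Num.max /Num.min.
have [x0|x0|x0] := ltgtP (dot x e) 0; last first.
- rewrite refl_fix//; case: ltP; case: ltP; lra.
- move: (f x) (g x) (f (tau x)) (g (tau x)) => a b c c'.
  by case: (ltgtP a c) => ?; case: (ltgtP b c') => ?; subst; nra.
- move: (f x) (g x) (f (tau x)) (g (tau x)) => a b c c'.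
  by case: (ltgtP a c) => ?; case: (ltgtP b c') => ?; subst; nra.
Qed.

(** Facts about polarisation hold for the sum over a pair [x], [refl e x]; this identity makes them
    facts about integrals. *)
Lemma integral_symm f : measurable_fun setT f ->
  m.-integrable setT (EFin \o f) ->
  2 * (\int[m]_x f x) = \int[m]_x (f x + f (tau x)).
Proof.
move=> mf fi.
have fti := integrable_mpres measurable_refl (fun A => @mball_refl R d e A e1) fi.
rewrite (RintegralD measurableT fi fti) /= integral_refl//; move: (Rintegral _ _ _) => a; lra.
Qed.

Lemma ip_pol f g : sq m f -> sq m g -> ip f g <= ip (polarise f) (polarise g).
Proof.
move=> sf sg; have sp := sq_pol sf; have sq' := sq_pol sg.
have fgi := sqM sf sg; have pgi := sqM sp sq'.
have mfg := measurable_funM (sq_meas sf) (sq_meas sg).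
have mpg := measurable_funM (sq_meas sp) (sq_meas sq').
rewrite -(ler_pM2l (ltr0n R 2)) /l2ip.
rewrite (integral_symm mfg fgi) (integral_symm mpg pgi).
apply: le_Rintegral => //.
- exact: (integrableD measurableT fgi (integrable_mpres measurable_refl
    (fun A => @mball_refl R d e A e1) fgi)).
- exact: (integrableD measurableT pgi (integrable_mpres measurable_refl
    (fun A => @mball_refl R d e A e1) pgi)).
- by move=> x _; exact: pol_rearrangement.
Qed.

(** An even weight sees only sums over reflected pairs, which polarisation preserves. This keeps the
    constraint against the torsion function. *)
Lemma ip_pol_even f g : sq m f -> sq m g ->
  {ae m, forall x, g (tau x) = g x} -> ip (polarise f) g = ip f g.
Proof.
move=> sf sg gt.
have key h : sq m h -> 2 * ip h g = ip (fun x => h x + h (tau x)) g.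
  move=> sh; rewrite (ipDl sh (sq_refl sh) sg).
  have -> : ip (h \o tau) g = ip (h \o tau) (g \o tau).
    rewrite ipC [RHS]ipC; apply/esym.
    exact: (ip_ae (sq_refl sg) sg (sq_refl sh) gt).
  by rewrite ip_refl//; move: (ip h g) => a; lra.
apply: (@mulfI _ 2); first by rewrite pnatr_eq0.
rewrite !key//; last exact: sq_pol.
by congr l2ip; apply/funext => x; exact: polD.
Qed.

Definition grad phi x : V := \row_i partial i phi x.

Lemma Rintegral_sumr (I : Type) (s : seq I) (F : I -> V -> R) :
  (forall i, m.-integrable setT (EFin \o F i)) ->
  \int[m]_x (\sum_(i <- s) F i x) = \sum_(i <- s) \int[m]_x F i x /\
  m.-integrable setT (EFin \o (fun x => \sum_(i <- s) F i x)).
Proof.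
move=> Fi; elim: s => [|i s [IH1 IH2]].
  rewrite big_nil; split.
    by under eq_Rintegral do rewrite big_nil; rewrite /Rintegral integral0.
  rewrite (_ : _ \o _ = cst 0%E); first exact: integrable0.
  by apply/funext => x /=; rewrite big_nil.
rewrite big_cons -IH1; split.
  by under eq_Rintegral do rewrite big_cons; rewrite (RintegralD measurableT (Fi i) IH2).
rewrite (_ : _ \o _ = fun x => ((F i x)%:E + (\sum_(j <- s) F j x)%:E)%E).
  exact: (integrableD measurableT (Fi i) IH2).
by apply/funext => x /=; rewrite big_cons.
Qed.

Lemma energy_grad phi psi : test_function phi -> test_function psi ->
  energy phi psi = \int[m]_x dot (grad phi x) (grad psi x).
Proof.
move=> tp tq.
have [E _] := @Rintegral_sumr _ (index_enum 'I_d)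
  (fun i x => partial i phi x * partial i psi x)
  (fun i => sqM (test_sq (test_partial i tp)) (test_sq (test_partial i tq))).
rewrite -[LHS]/(\sum_i \int[m]_x (partial i phi x * partial i psi x)) -E.
by apply: eq_Rintegral => x _; apply: eq_bigr => i _; rewrite !mxE.
Qed.

Lemma smooth_Ck k phi : smooth phi -> Ck k phi.
Proof. by move=> /smoothP. Qed.

(** Chain rule; a reflection is its own transpose, so it reappears in front of the gradient. *)
Lemma grad_refl phi x : smooth phi -> grad (phi \o tau) x = tau (grad phi (tau x)).
Proof.
move=> sp; apply/rowP => i; rewrite mxE.
rewrite (partial_refl e i (smooth_Ck 1 sp)).
rewrite reflE mxE /dot mulr_sumr mulr_suml.
transitivity (\sum_j (partial j phi (tau x) * (j == i)%:R -
   2 * (partial j phi (tau x) * e 0 j) * e 0 i)).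
  by apply: eq_bigr => j _; rewrite reflE mxE eqxx/= dotC dot_delta; ring.
rewrite sumrB; congr (_ - _).
  by rewrite (bigD1 i)//= eqxx mulr1 big1 ?addr0// => j /negbTE ->; rewrite mulr0.
by apply: eq_bigr => j _; rewrite mxE.
Qed.

Lemma energy_refl phi psi : test_function phi -> test_function psi ->
  energy (phi \o tau) (psi \o tau) = energy phi psi.
Proof.
move=> tp tq.
rewrite (energy_grad (test_refl e1 tp) (test_refl e1 tq)) (energy_grad tp tq).
under eq_Rintegral do rewrite (grad_refl _ (test_smooth tp)) (grad_refl _ (test_smooth tq)) dot_refl2//.
rewrite (integral_refl (f := fun x => dot (grad phi x) (grad psi x)))//.
have [_ /measurable_int/measurable_EFinP] := @Rintegral_sumr _ (index_enum 'I_d)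
  (fun i x => partial i phi x * partial i psi x)
  (fun i => sqM (test_sq (test_partial i tp)) (test_sq (test_partial i tq))).
by congr measurable_fun; apply/funext => x; apply: eq_bigr => i _; rewrite !mxE.
Qed.

Lemma dfun_refl f phi : sq m f -> f \o tau = f -> test_function phi ->
  dfun f (phi \o tau) = dfun f phi.
Proof.
move=> sf ft tp; rewrite /dfun energy_refl//; congr (2 * _ - _).
by rewrite -[in LHS]ft ip_refl//; exact: test_sq.
Qed.

(** A nearly optimal test function and its reflection have the same gap, so both are close to
    [green f]. *)
Lemma green_even f (i0 : 'I_d) : sq m f -> f \o tau = f ->
  {ae m, forall x, green f (tau x) = green f x}.
Proof.
move=> sf ft; have [su H1 H2 _] := greenP i0 sf.
set u := green f in su H1 *.
have sut := sq_refl su.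
suff n0 : nrm (fun x => u (tau x) - u x) = 0.
  have := nrm_eq0 (sqB sut su) n0; apply: filterS => x /eqP.
  by rewrite subr_eq0 => /eqP.
apply/eqP; rewrite eq_le nrm_ge0 andbT.
apply: (@cvg0_le _ _ (fun n => 4 * 2^-1 ^+ n)) => [n|]; last exact: half_pow_cvg0.
have q0 : 0 < 2^-1 ^+ n :> R by exact: exprn_gt0.
have [phi tp Hp] := H2 _ (exprn_gt0 2 q0).
have B phi' : test_function phi' -> J f - dfun f phi' <= (2^-1 ^+ n) ^+ 2 ->
    nrm (fun x => u x - phi' x) <= 2 * 2^-1 ^+ n.
  move=> tp' Hp'; rewrite -(@ler_pXn2r _ 2)// ?nnegrE ?nrm_ge0 ?mulr_ge0 ?(ltW q0)//.
  apply: le_trans (H1 _ tp') _; rewrite exprMn (_ : 2 ^+ 2 = 4 :> R); last by rewrite -natrX.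
  by rewrite ler_wpM2l.
have tpt := test_refl e1 tp.
have B1 := B _ tp Hp.
have B2 : nrm (fun x => u x - (phi \o tau) x) <= 2 * 2^-1 ^+ n.
  by apply: (B _ tpt); rewrite (dfun_refl sf ft tp); exact: Hp.
have E : nrm (fun x => u (tau x) - phi (tau x)) = nrm (fun x => u x - phi x).
  exact: (nrm_refl (sqB su (test_sq tp))).
have T := nrm_tri sut (test_sq tpt) su.
rewrite (nrm_distC m (phi \o tau) u) in T.
apply: le_trans T _; rewrite E.
by move: B1 B2; move: (nrm _) (nrm _) (2^-1 ^+ n) => a b c *; lra.
Qed.

End polarisation.

(** * Smoothed polarisation of test functions *)

Section polarised_test.
Context {R : realType} {d : nat}.
Local Notation V := 'rV[R]_d.
Local Notation m := (mball R d).
Local Notation ip := (l2ip m).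
Local Notation nrm := (l2nrm m).
Implicit Types (phi psi f g u v : V -> R) (x : V).
Variable e : V.
Hypothesis e1 : enorm e = 1.
Local Notation tau := (refl e).
Local Notation pol := (polarise e).

(* A smooth substitute for the absolute value. It vanishes near 0, so that
   [sgnp] below is smooth across the hyperplane. *)
Definition sabs (dl s : R) : R := theta dl s + theta dl (- s).

Lemma sabsN dl s : sabs dl (- s) = sabs dl s.
Proof. by rewrite /sabs opprK addrC. Qed.

Lemma sabs_eq0 dl s : 0 < dl -> `|s| <= dl -> sabs dl s = 0.
Proof.
move=> dl0; rewrite ler_norml => /andP[s1 s2].
by rewrite /sabs !theta_eq0 ?addr0// lerNl.
Qed.

Lemma sabs_close dl s : 0 < dl -> `|sabs dl s - `|s| | <= 2 * dl.
Proof.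
move=> dl0; wlog s0 : s / 0 <= s => [hw|].
  have [/hw//|s0] := leP 0 s.
  by rewrite -sabsN -(normrN s); apply: hw; lra.
rewrite (ger0_norm s0) /sabs (theta_eq0 dl0 (_ : - s <= dl)) ?addr0; last by lra.
have := theta_le dl0 s0; have := theta_ge s dl0.
by rewrite ler_norml; move: (theta dl s) => t *; apply/andP; split; lra.
Qed.

Lemma Ck_sabs dl k phi : 0 < dl -> Ck k phi -> Ck k (fun x => sabs dl (phi x)).
Proof.
move=> dl0 Hp.
have key psi : Ck k psi -> Ck k (fun x => theta dl (psi x)).
  move=> Hq; have H1 := Ck_sub Hq (Ck_cst k dl).
  apply: Ck_mul => //; apply: (Ck_comp (Rk_bumpn k 0)).
  exact: (Ck_mul H1 (Ck_cst k dl^-1)).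
exact: (Ck_add (key _ Hp) (key _ (Ck_opp Hp))).
Qed.

(** The derivative of [sabs dl] is a difference of two slopes in [[0, 1]], hence at most 1 in
    absolute value. *)
Lemma partial_sabs dl phi i x : 0 < dl -> C0d phi ->
  `|partial i (fun y => sabs dl (phi y)) x| <= `|partial i phi x|.
Proof.
move=> dl0 [cp dp].
have d1 : is_derive (phi x) 1 (theta dl) (dtheta dl (phi x)) := is_derive_theta _ dl0.
have d2 : is_derive (- phi x) 1 (theta dl) (dtheta dl (- phi x)) := is_derive_theta _ dl0.
have dphi := derivableP (dp i x).
have D1 := is_derive_comp1 dphi d1.
have D2 := is_derive_comp1 (is_deriveN dphi) d2.
have [_] := is_deriveD D1 D2.
rewrite -[X in X = _]/(partial i (fun y => sabs dl (phi y)) x) => ->.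
rewrite -[X in _ <= `|X|]/('D_(delta_mx 0 i) phi x).
move: ('D_(delta_mx 0 i) phi x) => c.
have -> : dtheta dl (phi x) * c + dtheta dl (- phi x) * - c =
          (dtheta dl (phi x) - dtheta dl (- phi x)) * c by ring.
rewrite normrM ler_piMl// ler_norml.
have := dtheta_ge0 dl (phi x); have := dtheta_ge0 dl (- phi x).
have := dtheta_le1 dl (phi x); have := dtheta_le1 dl (- phi x).
by move: (dtheta _ _) (dtheta _ _) => p q *; apply/andP; split; lra.
Qed.

Definition evenp phi x : R := 2^-1 * phi x + 2^-1 * phi (tau x).
Definition oddp phi x : R := 2^-1 * phi x + - 2^-1 * phi (tau x).
Definition sgnp phi dl x : R :=
  if 0 < dot x e then sabs dl (oddp phi x) else - sabs dl (oddp phi x).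

Lemma oddp_refl phi x : oddp phi (tau x) = - oddp phi x.
Proof. by rewrite /oddp reflK//; ring. Qed.

Lemma evenp_refl phi x : evenp phi (tau x) = evenp phi x.
Proof. by rewrite /evenp reflK//; ring. Qed.

Lemma sgnp_refl phi dl x : 0 < dl -> sgnp phi dl (tau x) = - sgnp phi dl x.
Proof.
move=> dl0; rewrite /sgnp dot_refl// oddp_refl sabsN oppr_gt0.
case: ltgtP => //; rewrite ?opprK// => /esym x0.
by rewrite sabs_eq0 ?oppr0// /oddp refl_fix// mulNr subrr normr0 ltW.
Qed.

Lemma pol_even_odd phi x :
  pol phi x = evenp phi x + (if 0 < dot x e then `|oddp phi x| else - `|oddp phi x|).
Proof.
rewrite /polarise /evenp /oddp; have [x0|x0|x0] := ltgtP (dot x e) 0.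
- rewrite /Num.min; move: (phi x) (phi (tau x)) => a b; case: ltP => ab.
    by rewrite ler0_norm; lra.
  by rewrite ger0_norm; lra.
- rewrite /Num.max; move: (phi x) (phi (tau x)) => a b; case: ltP => ab.
    by rewrite ler0_norm; lra.
  by rewrite ger0_norm; lra.
- by rewrite refl_fix// maxxx mulNr subrr normr0; lra.
Qed.

Lemma test_evenp phi : test_function phi -> test_function (evenp phi).
Proof.
move=> tp.
exact: (test_add (test_scale 2^-1 tp) (test_scale 2^-1 (test_refl e1 tp))).
Qed.

Lemma test_oddp phi : test_function phi -> test_function (oddp phi).
Proof.
move=> tp.
exact: (test_add (test_scale 2^-1 tp) (test_scale (- 2^-1) (test_refl e1 tp))).
Qed.

(** Off the hyperplane the side is locally constant. On it the odd part vanishes and stays below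
    [dl] nearby, where [sabs dl] is zero. *)
Lemma sgnp_near phi dl x : 0 < dl -> test_function phi ->
  exists2 c : R, `|c| <= 1 &
    \forall y \near x, c * sabs dl (oddp phi y) = sgnp phi dl y.
Proof.
move=> dl0 tp; have ce := @continuous_dotr R d e x.
have [x0|x0|x0] := ltgtP (dot x e) 0.
- exists (-1); first by rewrite normrN normr1.
  have N : \forall y \near x, dot y e < 0 by have /cvgr_lt := ce; apply.
  move: N; apply: filterS => y y0.
  by rewrite /sgnp ltNge (ltW y0)/= mulN1r.
- exists 1; first by rewrite normr1.
  have N : \forall y \near x, 0 < dot y e by have /cvgr_gt := ce; apply.
  move: N; apply: filterS => y y0.
  by rewrite /sgnp y0 mul1r.
- exists 0; first by rewrite normr0.
  have co := test_continuous (test_oddp tp).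
  have o0 : oddp phi x = 0 by rewrite /oddp refl_fix//; ring.
  have H : \forall y \near x, `|oddp phi x - oddp phi y| < dl.
    by have /cvgrPdist_lt := co x; apply.
  move: H; apply: filterS => y; rewrite o0 sub0r normrN => /ltW yd.
  by rewrite /sgnp sabs_eq0// mul0r oppr0 if_same.
Qed.

Lemma test_sgnp phi dl : 0 < dl -> test_function phi ->
  test_function (sgnp phi dl).
Proof.
move=> dl0 tp; have to := test_oddp tp.
apply/test_functionP; split; last first.
  have /test_functionP[_ [r r01 Hr]] := to.
  exists r => // x /Hr x0.
  by rewrite /sgnp x0 sabs_eq0 ?normr0 ?(ltW dl0)// oppr0 if_same.
apply/smoothP => k; apply: Ck_near => x; have [c _ Hc] := sgnp_near x dl0 tp.
exists (fun y => c * sabs dl (oddp phi y)); last exact: Hc.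
apply: (Ck_mul (Ck_cst k c)); apply: (Ck_sabs dl0).
exact: (smooth_Ck _ (test_smooth to)).
Qed.

Lemma partial_sgnp phi dl i x : 0 < dl -> test_function phi ->
  `|partial i (sgnp phi dl) x| <= `|partial i (oddp phi) x|.
Proof.
move=> dl0 tp; have co := test_C0d (test_oddp tp).
have [c c1 Hc] := sgnp_near x dl0 tp.
have cs : C0d (fun y => sabs dl (oddp phi y)).
  apply: (@Ck_C0d _ _ 0); apply: (Ck_sabs dl0).
  exact: (smooth_Ck _ (test_smooth (test_oddp tp))).
rewrite /partial -(near_eq_derive _ Hc).
rewrite -[X in `|X| <= _]/(partial i (fun y => c * sabs dl (oddp phi y)) x).
rewrite (partial_scale c i cs) normrM.
apply: le_trans (partial_sabs i x dl0 co).
by rewrite ler_piMl.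
Qed.

(* Smoothed polarisation: pol phi is the even part of phi plus, up to the side
   of the hyperplane, the absolute value of its odd part. *)
Definition polT phi dl x : R := 1 * evenp phi x + 1 * sgnp phi dl x.

Lemma test_polT phi dl : 0 < dl -> test_function phi -> test_function (polT phi dl).
Proof.
move=> dl0 tp.
exact: (test_add (test_scale 1 (test_evenp tp)) (test_scale 1 (test_sgnp dl0 tp))).
Qed.

Lemma polT_close phi dl x : 0 < dl -> `|polT phi dl x - pol phi x| <= 2 * dl.
Proof.
move=> dl0; rewrite pol_even_odd /polT !mul1r /sgnp.
have -> (a b c : R) : a + b - (a + c) = b - c by ring.
have := sabs_close (oddp phi x) dl0.
by case: ifP => // _; rewrite -opprD normrN.
Qed.

(** Reflection preserves the energy and changes the sign of the odd argument. *)
Lemma energy_even_odd phi psi : test_function phi -> test_function psi ->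
  (forall x, phi (tau x) = phi x) -> (forall x, psi (tau x) = - psi x) ->
  energy phi psi = 0.
Proof.
move=> tp tq ep oq.
have := energy_refl e1 tp tq.
have -> : phi \o tau = phi by apply/funext.
have -> : psi \o tau = fun x => -1 * psi x.
  by apply/funext => x /=; rewrite oq mulN1r.
rewrite energyC (energyZl (-1) tq tp) energyC.
by move: (energy _ _) => a; lra.
Qed.

(** The even part is untouched and orthogonal in energy to both odd parts, so only the odd part
    matters, and [sabs] does not increase derivatives. *)
Lemma energy_polT phi dl : 0 < dl -> test_function phi ->
  energy (polT phi dl) (polT phi dl) <= energy phi phi.
Proof.
move=> dl0 tp; have te := test_evenp tp; have to := test_oddp tp.
have ts := test_sgnp dl0 tp.
have E : (fun x => 1 * evenp phi x + 1 * oddp phi x) = phi.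
  apply/funext => x; rewrite /evenp /oddp.
  by move: (phi x) (phi (tau x)) => a b; lra.
have := energy_quad 1 1 te to; rewrite E => ->.
rewrite (energy_quad 1 1 te ts).
rewrite (energy_even_odd te to (evenp_refl phi) (oddp_refl phi)).
rewrite (energy_even_odd te ts (evenp_refl phi) (fun x => sgnp_refl phi x dl0)).
suff : energy (sgnp phi dl) (sgnp phi dl) <= energy (oddp phi) (oddp phi).
  by move: (energy _ _) (energy _ _) (energy _ _) => a b c *; rewrite expr1n; lra.
apply: ler_sum => i _.
rewrite -[leLHS]nrm_sqr -[leRHS]nrm_sqr ler_pXn2r; [|by []|exact: nrm_ge0|exact: nrm_ge0].
apply: (nrm_le (test_sq (test_partial i ts)) (test_sq (test_partial i to))).
by move=> x; exact: partial_sgnp.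
Qed.

Lemma polT_exists f phi eps : 0 < eps -> sq m f -> test_function phi ->
  exists psi, [/\ test_function psi, nrm (fun x => psi x - pol phi x) <= eps &
    dfun f phi - eps <= dfun (pol f) psi].
Proof.
move=> eps0 sf tp.
have sp := sq_pol e1 sf; have spp := sq_pol e1 (test_sq tp).
have sc1 := @sq_cst _ _ _ (m : {finite_measure set V -> \bar R}) 1.
(* [C] collects the uniform smoothing error [2 dl]: once as an L^2 norm, once in the linear term of
   [dfun], which carries a factor 2. The final 1 makes it positive. *)
pose C := nrm (fun=> 1) * (2 + 4 * nrm (pol f)) + 1.
have C0 : 0 < C.
  by rewrite ltr_wpDl// mulr_ge0 ?nrm_ge0// addr_ge0// mulr_ge0// nrm_ge0.
have [dl dl0 dlC] : exists2 dl, 0 < dl & dl * C = eps.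
  by exists (eps / C); rewrite ?divr_gt0// mulfVK// gt_eqF.
exists (polT phi dl); have tq := test_polT dl0 tp; have sq' := test_sq tq.
have H : nrm (fun x => polT phi dl x - pol phi x) <= 2 * dl * nrm (fun=> 1).
  have -> : 2 * dl * nrm (fun=> 1) = nrm (fun=> 2 * dl * 1).
    by rewrite (nrmZ _ sc1) ger0_norm// mulr_ge0// ltW.
  apply: (nrm_le (sqB sq' spp) (sqZ (2 * dl) sc1)) => x.
  by rewrite mulr1 [leRHS]ger0_norm ?polT_close// mulr_ge0// ltW.
have n1 := nrm_ge0 m (fun=> 1); have n2 := nrm_ge0 m (pol f).
split=> //.
  apply: le_trans H _; rewrite -dlC /C.
  have := mulr_ge0 (mulr_ge0 (ltW dl0) n1) n2; move: dl0.
  by move: (nrm _) (nrm _) (dl) => a b c *; lra.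
have I := ip_close sp sq' spp; have P := ip_pol e1 sf (test_sq tp).
have E := energy_polT dl0 tp; rewrite /dfun.
rewrite (ipC m (pol f) (polT _ _)); rewrite (ipC m (pol f)) in P.
move: I; rewrite ler_norml => /andP[I _].
have B : nrm (pol f) * nrm (fun x => polT phi dl x - pol phi x) <=
         nrm (pol f) * (2 * dl * nrm (fun=> 1)) by rewrite ler_wpM2l.
have dl0' := ltW dl0; have dn := mulr_ge0 dl0' n1.
have dln := mulr_ge0 dn n2.
rewrite -dlC /C; move: I P E B dn dln dl0'.
move: (ip _ _) (ip _ _) (ip _ _) (energy _ _) (energy _ _) => p q r E1 E2.
by move: (nrm _) (nrm _) (nrm _) => a b c *; nra.
Qed.

Lemma nrm_pol_contract f g : sq m f -> sq m g ->
  nrm (fun x => pol f x - pol g x) <= 2 * nrm (fun x => f x - g x).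
Proof.
move=> sf sg; have sfg := sqB sf sg; have mfg := sq_meas sfg.
have sa : sq m (fun x => `|f x - g x|).
  by apply: (sq_le _ sfg) => [|x]; [exact: measurableT_comp|rewrite normr_id].
have sat := sq_refl e1 sa.
apply: (@le_trans _ _ (nrm (fun x => `|f x - g x| + `|f (tau x) - g (tau x)|))).
  apply: (nrm_le (sqB (sq_pol e1 sf) (sq_pol e1 sg)) (sqD sa sat)) => x.
  rewrite /= [leRHS]ger0_norm; last by rewrite addr_ge0.
  exact: (pol_contract e f g x).
apply: le_trans (nrmD sa sat) _.
rewrite -[X in _ + X <= _]/(nrm ((fun x => `|f x - g x|) \o tau)) (nrm_refl e1 sa).
have : nrm (fun x => `|f x - g x|) <= nrm (fun x => f x - g x).
  by apply: (nrm_le sa sfg) => x; rewrite normr_id.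
by move: (nrm _) (nrm _) => a b *; lra.
Qed.

Let aux (a b c : R) : a - b <= c / 2 -> 0 < c / 2 -> 4 * (a - b) <= 4 * c.
Proof. by move=> *; lra. Qed.

Let aux2 (a a' b b' c : R) : a' <= a -> a - b <= c / 2 -> b - c / 2 <= b' ->
  4 * (a' - b') <= 4 * c.
Proof. by move=> *; lra. Qed.

Let aux3 (a b c g h k q qq : R) : 0 < q -> a <= 2 * q -> b <= 2 * q -> c <= b + g ->
  g <= k + h -> h <= 2 * a -> k <= qq / 2 -> qq <= q -> c <= 7 * q.
Proof. by move=> *; lra. Qed.

(** A test function nearly optimal for [f] polarises, up to smoothing, to one nearly optimal for
    [pol f], because [J (pol f) <= J f]. Each is close to its Green potential, and polarisation is
    Lipschitz in L^2. *)
Lemma green_pol f (i0 : 'I_d) : sq m f -> J (pol f) <= J f ->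
  {ae m, forall x, green (pol f) x = pol (green f) x}.
Proof.
move=> sf Jle; have sp := sq_pol e1 sf.
have [su H1 H2 _] := greenP i0 sf; have [su' H1' _ _] := greenP i0 sp.
set u := green f in su H1 *; set u' := green (pol f) in su' H1' *.
have spu := sq_pol e1 su.
suff n0 : nrm (fun x => u' x - pol u x) = 0.
  have := nrm_eq0 (sqB su' spu) n0; apply: filterS => x /eqP.
  by rewrite subr_eq0 => /eqP.
apply/eqP; rewrite eq_le nrm_ge0 andbT.
(* The constant rounds up [2 + 1/2 + 2 * 2]: the distance of [psi] to [u'], the smoothing error, and
   twice the distance of [phi] to [u]. *)
apply: (@cvg0_le _ _ (fun n => 7 * 2^-1 ^+ n)) => [n|]; last exact: half_pow_cvg0.
have q0 : 0 < 2^-1 ^+ n :> R by exact: exprn_gt0.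
have q1 : 2^-1 ^+ n <= 1 :> R by rewrite exprn_ile1// ?invr_ge0// invf_le1// ler1n.
move: (2^-1 ^+ n) q0 q1 => q q0 q1.
have e2 : 0 < q ^+ 2 / 2 by rewrite divr_gt0// exprn_gt0.
have [phi tp Hp] := H2 _ e2.
have [psi [tq Hq1 Hq2]] := polT_exists e2 sf tp.
have sphi := test_sq tp; have spsi := test_sq tq.
have B1 : nrm (fun x => u x - phi x) <= 2 * q.
  rewrite -(@ler_pXn2r _ 2)// ?nnegrE ?nrm_ge0 ?mulr_ge0 ?(ltW q0)//.
  apply: le_trans (H1 _ tp) _; rewrite exprMn (_ : 2 ^+ 2 = 4 :> R); last by rewrite -natrX.
  exact: (aux Hp e2).
have B2 : nrm (fun x => u' x - psi x) <= 2 * q.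
  rewrite -(@ler_pXn2r _ 2)// ?nnegrE ?nrm_ge0 ?mulr_ge0 ?(ltW q0)//.
  apply: le_trans (H1' _ tq) _; rewrite exprMn (_ : 2 ^+ 2 = 4 :> R); last by rewrite -natrX.
  exact: (aux2 Jle Hp Hq2).
have T1 := nrm_tri su' spsi spu.
have T2 := nrm_tri spsi (sq_pol e1 sphi) spu.
have T3 := nrm_pol_contract sphi su; rewrite (nrm_distC m phi u) in T3.
have q2 : q ^+ 2 <= q by rewrite expr2 ler_piMl// ltW.
exact: (aux3 q0 B1 B2 T1 T2 T3 Hq1 q2).
Qed.

End polarised_test.

(** * Maximum principle *)

Section averages.
Context {R : realType} {d : nat}.
Local Notation V := 'rV[R]_d.
Local Notation D := (unit_ball R d).
Local Notation m := (mball R d).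
Local Notation ip := (l2ip m).
Local Notation nrm := (l2nrm m).
Local Notation L := (leb R d).
Implicit Types (phi psi f g u v : V -> R) (x y : V) (r : R).

Definition vol r : \bar R := L (eball 0 r).

Lemma leb_eball x r : L (eball x r) = vol r.
Proof.
have -> : eball x r = (fun y => y + (- x)) @^-1` eball 0 r.
  by apply/seteqP; split => y; rewrite /eball/= subr0.
by rewrite leb_shift//; exact: measurable_eball.
Qed.

Lemma vol_fin r : vol r \is a fin_num.
Proof. by rewrite ge0_fin_numE//; exact: leb_eball_ltoo. Qed.

Lemma eballC x y r : eball x r y = eball y r x.
Proof. by rewrite /eball/= enorm_distC. Qed.

Lemma measurable_ball_pair r :
  measurable [set xy : V * V | eball xy.1 r xy.2].
Proof.
have -> : [set xy : V * V | eball xy.1 r xy.2] =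
    (fun xy : V * V => xy.2 - xy.1) @^-1` eball 0 r.
  by apply/seteqP; split => xy; rewrite /eball/= subr0.
apply: preimage_measurable; last exact: measurable_eball.
exact: (measurable_fun_subV measurable_snd measurable_fst).
Qed.

Definition bind r x y : \bar R := (\1_(eball x r) y)%:E.

Lemma bind_ge0 r x y : (0 <= bind r x y)%E.
Proof. by rewrite lee_fin. Qed.

Lemma measurable_bind r : measurable_fun setT (fun xy : V * V => bind r xy.1 xy.2).
Proof.
apply/measurable_EFinP.
exact: (measurable_indic (measurable_ball_pair r)).
Qed.

Lemma measurable_bind2 r x : measurable_fun setT (bind r x).
Proof.
by apply/measurable_EFinP; exact: (measurable_indic (measurable_eball x r)).
Qed.

Lemma bindC r x y : bind r x y = bind r y x.
Proof.
rewrite /bind !indicE (_ : (y \in eball x r) = (x \in eball y r))//.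
by apply/idP/idP; rewrite !inE eballC.
Qed.

Lemma measurable_weight (g : V -> \bar R) r : measurable_fun setT g ->
  measurable_fun setT (fun xy : V * V => g xy.2 * bind r xy.1 xy.2)%E.
Proof.
move=> mg; apply: emeasurable_funM; last exact: measurable_bind.
exact: (measurableT_comp mg measurable_snd).
Qed.

Lemma integral_weight_le (g : V -> \bar R) r : measurable_fun setT g ->
  (forall y, 0 <= g y)%E ->
  (\int[m]_x \int[L]_y (g y * bind r x y) <= vol r * \int[L]_y g y)%E.
Proof.
move=> mg g0.
rewrite (fubini_tonelli (fun xy : V * V => g xy.2 * bind r xy.1 xy.2)%E)//=; last 2 first.
- exact: measurable_weight.
- by move=> xy; rewrite mule_ge0// bind_ge0.
rewrite -ge0_integralZl//.
apply: ge0_le_integral => //=.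
- by move=> y _; apply: integral_ge0 => x _; rewrite mule_ge0// bind_ge0.
- have := measurable_fun_fubini_tonelli_G (m1 := m) (fun xy : V * V => g xy.2 * bind r xy.1 xy.2)%E.
  apply; first exact: measurable_weight.
  by move=> xy; rewrite mule_ge0// bind_ge0.
- exact: measurable_funeM.
move=> y _; under eq_integral do rewrite bindC.
rewrite ge0_integralZl//; last 2 first.
- exact: measurable_bind2.
- by move=> x _; exact: bind_ge0.
rewrite muleC lee_wpmul2r// /bind integral_indic// ?setIT; last exact: measurable_eball.
rewrite -(leb_eball y) [leLHS]mballE le_measure// inE; last exact: measurable_eball.
by apply: measurableI; [exact: measurable_eball|exact: measurable_unit_ball].
Qed.

Lemma integral_bind x r : (\int[L]_y bind r x y = vol r)%E.
Proof.
rewrite /bind (integral_indic _ measurableT (measurable_eball x r)) setIT.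
exact: leb_eball.
Qed.

Lemma test_lipschitz phi : test_function phi ->
  exists2 K, 0 <= K & forall x y, `|phi y - phi x| <= K * enorm (y - x).
Proof.
move=> tp; have H (i : 'I_d) := test_bounded (test_partial i tp).
pose M i := s2val (cid2 (H i)).
have M0 i : 0 <= M i by rewrite /M; case: (cid2 _).
have MP i x : `|partial i phi x| <= M i by rewrite /M; case: (cid2 _).
exists (\sum_i M i); first exact: sumr_ge0.
move=> x y; have C1 := smooth_Ck 1 (test_smooth tp).
have /CkS[C0 Cp] := C1.
have cpj j : continuous (partial j phi) by have /Ck_C0d[] := Cp j.
have dv (z v : V) : derivable phi z v by have [] := is_derive_dir z v C0 cpj.
have [s _] := line_mvt x 1 (fun z => dv z (y - x)).
rewrite scale1r subrK mul1r => ->; rewrite (derive_dir _ _ C1).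
apply: le_trans (ler_norm_sum _ _ _) _; rewrite mulr_suml.
apply: ler_sum => i _; rewrite normrM mulrC.
by apply: ler_pM => //; exact: coord_le_enorm.
Qed.

(** The L^2 closure of the test functions. It contains Green potentials and indicators, the two
    kinds of functions to which [mean_osc] is applied. *)
Definition test_approx f : Prop := sq m f /\
  forall eps, 0 < eps -> exists2 phi, test_function phi & nrm (fun x => f x - phi x) <= eps.

Let sc1 := @sq_cst _ _ _ (m : {finite_measure set V -> \bar R}) 1.

Lemma integral_norm_le f : sq m f ->
  (\int[m]_x `|f x|%:E <= (nrm f * nrm (fun=> 1))%:E)%E.
Proof.
move=> sf; have sa : sq m (fun x => `|f x|).
  apply: (sq_le _ sf) => [|x]; last by rewrite normr_id.
  by apply: measurableT_comp => //; exact: sq_meas sf.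
have <- : (ip (fun x => `|f x|) (fun=> 1))%:E = (\int[m]_x `|f x|%:E)%E.
  rewrite /l2ip /Rintegral fineK; last exact: integrable_fin_num (sqM sa sc1).
  by apply: eq_integral => x _; rewrite mulr1.
rewrite lee_fin; apply: le_trans (ip_le sa sc1) _.
apply: ler_wpM2r; first exact: nrm_ge0.
by apply: (nrm_le sa sf) => x; rewrite normr_id.
Qed.

Lemma mball_setT_fin : m setT \is a fin_num.
Proof. exact: (@fin_num_measure _ _ _ (m : {finite_measure set V -> \bar R})). Qed.

(* The L^1 form of Lebesgue's differentiation theorem. *)
Lemma mean_osc f : (forall x, ~ D x -> f x = 0) -> test_approx f ->
  forall eps, 0 < eps -> exists2 r0, 0 < r0 & forall r, 0 < r -> r <= r0 ->
  (\int[m]_x \int[L]_y (`|f y - f x|%:E * bind r x y) <= eps%:E * vol r)%E.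
Proof.
move=> fD [sf af] eps eps0; have mf := sq_meas sf.
pose N := nrm (fun=> 1); have N0 : 0 <= N by exact: nrm_ge0.
have [phi tp Hp] : exists2 phi, test_function phi &
    nrm (fun x => f x - phi x) * N <= eps / 4.
  have e1 : 0 < eps / (4 * (N + 1)) by rewrite divr_gt0// mulr_gt0// ltr_wpDl.
  have [phi tp Hp] := af _ e1; exists phi => //.
  apply: (@le_trans _ _ (eps / (4 * (N + 1)) * (N + 1))).
    by apply: ler_pM => //; [exact: nrm_ge0|rewrite lerDl].
  by rewrite invfM mulrA mulfVK// gt_eqF// ltr_wpDl.
have [K K0 HK] := test_lipschitz tp.
have sphi := test_sq tp; have mphi := sq_meas sphi.
pose T := fine (m setT); have TE : m setT = T%:E by rewrite fineK// mball_setT_fin.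
have T0 : 0 <= T by rewrite fine_ge0.
exists (eps / (2 * (K * T + 1))).
  by rewrite divr_gt0// mulr_gt0// ltr_wpDl// mulr_ge0.
move=> r r0 rle.
have KTr : K * r * T <= eps / 2.
  have : r * (2 * (K * T + 1)) <= eps.
    by rewrite -ler_pdivlMr// mulr_gt0// ltr_wpDl// mulr_ge0.
  have -> : r * (2 * (K * T + 1)) = 2 * (K * r * T) + 2 * r by ring.
  by move: r0; move: (K * r * T) => *; lra.
have sd := sqB sf sphi.
have mg : measurable_fun setT (fun y => `|f y - phi y|%:E).
  apply/measurable_EFinP; apply: measurableT_comp => //; exact: sq_meas sd.
(* The oscillation of [f] is split through [phi]: the error at [y], the Lipschitz term and the error
   at [x] contribute at most [eps / 4], [eps / 2] and [eps / 4]. *)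
pose G (x y : V) : \bar R :=
  (`|f y - phi y|%:E * bind r x y + (K * r + `|f x - phi x|)%:E * bind r x y)%E.
have b0 := bind_ge0 r.
have v0 : (0 <= vol r)%E by [].
have GE x : (\int[L]_y G x y = \int[L]_y (`|f y - phi y|%:E * bind r x y) +
    (K * r + `|f x - phi x|)%:E * vol r)%E.
  have c0 : 0 <= K * r + `|f x - phi x| by rewrite addr_ge0// mulr_ge0// ltW.
  rewrite ge0_integralD//=; last 4 first.
  - by move=> y _; rewrite mule_ge0.
  - exact: (emeasurable_funM mg (measurable_bind2 r x)).
  - by move=> y _; rewrite mule_ge0.
  - by apply: measurable_funeM; exact: measurable_bind2.
  rewrite ge0_integralZl//; last exact: measurable_bind2.
  by rewrite integral_bind.
have mF : measurable_fun setT
    (fun x : V => \int[L]_y (`|f y - phi y|%:E * bind r x y))%E.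
  apply: (measurable_fun_fubini_tonelli_F (m2 := L)
    (fun xy : V * V => `|f xy.2 - phi xy.2|%:E * bind r xy.1 xy.2)%E).
    exact: (measurable_weight r mg).
  by move=> xy; rewrite mule_ge0.
have mc : measurable_fun setT (fun x => (K * r + `|f x - phi x|)%:E * vol r)%E.
  apply: emeasurable_funM => //; apply/measurable_EFinP.
  by apply: measurable_funD => //; apply/measurable_EFinP.
apply: (@le_trans _ _ (\int[m]_x \int[L]_y G x y)%E).
  apply: ge0_le_integral => //=.
  - by move=> x _; apply: integral_ge0 => y _; rewrite mule_ge0.
  - apply: (measurable_fun_fubini_tonelli_F (m2 := L)
      (fun xy : V * V => `|f xy.2 - f xy.1|%:E * bind r xy.1 xy.2)%E).
      apply: emeasurable_funM; last exact: measurable_bind.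
      apply/measurable_EFinP; apply: measurableT_comp => //.
      by apply: measurable_funB; apply: measurableT_comp.
    by move=> xy; rewrite mule_ge0.
  - by under eq_fun do rewrite GE; exact: emeasurable_funD.
  move=> x _; apply: ge0_le_integral => //=.
  - by move=> y _; rewrite mule_ge0.
  - apply: emeasurable_funM; last exact: measurable_bind2.
    apply/measurable_EFinP; apply: measurableT_comp => //.
    by apply: measurable_funB.
  - apply: emeasurable_funD.
      exact: (emeasurable_funM mg (measurable_bind2 r x)).
    by apply: measurable_funeM; exact: measurable_bind2.
  move=> y _; rewrite /G -ge0_muleDl//; last first.
    by rewrite lee_fin addr_ge0// mulr_ge0// ltW.
  rewrite -EFinD /bind indicE; case: (boolP (y \in _)) => [|_]; last by rewrite !mule0.
  rewrite inE /eball/= => yx; rewrite !mule1 lee_fin.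
  have -> : f y - f x = (f y - phi y) + ((phi y - phi x) - (f x - phi x)) by ring.
  apply: le_trans (ler_normD _ _) _; rewrite lerD2l.
  apply: le_trans (ler_normB _ _) _; rewrite lerD2r.
  by apply: le_trans (HK x y) _; rewrite ler_wpM2l// ltW.
under eq_integral do rewrite GE.
rewrite ge0_integralD//=; last 2 first.
- by move=> x _; apply: integral_ge0 => y _; rewrite mule_ge0.
- by move=> x _; rewrite mule_ge0// lee_fin addr_ge0// mulr_ge0// ltW.
have A1 : (\int[m]_x `|f x - phi x|%:E <= (eps / 4)%:E)%E.
  by apply: le_trans (integral_norm_le sd) _; rewrite lee_fin.
have A2 : (\int[m]_x \int[L]_y (`|f y - phi y|%:E * bind r x y) <=
    (eps / 4)%:E * vol r)%E.
  apply: le_trans (integral_weight_le r mg _) _ => //.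
  rewrite muleC lee_wpmul2r//.
  rewrite -ge0_integral_mball// => x xD.
  by rewrite fD// (test_ball0 tp xD) subrr normr0.
have A3 : (\int[m]_x ((K * r + `|f x - phi x|)%:E * vol r) <=
    (eps / 2 + eps / 4)%:E * vol r)%E.
  rewrite ge0_integralZr//=; last 2 first.
  - apply/measurable_EFinP; apply: measurable_funD => //; exact/measurable_EFinP.
  - by move=> x _; rewrite lee_fin addr_ge0// mulr_ge0// ltW.
  rewrite lee_wpmul2r//; under eq_integral do rewrite EFinD.
  rewrite ge0_integralD//=; last by move=> x _; rewrite lee_fin mulr_ge0// ltW.
  rewrite EFinD; apply: leeD => //.
  rewrite integral_cst//; rewrite -[X in (_ * X)%E]/(m setT) TE -EFinM lee_fin.
  exact: KTr.
apply: le_trans (leeD A2 A3) _.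
rewrite -ge0_muleDl ?lee_fin ?addr_ge0 ?divr_ge0 ?(ltW eps0)// -EFinD.
by rewrite lee_wpmul2r// lee_fin; lra.
Qed.

End averages.

(** * Radial barriers and averaging kernels *)

Section barrier.
Context {R : realType} {d : nat}.
Local Notation V := 'rV[R]_d.
Local Notation D := (unit_ball R d).
Local Notation m := (mball R d).
Local Notation ip := (l2ip m).
Local Notation nrm := (l2nrm m).
Local Notation L := (leb R d).
Local Notation ev i := (delta_mx 0 i : V).
Implicit Types (phi psi f g u v w : V -> R) (x y : V) (r t : R).

Lemma bumpn_bound n (s : R) : s <= 1 -> bumpn n s <= n.+2`!%:R.
Proof.
move=> s1; have [s0|s0] := leP s 0; first by rewrite bumpn_eq0.
apply: le_trans (bumpn_le n s0) _; rewrite ler_piMr// expr2; nra.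
Qed.

Definition qd x y : R := dot (y - x) (y - x).

Lemma qd_ge0 x y : 0 <= qd x y. Proof. exact: dot_ge0. Qed.

Lemma qd_enorm x y : qd x y = enorm (y - x) ^+ 2.
Proof. by rewrite enorm_dot. Qed.

Definition arg t x y : R := 1 - t ^+ 2 * qd x y.

Lemma arg_le1 t x y : arg t x y <= 1.
Proof. by rewrite /arg lerBlDr lerDl mulr_ge0 ?qd_ge0// sqr_ge0. Qed.

Lemma arg_gt0 t x y : 0 < t -> (0 < arg t x y) = (enorm (y - x) < t^-1).
Proof.
move=> t0; rewrite /arg subr_gt0 qd_enorm -exprMn expr_lt1 ?mulr_ge0 ?enorm_ge0 ?(ltW t0)//.
by rewrite -ltr_pdivlMl// mulr1.
Qed.

Lemma dot_line (h : R) (c : V) i :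
  dot (h *: ev i + c) (h *: ev i + c) = dot c c + h * (2 * c 0 i) + h * h.
Proof.
rewrite dotDl !dotDr !dotZl !dotZr (dotC (ev i) c) !dot_delta !mxE !eqxx.
by move: (dot _ _) => a /=; ring.
Qed.

Lemma is_derive_arg t x y i :
  is_derive y (ev i) (arg t x) (- (t ^+ 2 * (2 * (y 0 i - x 0 i)))).
Proof.
apply/is_derive_line0.
rewrite (_ : (fun h => _) = (fun h : R =>
   1 - t ^+ 2 * (qd x y + h * (2 * (y 0 i - x 0 i)) + h * h))); last first.
  apply/funext => h; rewrite /arg /qd; congr (1 - _ * _).
  have -> : h *: ev i + y - x = h *: ev i + (y - x) by rewrite addrA.
  by rewrite [LHS]dot_line !mxE.
by apply: is_derive_eq; rewrite /GRing.scale/=; ring.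
Qed.

Lemma Ck_arg k t x : Ck k (arg t x).
Proof.
apply: Ck_sub; first exact: Ck_cst.
apply: Ck_mul; first exact: Ck_cst.
apply: Ck_sum => i.
have H : Ck k (fun y : V => (y - x) 0 i).
  have := Ck_sub (Ck_coord k i) (Ck_cst k (x 0 i)).
  by congr (Ck k); apply/funext => y; rewrite !mxE.
exact: Ck_mul.
Qed.

Definition barrier t x y : R := bumpn 0 (arg t x y).

Lemma barrier_ge0 t x y : 0 <= barrier t x y. Proof. exact: bumpn_ge0. Qed.

Lemma barrier_eq0 t x y : 0 < t -> t^-1 <= enorm (y - x) -> barrier t x y = 0.
Proof. by move=> t0 H; rewrite /barrier bumpn_eq0// leNgt arg_gt0// -leNgt. Qed.

Lemma test_barrier t x : 0 < t -> enorm x + t^-1 < 1 -> test_function (barrier t x).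
Proof.
move=> t0 xt; apply/test_functionP; split.
  by apply/smoothP => k; apply: (Ck_comp (Rk_bumpn k 0)); exact: Ck_arg.
exists (enorm x + t^-1).
  by rewrite xt andbT ltr_wpDl ?enorm_ge0// invr_gt0.
move=> y xy; apply: barrier_eq0 => //.
have := enormD x (y - x); rewrite addrC subrK => H.
by rewrite -(lerD2l (enorm x)) (le_trans xy).
Qed.

(** The derivative of [bumpn 2], hence the second derivative of [bumpn 0]. *)
Definition db2 (s : R) : R := - 2%:R * bumpn 3 s + bumpn 4 s.

Lemma lap_barrier t x y : lap (barrier t x) y =
  4 * t ^+ 4 * qd x y * db2 (arg t x y) - 2 * t ^+ 2 * d%:R * bumpn 2 (arg t x y).
Proof.
have p1 i : partial i (barrier t x) =
    fun z => bumpn 2 (arg t x z) * (- (t ^+ 2 * (2 * (z 0 i - x 0 i)))).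
  apply/funext => z.
  have [_] := is_derive_comp1 (is_derive_arg t x z i) (is_derive_bumpn 0 (arg t x z)).
  by rewrite oppr0 mul0r add0r.
have p2 i : partial i (partial i (barrier t x)) y =
    4 * t ^+ 4 * (y 0 i - x 0 i) ^+ 2 * db2 (arg t x y) -
    2 * t ^+ 2 * bumpn 2 (arg t x y).
  rewrite p1.
  have d1 := is_derive_comp1 (is_derive_arg t x y i) (is_derive_bumpn 2 (arg t x y)).
  have d2 : is_derive y (ev i) (fun z : V => - (t ^+ 2 * (2 * (z 0 i - x 0 i))))
      (- (t ^+ 2 * 2)).
    have := is_partial_coord i i y; rewrite eqxx => dc.
    by apply: is_derive_eq; rewrite /GRing.scale/=; ring.
  have [_ E] := is_deriveM d1 d2; rewrite [LHS]E /GRing.scale/= -/(db2 _).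
  by move: (db2 _) (bumpn _ _) => a b; ring.
rewrite /lap; under eq_bigr do rewrite p2.
rewrite sumrB sumr_const card_ord -mulr_natr.
rewrite -mulr_suml -mulr_sumr; congr (_ * _ * _ - _); last by ring.
by apply: eq_bigr => i _; rewrite !mxE expr2.
Qed.

(* The profile is chosen such that the t-derivative of the kernel is a negative
   multiple of the Laplacian of the barrier: weighted means of a superharmonic
   function over balls of radius 1/t increase with t. *)
Definition kern t x y : R := t ^+ d * bumpn 2 (arg t x y).

Definition dkern t x y : R := d%:R * t ^+ d.-1 * bumpn 2 (arg t x y) +
  t ^+ d * (db2 (arg t x y) * - (2 * t * qd x y)).

Lemma is_derive_kern t x y : is_derive t 1 (fun s : R => kern s x y) (dkern t x y).
Proof.
have da : is_derive t 1 (fun s : R => arg s x y) (- (2 * t * qd x y)).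
  by rewrite /arg; apply: is_derive_eq; rewrite /GRing.scale/=; ring.
have d2 := @is_derive_comp1 R R (bumpn 2) (fun s : R => arg s x y) t 1 _ _
  da (is_derive_bumpn 2 (arg t x y)).
have d1 : is_derive t 1 (fun s : R => s ^+ d) (d%:R * t ^+ d.-1).
  split; first exact: exprn_derivable.
  by rewrite exp_derive /GRing.scale/= mulr1.
have := is_deriveM d1 d2; congr is_derive.
by rewrite /dkern /GRing.scale/= -/(db2 _); ring.
Qed.

Lemma dkern_lap t x y : 0 < t ->
  dkern t x y = - (t ^+ d / t ^+ 3 / 2) * lap (barrier t x) y.
Proof.
move=> t0; rewrite lap_barrier /dkern.
have -> : d%:R * t ^+ d.-1 = d%:R * (t ^+ d / t).
  case: (d) => [|n]; first by rewrite !mul0r.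
  by rewrite exprS mulrAC divff ?mul1r// gt_eqF.
move: (db2 _) (bumpn _ _) (qd _ _) (t ^+ d) (d%:R : R) => a b q p n.
by field; rewrite gt_eqF.
Qed.

Lemma kern_ge0 t x y : 0 < t -> 0 <= kern t x y.
Proof. by move=> t0; rewrite mulr_ge0 ?bumpn_ge0// exprn_ge0// ltW. Qed.

Lemma kern_gt0 t x y : 0 < t -> enorm (y - x) < t^-1 -> 0 < kern t x y.
Proof. by move=> t0 H; rewrite mulr_gt0 ?exprn_gt0// bumpn_gt0// arg_gt0. Qed.

Lemma kern_eq0 t x y : 0 < t -> t^-1 <= enorm (y - x) -> kern t x y = 0.
Proof.
by move=> t0 H; rewrite /kern bumpn_eq0 ?mulr0// leNgt arg_gt0// -leNgt.
Qed.

Lemma kern_le t x y : 0 < t -> kern t x y <= t ^+ d * 4`!%:R.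
Proof.
by move=> t0; rewrite /kern ler_pM2l ?exprn_gt0// bumpn_bound// arg_le1.
Qed.

Lemma continuous_kern t x : continuous (kern t x).
Proof.
have [c _] := Ck_C0d (Ck_mul (Ck_cst 0 (t ^+ d))
  (Ck_comp (Rk_bumpn 0 2) (Ck_arg 0 t x))).
exact: c.
Qed.

Lemma sq_kern t x : 0 < t -> sq m (kern t x).
Proof.
move=> t0; apply: (@sq_bounded _ _ _ (m : {finite_measure set V -> \bar R})
  (kern t x) (t ^+ d * 4`!%:R)).
  exact: continuous_measurable_rV (@continuous_kern t x).
by move=> y; rewrite ger0_norm ?kern_ge0// kern_le.
Qed.

(** Uniform in [x], [y] and in [t] between [a] and [b]: the domination for differentiating means
    under the integral sign. *)
Lemma dkern_bound (a b t : R) x y : 0 < a -> a <= t -> t <= b ->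
  `|dkern t x y| <= b ^+ d / a *
     (d%:R * 4`!%:R + 2 * (2 * 5`!%:R + 6`!%:R)).
Proof.
move=> a0 at' tb; have t0 := lt_le_trans a0 at'; have b0 := lt_le_trans t0 tb.
have td : 0 <= t ^+ d / t <= b ^+ d / a.
  apply/andP; split; first by rewrite divr_ge0 ?exprn_ge0 ?(ltW t0).
  apply: ler_pM; rewrite ?exprn_ge0 ?invr_ge0 ?(ltW t0)//.
    by rewrite lerXn2r// nnegrE ltW.
  by rewrite lef_pV2 ?posrE.
have -> : dkern t x y = t ^+ d / t * (d%:R * bumpn 2 (arg t x y) -
    2 * (t ^+ 2 * qd x y) * db2 (arg t x y)).
  rewrite dkern_lap// lap_barrier.
  move: (db2 _) (bumpn _ _) (qd _ _) (t ^+ d) (d%:R : R) => p q r s n.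
  by field; rewrite gt_eqF.
rewrite normrM; apply: ler_pM => //.
  by case/andP: td => /ger0_norm -> .
have [s0|s0] := leP (arg t x y) 0.
  rewrite /db2 !bumpn_eq0// !(mulr0, addr0, subr0) normr0.
  by rewrite addr_ge0// mulr_ge0.
have q1 : 0 <= t ^+ 2 * qd x y <= 1.
  by rewrite mulr_ge0 ?sqr_ge0 ?qd_ge0//= -subr_ge0 ltW.
have b2 := bumpn_bound 2 (arg_le1 t x y).
have b3 := bumpn_bound 3 (arg_le1 t x y).
have b4 := bumpn_bound 4 (arg_le1 t x y).
apply: le_trans (ler_normB _ _) _; apply: lerD.
  by rewrite ger0_norm ?mulr_ge0 ?bumpn_ge0// ler_wpM2l.
rewrite normrM; case/andP: q1 => q0 q1.
rewrite ger0_norm; last by apply: mulr_ge0.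
apply: (@le_trans _ _ (2 * 1 * `|db2 (arg t x y)|)).
  by apply: ler_wpM2r => //; apply: ler_wpM2l.
rewrite mulr1; apply: ler_wpM2l => //; apply: le_trans (ler_normD _ _) _; apply: lerD.
  rewrite normrM (_ : `|-2| = 2 :> R); last by rewrite normrN ger0_norm.
  by rewrite ger0_norm ?bumpn_ge0// ler_wpM2l.
by rewrite ger0_norm ?bumpn_ge0.
Qed.

End barrier.

(** * Strong maximum principle on the half ball *)

Section maximum_principle.
Context {R : realType} {d : nat}.
Local Notation V := 'rV[R]_d.
Local Notation D := (unit_ball R d).
Local Notation m := (mball R d).
Local Notation ip := (l2ip m).
Local Notation L := (leb R d).
Implicit Types (phi psi f g u v : V -> R) (x y : V) (r t : R).
Variables (e : V) (w : V -> R).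
Hypothesis e1 : enorm e = 1.
Hypothesis sw : sq m w.
(** Superharmonicity in the sense of distributions; [dl] keeps the supports away from the
    hyperplane. *)
Hypothesis superharmonic : forall phi (dl : R), 0 < dl -> test_function phi ->
  (forall x, 0 <= phi x) -> (forall x, dot x e <= dl -> phi x = 0) ->
  ip w (lap phi) <= 0.

(** The closed ball of radius [1/t] about [x] lies in the open half ball. *)
Definition inside t x : Prop := t^-1 < dot x e /\ enorm x + t^-1 < 1.

Lemma inside_le s t x : 0 < s -> s <= t -> inside s x -> inside t x.
Proof.
move=> s0 st [h1 h2]; have t0 := lt_le_trans s0 st.
have H : t^-1 <= s^-1 by rewrite lef_pV2 ?posrE.
split; first exact: le_lt_trans H h1.
by apply: le_lt_trans h2; rewrite lerD2l.
Qed.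

Definition mean t x : R := \int[m]_y (w y * kern t x y).

Lemma is_derive_mean t x : 0 < t -> derivable (mean ^~ x) t 1 /\
  (mean ^~ x)^`()%classic t = \int[m]_y (w y * dkern t x y).
Proof.
(* A window around [t] bounded away from 0, on which [dkern_bound] is uniform. *)
move=> t0; pose a := t / 2; pose b := t + 1.
have a0 : 0 < a by rewrite divr_gt0.
pose F s y : R := w y * kern s x y.
have dF (s : R) (y : V) : is_derive s 1 (F ^~ y) (w y * dkern s x y).
  have := is_deriveZ (w y) (is_derive_kern s x y); exact.
pose C := b ^+ d / a * (d%:R * 4`!%:R + 2 * (2 * 5`!%:R + 6`!%:R)).
have C0 : 0 <= C.
  by rewrite mulr_ge0// ?divr_ge0// ?exprn_ge0 ?addr_ge0 ?mulr_ge0// ltW.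
have tab : [set` `]a, b[] t.
  by rewrite /= in_itv/=; apply/andP; split; rewrite /a /b; lra.
have iF s : [set` `]a, b[] s -> m.-integrable setT (EFin \o F s).
  rewrite /= in_itv/= => /andP[as_ _].
  exact: (sqM sw (sq_kern x (lt_trans a0 as_))).
have derF s y : [set` `]a, b[] s -> setT y -> derivable (F ^~ y) s 1.
  by move=> _ _; have [] := dF s y.
have G0 y : 0 <= C * `|w y| by rewrite mulr_ge0.
have iG : m.-integrable setT (EFin \o (fun y => C * `|w y|)).
  have sa : sq m (fun y => C * `|w y|).
    apply: sqZ; apply: (sq_le _ sw) => [|y]; last by rewrite normr_id.
    by apply: measurableT_comp => //; exact: sq_meas sw.
  exact: (@sq_integrable _ _ _ (m : {finite_measure set V -> \bar R}) _ sa).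
have Gb s y : [set` `]a, b[] s -> setT y -> `|partial1of2 F s y| <= C * `|w y|.
  rewrite /= in_itv/= => /andP[as_ sb] _; rewrite partial1of2E.
  have [_ ->] := dF s y; rewrite normrM mulrC ler_wpM2r//.
  by apply: dkern_bound; rewrite // ltW.
split.
  exact: (@derivable_under_integral _ _ _ m F setT measurableT t a b tab iF derF
    (fun y => C * `|w y|) G0 iG Gb).
rewrite /mean derive1E.
have := @differentiation_under_integral _ _ _ m F setT measurableT t a b tab iF derF
    (fun y => C * `|w y|) G0 iG Gb.
rewrite derive1E => ->; apply: eq_Rintegral => y _.
by rewrite partial1of2E; have [_ ->] := dF t y.
Qed.

Lemma mean_mono s t x : 0 < s -> s <= t -> inside s x -> mean s x <= mean t x.
Proof.
move=> s0 st ins.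
have p0 r : r \in `]s, t[ -> 0 < r.
  by rewrite in_itv/= => /andP[sr _]; exact: lt_trans sr.
apply: (@ger0_derive1_ndecr _ (mean ^~ x) s t) => //.
- by move=> r /p0 r0; have [] := is_derive_mean x r0.
- move=> r rst; have r0 := p0 r rst.
  have [_ ->] := is_derive_mean x r0.
  have [i1 i2] : inside r x.
    by move: rst; rewrite in_itv/= => /andP[/ltW sr _]; exact: inside_le sr ins.
  have tb := test_barrier r0 i2.
  have -> : \int[m]_y (w y * dkern r x y) =
      - (r ^+ d / r ^+ 3 / 2) * ip w (lap (barrier r x)).
    rewrite -(ipZr _ (test_sq (test_lap tb)) sw).
    by apply: eq_Rintegral => y _; rewrite dkern_lap.
  have c0 : 0 <= r ^+ d / r ^+ 3 / 2 by rewrite !divr_ge0 ?exprn_ge0 ?(ltW r0).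
  rewrite mulNr oppr_ge0 mulr_ge0_le0//.
  (* This margin separates the support of the barrier from the hyperplane. *)
  have dl0 : 0 < dot x e - r^-1 by rewrite subr_gt0.
  apply: (superharmonic dl0 tb) => y; first exact: barrier_ge0.
  move=> ye; apply: barrier_eq0 => //.
  have := dot_le (x - y) e; rewrite dotBl e1 mulr1 enorm_distC.
  by move: ye; move: (dot _ _) (dot _ _) (enorm _) (r^-1) => a b c q *; lra.
- apply: derivable_within_continuous => r; rewrite in_itv/= => /andP[sr _].
  by have [] := is_derive_mean x (lt_le_trans s0 sr).
Qed.

Hypothesis w0 : forall x, 0 <= w x.

Definition null_on x t : Prop := {ae m, forall y, enorm (y - x) < t^-1 -> w y = 0}.

Lemma ae_eq0_integral (f : V -> \bar R) : measurable_fun setT f ->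
  (forall x, 0 <= f x)%E -> (\int[m]_x f x = 0)%E -> {ae m, forall x, f x = 0%E}.
Proof.
move=> mf f0 H.
have H' : (\int[m]_x `|f x| = 0)%E by under eq_integral do rewrite gee0_abs//.
have /ae_eq_integral_abs := H'; move=> /(_ measurableT mf).
by apply: filterS => x /(_ I).
Qed.

Lemma mean_sq t x : 0 < t -> m.-integrable setT (EFin \o (fun y => w y * kern t x y)).
Proof. by move=> t0; exact: (sqM sw (sq_kern x t0)). Qed.

Lemma meanE t x : 0 < t -> (mean t x)%:E = (\int[m]_y (w y * kern t x y)%:E)%E.
Proof.
by move=> t0; rewrite /mean /Rintegral fineK//; exact: integrable_fin_num (mean_sq x t0).
Qed.

Lemma mean_ge0 t x : 0 < t -> 0 <= mean t x.
Proof. by move=> t0; apply: Rintegral_ge0 => y _; rewrite mulr_ge0 ?kern_ge0. Qed.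

Lemma mean_eq0 t x : 0 < t -> mean t x = 0 <-> null_on x t.
Proof.
move=> t0; split=> [M0|N0].
  have mk := measurable_int _ (mean_sq x t0).
  have k0 y : (0 <= (w y * kern t x y)%:E)%E by rewrite lee_fin mulr_ge0 ?kern_ge0.
  have I0 : (\int[m]_y (w y * kern t x y)%:E = 0)%E by rewrite -meanE// M0.
  have := ae_eq0_integral mk k0 I0; apply: filterS => y [] /eqP.
  rewrite mulf_eq0 => /orP[/eqP //|/eqP ky yx].
  by have := kern_gt0 t0 yx; rewrite ky ltxx.
rewrite /mean /Rintegral (ae_eq_integral (cst 0%E))//.
- by rewrite integral0.
- exact: measurable_int (mean_sq x t0).
- move: N0; apply: filterS => y H _ /=.
  have [yx|yx] := ltP (enorm (y - x)) t^-1; first by rewrite H// mul0r.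
  by rewrite kern_eq0// mulr0.
Qed.

(** The ball of radius [1/(2t)] about [y] lies in the ball about [x] where [w] vanishes, so the mean
    at scale [2t] is zero. By monotonicity the mean at scale [t] is no larger, and a zero mean means
    vanishing on its whole ball. *)
Lemma null_on_spread t x y : 0 < t -> inside t y -> null_on x t ->
  enorm (y - x) <= t^-1 / 2 -> null_on y t.
Proof.
move=> t0 iy nx yx; have t2 : 0 < 2 * t by rewrite mulr_gt0.
apply/(mean_eq0 y t0)/eqP; rewrite eq_le mean_ge0// andbT.
have -> : 0 = mean (2 * t) y.
  apply/esym/(mean_eq0 y t2); move: nx; apply: filterS => z H zy; apply: H.
  have := enormD (z - y) (y - x); rewrite subrKA => /le_lt_trans; apply.
  move: zy yx; rewrite invfM; move: (enorm _) (enorm _) (t^-1) => a b c *; lra.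
by apply: mean_mono => //; lra.
Qed.

Lemma inside_convex t x y (s : R) : 0 <= s <= 1 -> inside t x -> inside t y ->
  inside t (x + s *: (y - x)).
Proof.
move=> /andP[s0 s1] [x1 x2] [y1 y2]; have s1' : 0 <= 1 - s by rewrite subr_ge0.
have -> : x + s *: (y - x) = (1 - s) *: x + s *: y.
  by rewrite scalerBr scalerBl scale1r addrA addrAC.
have cvx (a b : R) : Num.min a b <= (1 - s) * a + s * b.
  rewrite ge_min; apply/orP; have [ab|/ltW ab] := leP a b; [left|right]; nra.
split.
  by rewrite dotDl !dotZl (lt_le_trans _ (cvx _ _))// lt_min x1.
have := enormD ((1 - s) *: x) (s *: y); rewrite !enormZ !ger0_norm// => H.
apply: (@le_lt_trans _ _ ((1 - s) * enorm x + s * enorm y + t^-1)).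
  by rewrite lerD2r.
have P : 0 < Num.min (1 - enorm x - t^-1) (1 - enorm y - t^-1).
  by rewrite lt_min; apply/andP; split; lra.
move: (lt_le_trans P (cvx _ _)); move: (enorm x) (enorm y) (t^-1) => a b c *; lra.
Qed.

(** The segment stays [inside] by convexity and is covered in [M + 1] steps of length at most
    [1/(2t)]. *)
Lemma null_on_inside t x y : 0 < t -> inside t x -> inside t y ->
  null_on x t -> null_on y t.
Proof.
move=> t0 ix iy nx.
have [M HM] : exists M : nat, enorm (y - x) / (t^-1 / 2) <= M.+1%:R.
  have := archi_boundP (divr_ge0 (enorm_ge0 (y - x)) (ltW (divr_gt0 _ (ltr0n R 2) : 0 < t^-1 / 2))).
  rewrite invr_gt0 => /(_ t0) H; exists (Num.bound (enorm (y - x) / (t^-1 / 2))).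
  by rewrite (le_trans (ltW H))// ler_nat.
have M0 : 0 < M.+1%:R :> R by [].
pose z (j : nat) := x + (j%:R / M.+1%:R) *: (y - x).
have zM : z M.+1 = y by rewrite /z divff ?gt_eqF// scale1r addrC subrK.
suff H j : (j <= M.+1)%N -> null_on (z j) t by rewrite -zM; exact: H.
elim: j => [_|j IH jM]; first by rewrite /z mul0r scale0r addr0.
apply: (@null_on_spread _ (z j)) => //.
- apply: inside_convex => //; rewrite divr_ge0//=.
  by rewrite ler_pdivrMr// mul1r ler_nat.
- by apply: IH; exact: ltnW.
rewrite /z opprD addrACA subrr add0r -scalerBl -mulrBl -natr1 addrAC subrr add0r.
rewrite mul1r enormZ ger0_norm ?invr_ge0//.
rewrite mulrC ler_pdivrMr//; rewrite ler_pdivrMr in HM; first by rewrite mulrC.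
by rewrite divr_gt0// invr_gt0.
Qed.

Lemma rational_close y (dl : R) : 0 < dl ->
  exists q : 'rV[rat]_d, enorm (y - map_mx ratr q) < dl.
Proof.
move=> dl0; pose k := dl / d.+1%:R; have k0 : 0 < k by rewrite divr_gt0.
have qP i : exists q : rat, `|y 0 i - ratr q| < k.
  have [|q] := @rat_in_itvoo R (y 0 i) (y 0 i + k); first by rewrite ltrDl.
  rewrite in_itv/= => /andP[q1 q2]; exists q.
  by rewrite ltr0_norm ?subr_lt0// opprB ltrBlDl.
exists (\row_i sval (cid (qP i))).
have : eball (0 : V) dl (y - map_mx ratr (\row_i sval (cid (qP i)))).
  apply: cube_sub_eball => // i; rewrite !mxE; case: cid => q /= Hq.
  by rewrite -ler_norml ltW.
by rewrite /eball/= subr0.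
Qed.

Lemma inside_exists y : D y -> 0 < dot y e -> exists n : nat, inside n.+1%:R y.
Proof.
rewrite /unit_ball/eball/= subr0 => y1 ye.
pose k := Num.min (dot y e) (1 - enorm y).
have k0 : 0 < k by rewrite lt_min ye subr_gt0.
have [n _ /(_ n (leqnn _)) nk] := near_infty_natSinv_lt (PosNum k0).
have {}nk : n.+1%:R^-1 < k := nk.
exists n; move: nk; rewrite lt_min => /andP[H1 H]; split=> //.
by rewrite addrC -ltrBrDr.
Qed.

(** Countably many balls with rational centres cover the half ball, so their null sets can be
    combined. Vanishing reaches each ball at the common scale [max t (n + 1)] and then fills it by
    monotonicity. *)
Lemma strong_max t x : 0 < t -> inside t x -> null_on x t ->
  {ae m, forall y, D y -> 0 < dot y e -> w y = 0}.
Proof.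
move=> t0 ix nx.
pose P (k : nat) y := if unpickle k is Some (q, n) then
  inside n.+1%:R (map_mx ratr (q : 'rV[rat]_d) : V) ->
  enorm (y - map_mx ratr q) < n.+1%:R^-1 -> w y = 0 else True.
have HP k : {ae m, forall y, P k y}.
  rewrite /P; case: (unpickle k) => [[q n]|]; last exact: aeW.
  have [iq|niq] := pselect (inside n.+1%:R (map_mx ratr q : V)); last first.
    by apply: aeW => y /niq.
  pose s := Num.max t n.+1%:R.
  have s0 : 0 < s by rewrite lt_max t0.
  have ts : t <= s by rewrite le_max lexx.
  have ns : n.+1%:R <= s by rewrite le_max lexx orbT.
  have nxs : null_on x s.
    move: nx; apply: filterS => z H zx; apply: H; apply: lt_le_trans zx _.
    by rewrite lef_pV2 ?posrE.
  have n0 : 0 < n.+1%:R :> R by [].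
  have N1 := null_on_inside s0 (inside_le t0 ts ix) (inside_le n0 ns iq) nxs.
  have : null_on (map_mx ratr q) n.+1%:R.
    apply/(mean_eq0 _ n0)/eqP; rewrite eq_le mean_ge0// andbT.
    have <- : mean s (map_mx ratr q) = 0 by apply/mean_eq0.
    exact: mean_mono.
  by apply: filterS => y H _; exact: H.
have := ae_foralln HP; apply: filterS => y H Dy ye.
have [n [i1 i2]] := inside_exists Dy ye.
(* Thus [k + 1 = 2 (n + 1)]: halving the radius leaves room for the distance from [y] to the
   rational centre. *)
pose k := (2 * n.+1)%N.-1.
have kE : k.+1%:R = 2 * n.+1%:R :> R by rewrite /k prednK// natrM.
have [q Hq] : exists q : 'rV[rat]_d, enorm (y - map_mx ratr q) < k.+1%:R^-1.
  by apply: rational_close; rewrite invr_gt0.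
have := H (pickle (q, k)); rewrite /P pickleK; apply; last exact: Hq.
have kinv : k.+1%:R^-1 = n.+1%:R^-1 / 2 :> R by rewrite kE invfM mulrC.
rewrite kinv in Hq; split; rewrite kinv.
  have := dot_le (y - map_mx ratr q) e; rewrite dotBl e1 mulr1.
  by move: Hq i1; move: (enorm _) (dot _ _) (dot _ _) (_^-1) => *; lra.
have := enormB y (y - map_mx ratr q); rewrite opprB addrC subrK.
by move: Hq i2; move: (enorm _) (enorm _) (enorm _) (_^-1) => *; lra.
Qed.

Lemma measurable_kern2 t : measurable_fun setT (fun xy : V * V => kern t xy.1 xy.2).
Proof.
apply: measurable_funM => //.
apply: (measurableT_comp (continuous_measurable_fun (@continuous_bumpn R 2))).
apply: measurable_funB => //; apply: measurable_funM => //.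
apply: (measurableT_comp (continuous_measurable_rV (@continuous_dotxx R d))).
exact: (measurable_fun_subV measurable_snd measurable_fst).
Qed.

Lemma measurable_mean t : 0 < t -> measurable_fun setT (fun x => (mean t x)%:E).
Proof.
move=> t0; under eq_fun do rewrite (meanE _ t0).
apply: (measurable_fun_fubini_tonelli_F (m2 := m)
  (fun xy : V * V => (w xy.2 * kern t xy.1 xy.2)%:E)).
  apply/measurable_EFinP; apply: measurable_funM; last exact: measurable_kern2.
  exact: (measurableT_comp (sq_meas sw) measurable_snd).
by move=> xy; rewrite lee_fin mulr_ge0 ?kern_ge0.
Qed.

Lemma vol_scale t : 0 < t -> @vol R d t^-1 = ((t^-1 ^+ d)%:E * @vol R d 1)%E.
Proof.
move=> t0; rewrite /vol -leb_scale//; last exact: measurable_eball.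
congr L; apply/seteqP; split => x; rewrite /eball/= !subr0 enormZ ger0_norm ?ltW//;
  by rewrite -ltr_pdivlMl// mulr1.
Qed.

Lemma measurable_inside t : measurable [set x | inside t x].
Proof.
apply: measurableI.
  rewrite -[X in measurable X]setTI.
  apply: (measurable_fun_ltr (f := fun=> t^-1) (g := fun x => dot x e)) => //.
  exact: continuous_measurable_rV (@continuous_dotr R d e).
rewrite -[X in measurable X]setTI.
apply: (measurable_fun_ltr (g := fun=> 1) (f := fun x => enorm x + t^-1)) => //.
apply: measurable_funD => //; exact: measurable_enorm.
Qed.

(* At points where w vanishes the average over the ball of radius 1/s is
   controlled by the mean oscillation and tends to 0 as s grows, while it is
   nondecreasing in s. *)
Lemma mean_ae0 g t : (forall x, ~ D x -> g x = 0) -> test_approx g ->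
  (forall x, D x -> 0 < dot x e -> w x = g x) -> 0 < t ->
  {ae m, forall x, inside t x -> w x = 0 -> mean t x = 0}.
Proof.
move=> gD ag wg t0; have [sg _] := ag; have mg := sq_meas sg.
pose Z := [set x | inside t x] `&` [set x | w x = 0].
have mZ : measurable Z.
  apply: measurableI; first exact: measurable_inside.
  exact: (preimage_measurable (sq_meas sw) (measurable_set1 0)).
pose h x : \bar R := ((mean t x)%:E * (\1_Z x)%:E)%E.
have h0 x : (0 <= h x)%E by rewrite mule_ge0// lee_fin// mean_ge0.
have mh : measurable_fun setT h.
  apply: emeasurable_funM; first exact: measurable_mean.
  by apply/measurable_EFinP; exact: measurable_indic.
suff I0 : (\int[m]_x h x = 0)%E.
  have := ae_eq0_integral mh h0 I0; apply: filterS => x + ix wx.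
  rewrite /h indicE mem_set// mule1 => -[]; exact.
apply/eqP; rewrite eq_le integral_ge0 ?andbT//.
have v1 : (0 <= @vol R d 1)%E by [].
apply: (@le_trans _ _ (0%:E * (4`!%:R%:E * @vol R d 1))%E); last by rewrite mul0e.
have v1f := vol_fin (d := d) (1 : R).
rewrite -(fineK v1f) -!EFinM mul0r; apply/lee_addgt0Pr => eps eps0.
rewrite add0e.
(* [C] absorbs the bound [4!] of the kernel and the volume of the unit ball. *)
pose C : R := 4`!%:R * fine (@vol R d 1) + 1.
have C0 : 0 < C by rewrite ltr_wpDl// mulr_ge0// fine_ge0.
have [r0 r00 Hr] := mean_osc gD ag (divr_gt0 eps0 C0).
pose s := Num.max t r0^-1; have s0 : 0 < s by rewrite lt_max t0.
have ts : t <= s by rewrite le_max lexx.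
have sr : s^-1 <= r0.
  by rewrite -[leRHS]invrK lef_pV2 ?posrE ?invr_gt0// le_max lexx orbT.
have s'0 : 0 < s^-1 by rewrite invr_gt0.
pose I x : \bar R := (\int[L]_y (`|g y - g x|%:E * bind s^-1 x y))%E.
have I_ge0 x : (0 <= I x)%E.
  by apply: integral_ge0 => y _; rewrite mule_ge0// ?bind_ge0// lee_fin.
have mI : measurable_fun setT I.
  apply: (measurable_fun_fubini_tonelli_F (m2 := L)
    (fun xy : V * V => `|g xy.2 - g xy.1|%:E * bind s^-1 xy.1 xy.2)%E).
    apply: emeasurable_funM; last exact: measurable_bind.
    apply/measurable_EFinP; apply: measurableT_comp => //.
    by apply: measurable_funB; apply: measurableT_comp.
  by move=> xy; rewrite mule_ge0// ?bind_ge0// lee_fin.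
have hI x : (h x <= (s ^+ d * 4`!%:R)%:E * I x)%E.
  rewrite /h indicE; case: (boolP (x \in Z)) => [|_]; last first.
    by rewrite mule0 mule_ge0// lee_fin mulr_ge0// exprn_ge0// ltW.
  rewrite inE => -[ix wx]; rewrite mule1.
  have isx := inside_le t0 ts ix.
  have xD : D x.
    have [_] := ix; rewrite /unit_ball/eball/= subr0; apply: le_lt_trans.
    by rewrite lerDl invr_ge0 ltW.
  have xe : 0 < dot x e by have [H _] := ix; apply: lt_trans H; rewrite invr_gt0.
  have gx : g x = 0 by rewrite -wg.
  apply: (@le_trans _ _ (mean s x)%:E); first by rewrite lee_fin mean_mono.
  rewrite meanE// /I -ge0_integralZl//; last 3 first.
  - apply: emeasurable_funM; last exact: measurable_bind2.
    apply/measurable_EFinP; apply: measurableT_comp => //; exact: measurable_funB.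
  - by move=> y _; rewrite mule_ge0// ?bind_ge0// lee_fin.
  - by rewrite lee_fin mulr_ge0// exprn_ge0// ltW.
  rewrite -ge0_integral_mball; last 3 first.
  - apply: measurable_funeM; apply: emeasurable_funM; last exact: measurable_bind2.
    apply/measurable_EFinP; apply: measurableT_comp => //; exact: measurable_funB.
  - move=> y; rewrite mule_ge0// ?mule_ge0 ?bind_ge0// lee_fin//.
    by rewrite mulr_ge0// exprn_ge0// ltW.
  - by move=> y yD; rewrite gD// gx subr0 normr0 mul0e mule0.
  apply: ge0_le_integral => //.
  - by move=> y _; rewrite lee_fin mulr_ge0 ?kern_ge0.
  - exact: measurable_int (mean_sq x s0).
  - apply: measurable_funeM; apply: emeasurable_funM; last exact: measurable_bind2.
    apply/measurable_EFinP; apply: measurableT_comp => //; exact: measurable_funB.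
  move=> y _; rewrite /bind indicE -!EFinM lee_fin gx subr0.
  case: (boolP (y \in _)) => [|/negP].
    rewrite inE /eball/= => yx.
    have [i1 i2] := isx.
    have yD : D y.
      rewrite /unit_ball/eball/= subr0.
      have := enormD x (y - x); rewrite addrC subrK.
      by move: yx i2; move: (enorm _) (enorm _) (enorm _) (s^-1) => *; lra.
    have ye : 0 < dot y e.
      have := dot_le (x - y) e; rewrite dotBl e1 mulr1 enorm_distC.
      by move: yx i1; move: (enorm _) (dot _ _) (dot _ _) (s^-1) => *; lra.
    rewrite mulr1 -wg// ger0_norm// mulrC; apply: ler_wpM2r => //.
    exact: kern_le.
  rewrite inE /eball/= => /negP; rewrite -leNgt => yx.
  by rewrite mulr0 mulr0 kern_eq0// mulr0.
apply: (@le_trans _ _ (\int[m]_x ((s ^+ d * 4`!%:R)%:E * I x))%E).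
  by apply: ge0_le_integral => //; exact: measurable_funeM.
rewrite ge0_integralZl//; last by rewrite lee_fin mulr_ge0// exprn_ge0// ltW.
have := Hr _ s'0 sr; rewrite (vol_scale s0) -(fineK v1f).
rewrite -[X in (X <= _)%E -> _]/(\int[m]_x I x)%E => HI.
apply: le_trans (lee_wpmul2l _ HI) _.
  by rewrite lee_fin mulr_ge0// exprn_ge0// ltW.
rewrite -!EFinM lee_fin.
have -> : s ^+ d * 4`!%:R * (eps / C * (s^-1 ^+ d * fine (@vol R d 1))) =
    (s ^+ d * s^-1 ^+ d) * (eps * (4`!%:R * fine (@vol R d 1)) / C).
  by move: (s ^+ d) (s^-1 ^+ d) (4`!%:R) (fine _) (C^-1) => *; ring.
rewrite -exprMn divff ?gt_eqF// expr1n mul1r ler_pdivrMr//.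
by rewrite ler_wpM2l ?ltW// /C ltrDl.
Qed.

(** Either some mean at an inside point vanishes, and [w] vanishes on the half ball; or none does,
    and by [mean_ae0] the zeros of [w] form a null set. *)
Lemma max_principle g : (forall x, ~ D x -> g x = 0) -> test_approx g ->
  (forall x, D x -> 0 < dot x e -> w x = g x) ->
  {ae m, forall x, D x -> 0 < dot x e -> w x = 0} \/
  {ae m, forall x, D x -> 0 < dot x e -> 0 < w x}.
Proof.
move=> gD ag wg.
have [[n [x [ix nx]]]|H] := pselect (exists n x, inside n.+1%:R x /\ null_on x n.+1%:R).
  by left; exact: (strong_max (ltr0Sn R n) ix nx).
right; have HP n := mean_ae0 gD ag wg (ltr0Sn R n).
have := ae_foralln HP; apply: filterS => x K Dx xe.
have [n ix] := inside_exists Dx xe.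
rewrite lt_neqAle w0 andbT eq_sym; apply/negP => /eqP wx.
apply: H; exists n, x; split=> //.
by apply/(mean_eq0 _ (ltr0Sn R n)); exact: K.
Qed.

End maximum_principle.

(** * Consequences of equality under polarisation *)

Section dichotomy.
Context {R : realType} {d : nat}.
Local Notation V := 'rV[R]_d.
Local Notation D := (unit_ball R d).
Local Notation m := (mball R d).
Local Notation ip := (l2ip m).
Local Notation nrm := (l2nrm m).
Local Notation L := (leb R d).
Implicit Types (phi psi f g u v : V -> R) (x y e : V).

Lemma ae_ball : {ae m, forall x, D x}.
Proof.
exists (~` D); split=> //.
- by apply: measurableC; exact: measurable_unit_ball.
- by rewrite mballE setICl measure0.
Qed.

Lemma test_approx_ae f g : test_approx f -> sq m g -> {ae m, forall x, g x = f x} ->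
  test_approx g.
Proof.
move=> [sf af] sg gf; split=> // eps e0; have [phi tp H] := af _ e0.
exists phi => //; have sp := test_sq tp.
rewrite (nrm_ae (sqB sg sp) (sqB sf sp))//.
by apply: filterS gf => x ->.
Qed.

Lemma test_approx_sub f g : test_approx f -> test_approx g ->
  test_approx (fun x => f x - g x).
Proof.
move=> [sf af] [sg ag]; split; first exact: sqB.
move=> eps e0; have e2 : 0 < eps / 2 by rewrite divr_gt0.
have [phi tp H] := af _ e2; have [psi tq K] := ag _ e2.
exists (fun x => phi x - psi x); first exact: (test_sub tp tq).
have -> : (fun x => f x - g x - (phi x - psi x)) =
    (fun x => (f x - phi x) - (g x - psi x)) by apply/funext => x; ring.
apply: le_trans (nrmB (sqB sf (test_sq tp)) (sqB sg (test_sq tq))) _.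
by rewrite [leRHS]splitr lerD.
Qed.

Lemma test_approx_green f (i0 : 'I_d) : sq m f -> test_approx (green f).
Proof.
move=> sf; have [su H1 H2 _] := greenP i0 sf; split=> // eps e0.
have e2 : 0 < eps ^+ 2 / 4 by rewrite divr_gt0// exprn_gt0.
have [phi tp Hp] := H2 _ e2; exists phi => //.
rewrite -(@ler_pXn2r _ 2)// ?nnegrE ?nrm_ge0 ?(ltW e0)//.
apply: le_trans (H1 _ tp) _.
by move: Hp; move: (J _) (dfun _ _) (eps ^+ 2) => a b c *; lra.
Qed.

Lemma lap_near0 phi x : (\forall y \near x, phi y = 0) -> lap phi x = 0.
Proof.
have key psi i : (\forall y \near x, psi y = 0) -> \forall y \near x, partial i psi y = 0.
  move=> H; have := near_join H; apply: filterS => y Hy.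
  have E : \forall z \near y, (fun _ : V => 0 : R) z = psi z.
    by move: Hy; apply: filterS => z ->.
  by rewrite /partial -(near_eq_derive _ E); exact: (@derive_cst _ _ _ (0 : R)).
move=> H; rewrite /lap big1// => i _.
exact: (nbhs_singleton (key _ i (key _ i H))).
Qed.

(** Positive exactly where [x.e > dl] and [|x|^2 < 1 - dl]; these sets exhaust the open half ball as
    [dl] decreases. *)
Definition cap_bump e (dl : R) x : R :=
  bumpn 0 (dot x e - dl) * bumpn 0 (1 - dl - dot x x).

Lemma test_cap_bump e dl : 0 < dl -> dl <= 1 -> test_function (cap_bump e dl).
Proof.
move=> dl0 dl1; apply/test_functionP; split.
  apply/smoothP => k; apply: Ck_mul; apply: (Ck_comp (Rk_bumpn k 0)).
    by apply: Ck_sub; [exact: Ck_dot|exact: Ck_cst].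
  apply: Ck_sub; first exact: Ck_cst.
  by apply: Ck_sum => i; apply: Ck_mul; exact: Ck_coord.
exists (1 - dl / 2); first by apply/andP; split; lra.
move=> x xr; rewrite /cap_bump [X in _ * X]bumpn_eq0 ?mulr0//.
rewrite -enorm_dot; have : (1 - dl / 2) ^+ 2 <= enorm x ^+ 2.
  by rewrite lerXn2r ?nnegrE ?enorm_ge0//; lra.
by move: (enorm x ^+ 2) => a; nra.
Qed.

Lemma cap_bump_ge0 e dl x : 0 <= cap_bump e dl x.
Proof. by rewrite mulr_ge0// bumpn_ge0. Qed.

Lemma cap_bump_eq0 e dl x : dot x e <= dl -> cap_bump e dl x = 0.
Proof. by move=> H; rewrite /cap_bump bumpn_eq0 ?mul0r// subr_le0. Qed.

Lemma cap_bump_gt0 e x : D x -> 0 < dot x e ->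
  exists n : nat, 0 < cap_bump e n.+1%:R^-1 x.
Proof.
rewrite /unit_ball/eball/= subr0 => x1 xe.
have x2 : 0 < 1 - dot x x.
  by rewrite subr_gt0 -enorm_dot expr_lt1// enorm_ge0.
pose k := Num.min (dot x e) (1 - dot x x).
have k0 : 0 < k by rewrite lt_min xe.
have [n _ /(_ n (leqnn _)) nk] := near_infty_natSinv_lt (PosNum k0).
have {}nk : n.+1%:R^-1 < k := nk.
exists n; move: nk; rewrite lt_min => /andP[H1 H2].
rewrite mulr_gt0// bumpn_gt0//; first by rewrite subr_gt0.
by move: H2; move: (dot x x) (_^-1) => *; lra.
Qed.

(** On the positive side [pol u - u] is the positive part of [u o refl e - u]. By [green_pol] its
    Laplacian is [f - pol f], which is nonpositive there, so the maximum principle applies. *)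
Lemma half_dichotomy e f (i0 : 'I_d) : enorm e = 1 -> sq m f ->
  J (polarise e f) <= J f ->
  {ae m, forall x, D x -> 0 < dot x e -> f (refl e x) <= f x} \/
  {ae m, forall x, D x -> 0 < dot x e -> green f x < green f (refl e x)}.
Proof.
move=> e1 sf Jle; have sp := sq_pol e1 sf.
have [su _ _ Hu] := greenP i0 sf; have [su' _ _ Hu'] := greenP i0 sp.
have uu' := green_pol e1 i0 sf Jle.
have au := test_approx_green i0 sf; have au' := test_approx_green i0 sp.
set u := green f in su Hu uu' au *; set u' := green (polarise e f) in su' Hu' uu' au'.
have spu := sq_pol e1 su.
(* The indicator removes the arbitrary values of the potentials off the ball. *)
pose g x : R := \1_D x * (polarise e u x - u x).
have gD x : ~ D x -> g x = 0.
  by move=> xD; rewrite /g indicE memNset// mul0r.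
have ge x : D x -> g x = polarise e u x - u x.
  by move=> xD; rewrite /g indicE mem_set// mul1r.
have sg : sq m g.
  apply: (sq_le _ (sqB spu su)) => [|x].
    apply: measurable_funM; last exact: (measurable_funB (sq_meas spu) (sq_meas su)).
    exact: (measurable_indic measurable_unit_ball).
  by rewrite /g normrM ler_piMl// indicE; case: (_ \in _); rewrite ?normr1 ?normr0.
have gu : {ae m, forall x, g x = u' x - u x}.
  by have := ae_ball; apply: filterS2 uu' => x -> xD; rewrite ge.
have ag : test_approx g by apply: (test_approx_ae (test_approx_sub au' au)).
pose P := [set x : V | 0 < dot x e].
have mP : measurable P.
  rewrite -[X in measurable X]setTI.
  apply: (measurable_fun_ltr (f := fun=> 0) (g := fun x : V => dot x e)) => //.
  exact: continuous_measurable_rV (@continuous_dotr R d e).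
pose w x : R := \1_P x * g x.
have wg x : D x -> 0 < dot x e -> w x = g x.
  by move=> _ xe; rewrite /w indicE mem_set// mul1r.
have sw : sq m w.
  apply: (sq_le _ sg) => [|x].
    apply: measurable_funM; last exact: sq_meas sg.
    exact: (measurable_indic mP).
  by rewrite /w normrM ler_piMl// indicE; case: (_ \in _); rewrite ?normr1 ?normr0.
have polE h x : 0 < dot x e -> polarise e h x = Num.max (h x) (h (refl e x)).
  by move=> xe; rewrite /polarise (ltW xe).
have pol_ge h x : 0 < dot x e -> 0 <= polarise e h x - h x.
  by move=> xe; rewrite polE// subr_ge0 le_max lexx.
have w0 x : 0 <= w x.
  rewrite /w indicE; case: (boolP (x \in P)) => [|_]; last by rewrite mul0r.
  rewrite inE => /(pol_ge u) xe; rewrite mul1r /g mulr_ge0//.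
have lapE phi dl : 0 < dl -> test_function phi ->
    (forall x, dot x e <= dl -> phi x = 0) ->
    ip w (lap phi) = - ip (fun x => polarise e f x - f x) phi.
  move=> dl0 tp pz; have sl := test_sq (test_lap tp).
  have -> : ip w (lap phi) = ip g (lap phi).
    apply: eq_Rintegral => x _; rewrite /w indicE.
    case: (boolP (x \in P)) => [|/negP]; first by rewrite mul1r.
    rewrite inE /P/= => /negP; rewrite -leNgt => xe.
    rewrite lap_near0 ?mulr0//.
    have N : \forall y \near x, dot y e < dl.
      have xe' := le_lt_trans xe dl0.
      by have /cvgr_lt := @continuous_dotr R d e x; apply.
    by move: N; apply: filterS => y /ltW/pz.
  rewrite (ip_ae sg (sqB su' su) sl gu) (ipBl su' su sl) (Hu _ tp) (Hu' _ tp).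
  by rewrite (ipBl sp sf (test_sq tp)) opprB opprK addrC.
have sh : forall phi dl, 0 < dl -> test_function phi -> (forall x, 0 <= phi x) ->
    (forall x, dot x e <= dl -> phi x = 0) -> ip w (lap phi) <= 0.
  move=> phi dl dl0 tp p0 pz; rewrite (lapE _ _ dl0 tp pz) oppr_le0.
  apply: Rintegral_ge0 => x _; have [xe|xe] := leP (dot x e) dl.
    by rewrite pz// mulr0.
  by rewrite mulr_ge0// pol_ge// (lt_trans dl0).
have [wz|wp] := max_principle e1 sw sh w0 gD ag wg; last first.
  right; apply: filterS wp => x H Dx xe; have := H Dx xe.
  by rewrite wg// ge// polE// subr_gt0 lt_max ltxx.
left.
(* When [w] vanishes, the equation tested with [cap_bump] has a nonnegative integrand of integral
   zero, so [pol f = f] where the bump is positive. *)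
have K n : {ae m, forall x, (polarise e f x - f x) * cap_bump e n.+1%:R^-1 x = 0}.
  have n0 : 0 < n.+1%:R^-1 :> R by rewrite invr_gt0.
  have n1 : n.+1%:R^-1 <= 1 :> R by rewrite invf_le1// ler1n.
  have tp := test_cap_bump e n0 n1.
  have pz := @cap_bump_eq0 e n.+1%:R^-1.
  have I := sqM (sqB sp sf) (test_sq tp).
  have I0 : ip (fun x => polarise e f x - f x) (cap_bump e n.+1%:R^-1) = 0.
    apply/eqP; rewrite -oppr_eq0 -(lapE _ _ n0 tp pz).
    have sl := test_sq (test_lap tp).
    have wz2 : {ae m, forall x, w x = 0}.
      have := ae_ball; apply: filterS2 wz => x H xD; rewrite /w indicE.
      case: (boolP (x \in P)) => [|_]; last by rewrite mul0r.
      by rewrite inE => xe; have := H xD xe; rewrite wg// => ->; rewrite mulr0.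
    by rewrite (ip_ae sw (sq0 m) sl wz2) /l2ip; under eq_Rintegral do rewrite mul0r;
      rewrite /Rintegral integral0.
  have nn x : (0 <= ((polarise e f x - f x) * cap_bump e n.+1%:R^-1 x)%:E)%E.
    rewrite lee_fin; have [xe|xe] := leP (dot x e) n.+1%:R^-1.
      by rewrite pz// mulr0.
    by rewrite mulr_ge0 ?cap_bump_ge0// pol_ge// (lt_trans n0).
  have I1 : (\int[m]_x ((polarise e f x - f x) * cap_bump e n.+1%:R^-1 x)%:E = 0)%E.
    rewrite -[LHS]fineK; last exact: (integrable_fin_num measurableT I).
    by rewrite -[fine _]/(ip (fun x => polarise e f x - f x) (cap_bump e n.+1%:R^-1)) I0.
  have := ae_eq0_integral (measurable_int _ I) nn I1.
  by apply: filterS => x [].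
have := ae_foralln K; apply: filterS => x Kx xD xe.
have [n np] := cap_bump_gt0 xD xe.
have /eqP := Kx n; rewrite mulf_eq0 (gt_eqF np) orbF subr_eq0 polE// => /eqP <-.
by rewrite le_max lexx orbT.
Qed.

Lemma ae_refl e (P : V -> Prop) : enorm e = 1 ->
  {ae m, forall x, P x} -> {ae m, forall x, P (refl e x)}.
Proof.
move=> e1 [N [mN N0 NP]]; exists (refl e @^-1` N); split.
- by apply: preimage_measurable => //; exact: measurable_refl.
- by rewrite mball_refl.
- by move=> x /= Px; apply: NP.
Qed.

Lemma half_ball_not_null e : enorm e = 1 -> ~ {ae m, forall x, D x -> ~ 0 < dot x e}.
Proof.
move=> e1 [N [mN N0 HN]].
(* The open ball with diameter from the origin to [e] lies in the half ball. *)
have sub : eball (2^-1 *: e) 2^-1 `<=` N.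
  move=> x xb; apply: HN => /= H; apply: H.
    move: xb; rewrite /unit_ball/eball/= subr0.
    have := enormD (2^-1 *: e) (x - 2^-1 *: e).
    rewrite addrC subrK enormZ e1 ger0_norm//.
    by move: (enorm _) (enorm _) => a b *; lra.
  move: xb; rewrite /eball/=.
  have := dot_le (2^-1 *: e - x) e; rewrite dotBl dotZl -enorm_dot e1 enorm_distC.
  by move: (enorm _) (dot _ _) => a b *; lra.
have subD : eball (2^-1 *: e) 2^-1 `<=` D.
  move=> x; rewrite /unit_ball/eball/= subr0.
  have := enormD (2^-1 *: e) (x - 2^-1 *: e).
  rewrite addrC subrK enormZ e1 ger0_norm//.
  by move: (enorm _) (enorm _) => a b *; lra.
have : (m (eball (2^-1 *: e) 2^-1) <= m N)%E.
  by apply: le_measure; rewrite ?inE//; exact: measurable_eball.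
have m0 : m N = 0%E by exact: N0.
rewrite m0 mballE setIidl//; apply/negP; rewrite -ltNge.
by apply: leb_eball_gt0; rewrite invr_gt0.
Qed.

Lemma dichotomy e f (i0 : 'I_d) : enorm e = 1 -> sq m f ->
  J (polarise e f) <= J f -> J (polarise (- e) f) <= J f ->
  {ae m, forall x, D x -> 0 < dot x e -> f (refl e x) <= f x} \/
  {ae m, forall x, D x -> 0 < dot x e -> f x <= f (refl e x)}.
Proof.
move=> e1 sf J1 J2; have e1' : enorm (- e) = 1 by rewrite enormN.
have Dr x : D x -> D (refl e x) by rewrite /unit_ball/eball/= !subr0 enorm_refl.
have [H|H] := half_dichotomy i0 e1 sf J1; first by left.
have [K|K] := half_dichotomy i0 e1' sf J2.
  right; have := ae_refl e1 K; apply: filterS => x Hx xD xe.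
  have := Hx (Dr _ xD); rewrite reflNe reflK// dotNr dot_refl// opprK; exact.
exfalso; apply: (half_ball_not_null e1).
have := ae_refl e1 K; apply: filterS2 H => x Hx Kx xD xe.
have := Kx (Dr _ xD); rewrite reflNe reflK// dotNr dot_refl// opprK => /(_ xe).
by have := Hx xD xe => /lt_trans/[apply]; rewrite ltxx.
Qed.

End dichotomy.

(** * Level sets and spherical caps *)

Section density.
Context {R : realType} {d : nat}.
Local Notation V := 'rV[R]_d.
Local Notation D := (unit_ball R d).
Local Notation m := (mball R d).
Local Notation ip := (l2ip m).
Local Notation nrm := (l2nrm m).
Local Notation L := (leb R d).
Implicit Types (phi psi f g u v : V -> R) (x y e : V) (A B E : set V).

Lemma sq_indic A : measurable A -> sq m (\1_A : V -> R).
Proof.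
move=> mA; apply: (@sq_bounded _ _ _ (m : {finite_measure set V -> \bar R}) _ 1).
  exact: (measurable_indic mA).
by move=> x; rewrite indicE; case: (_ \in _); rewrite ?normr1 ?normr0.
Qed.

Lemma nrm_indic A : measurable A -> ((nrm (\1_A : V -> R) ^+ 2)%:E = m A)%E.
Proof.
move=> mA; rewrite nrm_sqr -(integral_sqr (sq_indic mA)).
under eq_integral => x _.
  rewrite (_ : (\1_A x : R) ^+ 2 = \1_A x); last first.
    by rewrite indicE; case: (_ \in _); rewrite ?expr1n ?expr0n.
  over.
by rewrite integral_indic// setIT.
Qed.

Lemma test_approx_add f g : test_approx f -> test_approx g ->
  test_approx (fun x => f x + g x).
Proof.
move=> [sf af] [sg ag]; split; first exact: sqD.
move=> eps e0; have e2 : 0 < eps / 2 by rewrite divr_gt0.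
have [phi tp H] := af _ e2; have [psi tq K] := ag _ e2.
exists (fun x => phi x + psi x); first exact: (test_add tp tq).
have -> : (fun x => f x + g x - (phi x + psi x)) =
    (fun x => (f x - phi x) + (g x - psi x)) by apply/funext => x; ring.
apply: le_trans (nrmD (sqB sf (test_sq tp)) (sqB sg (test_sq tq))) _.
by rewrite [leRHS]splitr lerD.
Qed.

Lemma test_approx_lim f : sq m f -> (forall eps, 0 < eps ->
    exists2 g, test_approx g & nrm (fun x => f x - g x) <= eps) -> test_approx f.
Proof.
move=> sf H; split=> // eps e0; have e2 : 0 < eps / 2 by rewrite divr_gt0.
have [g [sg ag] fg] := H _ e2; have [phi tp gp] := ag _ e2.
exists phi => //; apply: le_trans (nrm_tri sf sg (test_sq tp)) _.
by rewrite [leRHS]splitr lerD.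
Qed.

Lemma bump0_cvg1 (a b : R) : 0 < a ->
  bumpn 0 (n.+1%:R * a - b) @[n --> \oo] --> (1 : R).
Proof.
move=> a0; apply/cvgrPdist_le => eps e0.
have B : 0 < `|b| + eps^-1 by rewrite ltr_wpDl// invr_gt0.
have [N HN] : exists N : nat, (`|b| + eps^-1) / a <= N%:R.
  exists (Num.bound ((`|b| + eps^-1) / a)).
  by apply/ltW/archi_boundP; rewrite divr_ge0// ltW.
exists N => // n /= Nn.
have H : eps^-1 <= n.+1%:R * a - b.
  rewrite lerBrDr; apply: (@le_trans _ _ (`|b| + eps^-1)).
    by rewrite addrC lerD2r ler_norm.
  rewrite -ler_pdivrMr//; apply: le_trans HN _.
  by rewrite ler_nat (leq_trans Nn).
have ei : 0 < eps^-1 by rewrite invr_gt0.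
have s0 := lt_le_trans ei H.
rewrite ger0_norm ?subr_ge0 ?bump0_le1//.
rewrite lerBlDr -lerBlDl; apply: (@le_trans _ _ (1 - (n.+1%:R * a - b)^-1)).
  rewrite lerD2l lerN2 -[leRHS]invrK lef_pV2 ?posrE//.
rewrite /bumpn s0 expr0 mul1r; have := expR_ge1Dx (- (n.+1%:R * a - b)^-1).
by [].
Qed.

Lemma ecvg0_lt (u : nat -> \bar R) (eps : R) : u n @[n --> \oo] --> 0%E ->
  0 < eps -> \forall n \near \oo, (u n < eps%:E)%E.
Proof.
move=> /fine_cvgP[fu /cvgrPdist_lt cu] /cu; apply: filterS2 fu => n un.
by rewrite sub0r normrN => /(le_lt_trans (ler_norm _)); rewrite -lte_fin fineK.
Qed.

Lemma measurable_posset g : measurable_fun setT g -> measurable [set x | 0 < g x].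
Proof.
move=> mg; rewrite -[X in measurable X]setTI.
by apply: (measurable_fun_ltr (f := fun=> 0) (g := g)).
Qed.

Lemma test_approx_open g : smooth g -> test_approx (\1_[set x | 0 < g x]).
Proof.
move=> sg; have cg : continuous g := smooth_continuous sg.
have mU : measurable [set x | 0 < g x].
  exact: (measurable_posset (continuous_measurable_rV cg)).
set U := [set x | 0 < g x] in mU *; have sU := sq_indic mU.
(* The first factor tends to the indicator of [0 < g], the second to that of the ball; the shift by
   1 keeps the support away from the sphere. *)
pose chi (n : nat) x : R := bumpn 0 (n.+1%:R * g x - 0) *
                  bumpn 0 (n.+1%:R * (1 - dot x x) - 1).
have tchi n : test_function (chi n).
  apply/test_functionP; split.
    apply/smoothP => k; apply: Ck_mul; apply: (Ck_comp (Rk_bumpn k 0)).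
      apply: Ck_sub; last exact: Ck_cst.
      by apply: Ck_mul; [exact: Ck_cst|exact: smooth_Ck].
    apply: Ck_sub; last exact: Ck_cst.
    apply: Ck_mul; first exact: Ck_cst.
    apply: Ck_sub; first exact: Ck_cst.
    by apply: Ck_sum => i; apply: Ck_mul; exact: Ck_coord.
  pose q : R := n.+1%:R^-1.
  have q0 : 0 < q by rewrite invr_gt0.
  have q1 : q <= 1 by rewrite invf_le1// ler1n.
  have nq : n.+1%:R * q = 1 by rewrite divff.
  exists (1 - q / 2); first by apply/andP; split; lra.
  move=> x xr; rewrite /chi [X in _ * X]bumpn_eq0 ?mulr0//.
  have x2 : 1 - q <= dot x x.
    rewrite -enorm_dot; apply: le_trans (_ : (1 - q / 2) ^+ 2 <= _); first by nra.
    by rewrite lerXn2r ?nnegrE ?enorm_ge0//; lra.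
  have : n.+1%:R * (1 - dot x x) <= n.+1%:R * q by rewrite ler_wpM2l//; lra.
  by rewrite nq subr_le0.
have chi01 n x : 0 <= chi n x <= 1.
  by rewrite mulr_ge0 ?bumpn_ge0//= mulr_ile1 ?bumpn_ge0 ?bump0_le1.
pose h n x : R := \1_D x * (\1_U x - chi n x).
have mD : measurable D := measurable_unit_ball.
have smh n : measurable_fun setT (h n).
  apply: measurable_funM; first exact: (measurable_indic mD).
  exact: (sq_meas (sqB sU (test_sq (tchi n)))).
have hb n x : `|h n x| <= 1.
  rewrite /h normrM mulr_ile1//.
    by rewrite indicE; case: (_ \in _); rewrite ?normr1 ?normr0.
  have := chi01 n x; rewrite indicE => /andP[c0 c1]; rewrite ler_norml.
  by case: (_ \in _) => /=; apply/andP; split; lra.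
have sh n : sq m (h n).
  exact: (@sq_bounded _ _ _ (m : {finite_measure set V -> \bar R}) _ 1 (smh n) (hb n)).
have hc x : h n x @[n --> \oo] --> (0 : R).
  case: (boolP (x \in D)) => [|xD]; last first.
    rewrite (_ : (fun n => h n x) = fun=> 0); first exact: cvg_cst.
    by apply/funext => n; rewrite /h indicE (negbTE xD) mul0r.
  rewrite inE => xD; have xD' : 0 < 1 - dot x x.
    move: xD; rewrite /unit_ball/eball/= subr0 => x1.
    by rewrite subr_gt0 -enorm_dot expr_lt1// enorm_ge0.
  have [gx|gx] := ltP 0 (g x); last first.
    rewrite (_ : (fun n => h n x) = fun=> 0); first exact: cvg_cst.
    have U0 : x \notin U by apply/negP; rewrite inE /U/= ltNge gx.
    apply/funext => n; rewrite /h [X in _ * (X - _)]indicE (negbTE U0).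
    by rewrite /chi bumpn_eq0 ?mul0r ?subrr ?mulr0// subr0 mulr_ge0_le0.
  have -> : (fun n => h n x) = fun n => 1 - chi n x.
    by apply/funext => n; rewrite /h !indicE !mem_set// mul1r.
  rewrite -[X in _ --> X](subrr 1); apply: cvgB; first exact: cvg_cst.
  rewrite -[X in _ --> X](mulr1 1); apply: cvgM; exact: bump0_cvg1.
have I0 : (\int[m]_x (h n x ^+ 2)%:E @[n --> \oo] --> 0)%E.
  have -> : (0 = \int[m]_x (cst 0 x))%E by rewrite integral0.
  apply: (@dominated_cvg _ _ _ m setT measurableT (fun n x => (h n x ^+ 2)%:E)
    (cst 0%E) (cst 1%E)) => //.
  - by move=> n; apply/measurable_EFinP; exact: measurable_funX.
  - move=> x _; apply: cvg_EFin; first exact: nearW.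
    rewrite -[X in _ --> X](mulr0 (0 : R)).
    by under eq_fun do rewrite expr2; apply: cvgM; exact: hc.
  - exact: (@sq_integrable _ _ _ (m : {finite_measure set V -> \bar R}) _
      (@sq_cst _ _ _ (m : {finite_measure set V -> \bar R}) 1)).
  - move=> n x _; rewrite abse_EFin lee_fin normrX.
    by rewrite expr_le1.
apply: test_approx_lim => // eps e0.
have e2 : 0 < eps ^+ 2 by rewrite exprn_gt0.
have [N _ /(_ N (leqnn N)) /= HN] := ecvg0_lt I0 e2.
exists (chi N).
  split; first exact: test_sq.
  move=> eps' e'0; exists (chi N) => //.
  rewrite (_ : (fun x => _) = fun=> 0); last by apply/funext => x; rewrite subrr.
  rewrite /l2nrm /l2ip; under eq_Rintegral do rewrite mulr0.
  by rewrite /Rintegral integral0 sqrtr0 ltW.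
rewrite -(@ler_pXn2r _ 2)// ?nnegrE ?nrm_ge0 ?(ltW e0)//.
rewrite (nrm_ae (sqB sU (test_sq (tchi N))) (sh N)); last first.
  by apply: filterS (@ae_ball R d) => x xD; rewrite /h [X in _ = X * _]indicE mem_set// mul1r.
by rewrite -lee_fin nrm_sqr -integral_sqr// ltW.
Qed.

(** Coordinate half spaces are sets of this form and already make every coordinate measurable. *)
Lemma measurable_smooth_generated :
  @measurable _ V = <<s [set A | exists2 g, smooth g & A = [set x | 0 < g x]] >>.
Proof.
apply/seteqP; split => [A mA|]; last first.
  apply: smallest_sub; first exact: sigma_algebra_measurable.
  move=> _ [g sg ->].
  exact: (measurable_posset (continuous_measurable_rV (smooth_continuous sg))).
set G := [set A | _].
have mid : measurable_fun setT (idfun : g_sigma_algebraType G -> V).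
  apply: measurable_fun_rV => i.
  apply: (measurability _ (RGenOInfty.measurableE R)).
  move=> _ [_ [r ->] <-]; rewrite setTI; apply: sub_sigma_algebra.
  exists (fun x : V => x 0 i - r).
    apply/smoothP => k; apply: Ck_sub; [exact: Ck_coord|exact: Ck_cst].
  by apply/seteqP; split => x /=; rewrite in_itv/= andbT subr_gt0.
have := mid measurableT A mA; rewrite setTI; exact.
Qed.

(** Dynkin's theorem, with the positivity sets of smooth functions as generating pi-system. *)
Lemma test_approx_indic A : measurable A -> test_approx (\1_A).
Proof.
move=> mA; have mA' := mA; rewrite measurable_smooth_generated in mA'.
apply: (@dynkin_induction _ V _ (fun A => test_approx (\1_A))
  measurable_smooth_generated _ _ _ _ _ A mA').
- move=> _ _ [g sg ->] [h sh ->].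
  (* A smooth substitute for the product of the positive parts, positive exactly on the
     intersection. *)
  exists (fun x => bumpn 0 (g x) * bumpn 0 (h x)).
    by apply/smoothP => k; apply: Ck_mul; apply: (Ck_comp (Rk_bumpn k 0)); exact: smooth_Ck.
  apply/seteqP; split => x /=; first by move=> [g0 h0]; rewrite mulr_gt0// bumpn_gt0.
  have [g0|g0] := ltP 0 (g x); last by rewrite bumpn_eq0// mul0r ltxx.
  by have [h0|h0] := ltP 0 (h x); last by rewrite [X in _ * X]bumpn_eq0// mulr0 ltxx.
- have := test_approx_open (@smooth_cst R d 1); rewrite (_ : [set _ | _] = setT)//.
  by apply/seteqP; split => x //= _; exact: ltr01.
- by move=> _ [g sg ->]; exact: test_approx_open.
- move=> S mS aS; have := test_approx_open (@smooth_cst R d 1).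
  rewrite (_ : [set _ | _] = setT); last by apply/seteqP; split => x //= _; exact: ltr01.
  move=> aT; have := test_approx_sub aT aS; congr test_approx.
  by apply/funext => x; rewrite !indicE in_setT in_setC; case: (_ \in _); rewrite ?subrr ?subr0.
- move=> F mF tF aF.
  pose S n := \big[setU/set0]_(i < n) F i.
  have mS n : measurable (S n) by apply: bigsetU_measurable.
  have aS n : test_approx (\1_(S n)).
    elim: n => [|n IH].
      rewrite /S big_ord0; have := test_approx_open (@smooth_cst R d 0).
      by congr (test_approx (\1_ _)); apply/seteqP; split => x //=; rewrite ltxx.
    have := test_approx_add IH (aF n); congr test_approx.
    apply/funext => x; rewrite /S big_ord_recr/=.
    rewrite -/(S n) !indicE in_setU.
    case: (boolP (x \in F n)) => [|_]; last by rewrite orbF addr0.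
    rewrite inE => xF; rewrite orbT memNset ?add0r// => /= xS.
    move: xS; rewrite /S -bigcup_mkord => -[k /= kn Fk].
    have kE : k = n by apply: (tF k n I I); exists x.
    by move: kn; rewrite kE ltnn.
  have mU : measurable (\bigcup_k F k) by exact: bigcup_measurable.
  apply: test_approx_lim => [|eps e0]; first exact: sq_indic.
  have C : m (\bigcup_k F k `\` S n) @[n --> \oo] --> 0%E.
    have -> : 0%E = m (\bigcap_n (\bigcup_k F k `\` S n)).
      rewrite (_ : \bigcap_n _ = set0) ?measure0//.
      apply/seteqP; split => x // H; have [[k _ Fk] _] := H 0%N I.
      have [_] := H k.+1 I; apply.
      by rewrite /S -bigcup_mkord; exists k => //=.
    apply: nonincreasing_cvg_mu => //.
    - apply: (@le_lt_trans _ _ (m setT)).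
        by apply: le_measure; rewrite ?inE//; exact: measurableD.
      by rewrite -ge0_fin_numE// mball_setT_fin.
    - by move=> n; exact: measurableD.
    - by apply: bigcapT_measurable => n; exact: measurableD.
    - move=> i j ij; apply/subsetPset; apply: setDS.
      exact: subset_bigsetU.
  have e2 : 0 < eps ^+ 2 by rewrite exprn_gt0.
  have [N _ /(_ N (leqnn N)) /= HN] := ecvg0_lt C e2.
  exists (\1_(S N)); first exact: aS.
  rewrite -(@ler_pXn2r _ 2)// ?nnegrE ?nrm_ge0 ?(ltW e0)//.
  have -> : (fun x => \1_(\bigcup_k F k) x - \1_(S N) x) = (\1_(\bigcup_k F k `\` S N) : V -> R).
    apply/funext => x; rewrite !indicE in_setD.
    case: (boolP (x \in S N)) => [|_]; last by rewrite andbT subr0.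
    rewrite inE /S -bigcup_mkord => -[k _ Fk].
    by rewrite mem_set ?subrr//; exists k.
  by rewrite -lee_fin nrm_indic ?ltW//; exact: measurableD.
Qed.

End density.

(** * Upward closed versions of mirrored sets *)

Section upward_closed.
Context {R : realType} {d : nat}.
Local Notation V := 'rV[R]_d.
Local Notation D := (unit_ball R d).
Local Notation m := (mball R d).
Local Notation L := (leb R d).
Local Notation vol := (@vol R d).
Implicit Types (x y z e : V) (A B E : set V) (r : R).
Variable w : V.

Definition upward E : Prop := forall x y, enorm x = enorm y ->
  dot x w < dot y w -> E x -> E y.

(** The exceptional null set depends on [e], so this does not directly make [A] upward closed after
    removal of one null set. *)
Definition mirrored A : Prop := forall e, enorm e = 1 -> 0 < dot e w ->
  {ae m, forall x, D x -> 0 < dot x e -> A (refl e x) -> A x}.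

Lemma mirror_exists x y : enorm x = enorm y -> dot x w < dot y w ->
  exists e, [/\ enorm e = 1, 0 < dot e w, refl e y = x &
    exists2 c, 0 < c & y - x = c *: e].
Proof.
move=> xy xwy; pose c := enorm (y - x).
have c0 : 0 < c.
  rewrite /c lt0r enorm_ge0 andbT; apply/eqP => /enorm_eq0 /subr0_eq yx.
  by move: xwy; rewrite yx ltxx.
exists (c^-1 *: (y - x)).
have e1 : enorm (c^-1 *: (y - x)) = 1.
  by rewrite enormZ ger0_norm ?invr_ge0 ?(ltW c0)// mulVf// gt_eqF.
have ce : y - x = c *: (c^-1 *: (y - x)) by rewrite scalerA divff ?scale1r// gt_eqF.
split=> //; last by exists c.
  by rewrite dotZl mulr_gt0 ?invr_gt0// dotBl subr_gt0.
have H : dot y (y - x) = c ^+ 2 / 2.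
  rewrite /c enorm_dot !dotBl !dotBr (dotC x y) -!enorm_dot xy.
  by move: (enorm y) (dot _ _) => a b; lra.
rewrite /refl dotC dotZl (dotC (y - x)) H scalerA.
rewrite (_ : _ * _ = 1); last by field; rewrite gt_eqF.
by rewrite scale1r opprB addrC subrK.
Qed.

Lemma le_leb_ae A B : measurable A -> measurable B -> A `<=` D ->
  {ae m, forall x, A x -> B x} -> (L A <= L B)%E.
Proof.
move=> mA mB AD [N [mN N0 HN]].
apply: (@le_trans _ _ (L (B `|` (A `&` N)))).
  apply: le_measure; rewrite ?inE//.
    by apply: measurableU => //; exact: measurableI.
  move=> x Ax; have [Bx|Bx] := pselect (B x); [by left|right; split=> //].
  by apply: HN => /(_ Ax).
apply: le_trans (measureU2 _ _ _) _ => //; first exact: measurableI.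
rewrite [X in (_ + X)%E](_ : _ = 0%E) ?adde0//.
apply: (@subset_measure0 _ _ _ L _ (N `&` D)) => //.
- exact: measurableI.
- by apply: measurableI => //; exact: measurable_unit_ball.
- by move=> x [Ax Nx]; split=> //; exact: AD.
Qed.

(** The reflection taking [x] to [y] exchanges the two balls. Their common part counts equally on
    both sides, and the rest of the second ball lies on the positive side, where [mirrored]
    applies. *)
Lemma ball_mono A x y r : measurable A -> A `<=` D -> mirrored A ->
  enorm x = enorm y -> dot x w < dot y w ->
  (L (A `&` eball x r) <= L (A `&` eball y r))%E.
Proof.
move=> mA AD HA xy xwy.
have [e [e1 ew yx [c c0 ce]]] := mirror_exists xy xwy.
have mB z := measurable_eball z r : measurable (eball z r : set V).
set B := eball x r; set B' := eball y r.
have tauB z : B (refl e z) <-> B' z.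
  by rewrite /B /B' /eball/= -yx -reflB enorm_refl.
have tauB' z : B' (refl e z) <-> B z by rewrite -tauB reflK.
have decomp X Y : A `&` X = (A `&` X `&` Y) `|` (A `&` (X `\` Y)).
  apply/seteqP; split => z; last by case=> -[]; [case|move=> ? []].
  by move=> [Az Xz]; have [Yz|Yz] := pselect (Y z); [left|right].
have mI X Y : measurable X -> measurable Y -> measurable (A `&` X `&` Y).
  by move=> mX mY; apply: measurableI => //; exact: measurableI.
have mS X Y : measurable X -> measurable Y -> measurable (A `&` (X `\` Y)).
  by move=> mX mY; apply: measurableI => //; exact: measurableD.
have disj X Y : (A `&` X `&` Y) `&` (A `&` (X `\` Y)) = set0.
  by apply/seteqP; split => z // [[_ Yz] [_ [_]]].
have split X Y : measurable X -> measurable Y ->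
    (L (A `&` X) = L (A `&` X `&` Y) + L (A `&` (X `\` Y)))%E.
  move=> mX mY; rewrite {1}(decomp X Y).
  exact: (@measureU _ _ _ L _ _ (mI _ _ mX mY) (mS _ _ mX mY) (disj X Y)).
rewrite (split _ _ (mB x) (mB y)) (split _ _ (mB y) (mB x)) -/B -/B'.
rewrite (_ : A `&` B `&` B' = A `&` B' `&` B); last by rewrite setIAC.
apply: leeD => //.
have mAB := mS _ _ (mB x) (mB y).
rewrite -(leb_refl e1 mAB); apply: le_leb_ae.
- by apply: preimage_measurable => //; exact: measurable_refl.
- exact: (mS _ _ (mB y) (mB x)).
- by move=> z [/AD + _]; rewrite /unit_ball/eball/= !subr0 enorm_refl.
have := HA e e1 ew; apply: filterS => z Hz [Atz [Btz B'tz]].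
have B'z : B' z by apply/tauB.
have Bz : ~ B z by move=> /tauB'.
split=> //; apply: Hz => //.
  by move: (AD _ Atz); rewrite /unit_ball/eball/= !subr0 enorm_refl.
have : 0 < dot z (y - x).
  move: B'z Bz; rewrite /B /B' /eball/= => zy /negP; rewrite -leNgt => xz.
  have := lt_le_trans zy xz; rewrite -(@ltr_pXn2r _ 2)// ?nnegrE ?enorm_ge0//.
  rewrite !enorm_dot !dotBl !dotBr (dotC y z) (dotC x z) -!enorm_dot xy.
  by move: (enorm _) (enorm _) (dot _ _) (dot _ _) => a b p q *; lra.
by rewrite ce dotC dotZl dotC pmulr_rgt0.
Qed.

(* For a mirrored A these sets are upward closed, and they converge to A in
   measure as r tends to 0. *)
Definition majority A r : set V :=
  [set x | D x /\ ((2^-1)%:E * vol r < L (A `&` eball x r))%E].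

Lemma upward_majority A r : measurable A -> A `<=` D -> mirrored A ->
  upward (majority A r).
Proof.
move=> mA AD HA x y xy xwy [Dx Hx]; split.
  by move: Dx; rewrite /unit_ball/eball/= !subr0 xy.
apply: (lt_le_trans Hx); exact: (ball_mono r mA AD HA xy xwy).
Qed.

Lemma integral_indic_bind A x r : measurable A ->
  (\int[L]_y ((\1_A y)%:E * bind r x y) = L (A `&` eball x r))%E.
Proof.
move=> mA; have mB := measurable_eball x r : measurable (eball x r : set V).
have mAB : measurable (A `&` eball x r) by exact: measurableI.
transitivity (\int[L]_y (\1_(A `&` eball x r) y)%:E)%E.
  by apply: eq_integral => y _; rewrite /bind -EFinM !indicE in_setI -natrM mulnb.
by rewrite integral_indic// setIT.
Qed.

Lemma measurable_majority A r : measurable A -> measurable (majority A r).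
Proof.
move=> mA; apply: measurableI; first exact: measurable_unit_ball.
have mF : measurable_fun setT (fun x : V => L (A `&` eball x r)).
  under eq_fun do rewrite -integral_indic_bind//.
  apply: (measurable_fun_fubini_tonelli_F (m2 := L)
    (fun xy : V * V => (\1_A xy.2)%:E * bind r xy.1 xy.2)%E).
    apply: (@measurable_weight _ _ (fun y => (\1_A y)%:E)).
    by apply/measurable_EFinP; exact: (measurable_indic mA).
  by move=> xy; rewrite mule_ge0// ?bind_ge0// lee_fin.
rewrite -[X in measurable X]setTI.
exact: (measurable_lte measurableT (measurable_cst ((2^-1)%:E * vol r)%E) mF).
Qed.

Definition sdiff A B : set V := (A `\` B) `|` (B `\` A).

Lemma measurable_sdiff A B : measurable A -> measurable B -> measurable (sdiff A B).
Proof. by move=> mA mB; apply: measurableU; exact: measurableD. Qed.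

Lemma vol_gt0 r : 0 < r -> (0 < vol r)%E.
Proof. exact: leb_eball_gt0. Qed.

(** At a point of the symmetric difference, at least half of the ball carries the other value of the
    indicator. *)
Lemma majority_osc A r x : measurable A -> 0 < r -> D x -> sdiff (majority A r) A x ->
  ((2^-1)%:E * vol r <=
    \int[L]_y (`|\1_A y - \1_A x|%:E * bind r x y))%E.
Proof.
move=> mA r0 Dx [[[_ Hx] Ax]|[Ax Hx]].
  under eq_integral => y _.
    rewrite [X in (_ - X)](_ : _ = 0); last by rewrite indicE memNset.
    rewrite subr0 ger0_norm; last by rewrite indicE.
    over.
  by rewrite integral_indic_bind// ltW.
under eq_integral => y _.
  rewrite (_ : `|_| = \1_(~` A) y); last first.
    rewrite !indicE in_setC (mem_set Ax).
    by case: (y \in A); rewrite ?subrr ?normr0// sub0r normrN normr1.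
  over.
rewrite integral_indic_bind; last exact: measurableC.
have mB := measurable_eball x r : measurable (eball x r : set V).
have E : (vol r = L (A `&` eball x r) + L (~` A `&` eball x r))%E.
  rewrite -measureU//; [|exact: measurableI| |].
  - by rewrite -setIUl setUv setTI; exact/esym/leb_eball.
  - by apply: measurableI => //; exact: measurableC.
  - by rewrite setIACA setICr set0I.
have H : (L (A `&` eball x r) <= (2^-1)%:E * vol r)%E.
  by rewrite leNgt; apply/negP => H; apply: Hx.
have f1 : L (A `&` eball x r) \is a fin_num.
  rewrite ge0_fin_numE//; apply: le_lt_trans (leb_eball_ltoo x r).
  by apply: le_measure; rewrite ?inE//; exact: measurableI.
have f2 : L (~` A `&` eball x r) \is a fin_num.
  rewrite ge0_fin_numE//; apply: le_lt_trans (leb_eball_ltoo x r).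
  by apply: le_measure; rewrite ?inE//; apply: measurableI => //; exact: measurableC.
move: E H; rewrite -(fineK f1) -(fineK f2) -(fineK (vol_fin r)) -EFinD => -[->].
rewrite -!EFinM !lee_fin.
by move: (fine _) (fine _) => a b *; lra.
Qed.

(** Markov's inequality for the mean oscillation of the indicator, which is at least [vol r / 2] on
    the symmetric difference and small in integral by [mean_osc]. *)
Lemma majority_close A eps : measurable A -> A `<=` D -> 0 < eps ->
  exists2 r, 0 < r & (m (sdiff (majority A r) A) <= eps%:E)%E.
Proof.
move=> mA AD e0; have e2 : 0 < eps / 2 by rewrite divr_gt0.
have A0 x : ~ D x -> (\1_A x : R) = 0 by move=> nD; rewrite indicE memNset// => /AD.
have [r r0 Hr] := mean_osc A0 (test_approx_indic mA) e2.
exists r => //; have {Hr} := Hr r r0 (lexx r) => Hr.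
have mS := measurable_sdiff (measurable_majority r mA) mA.
pose I x : \bar R := (\int[L]_y (`|\1_A y - \1_A x|%:E * bind r x y))%E.
have I0 x : (0 <= I x)%E.
  by apply: integral_ge0 => y _; rewrite mule_ge0// ?bind_ge0// lee_fin.
have mI : measurable_fun setT I.
  apply: (measurable_fun_fubini_tonelli_F (m2 := L)
    (fun xy : V * V => `|\1_A xy.2 - \1_A xy.1|%:E * bind r xy.1 xy.2)%E).
    apply: emeasurable_funM; last exact: measurable_bind.
    apply/measurable_EFinP; apply: measurableT_comp => //.
    by apply: measurable_funB; apply: measurableT_comp => //; exact: measurable_indic.
  by move=> xy; rewrite mule_ge0// ?bind_ge0// lee_fin.
have v0 := vol_gt0 r0; have vf := @vol_fin R d r.
have K : ((2^-1)%:E * vol r * m (sdiff (majority A r) A) <= (eps / 2)%:E * vol r)%E.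
  apply: le_trans Hr; rewrite -[leRHS]/(\int[m]_x I x)%E.
  rewrite -(setIT (sdiff _ _)) -integral_indic//.
  have mi : measurable_fun setT (fun x : V => (\1_(sdiff (majority A r) A) x)%:E : \bar R).
    by apply/measurable_EFinP; exact: measurable_indic.
  have i0 (x : V) : setT x -> (0 <= (\1_(sdiff (majority A r) A) x)%:E :> \bar R)%E.
    by rewrite lee_fin.
  have c0 : (0 <= (2^-1)%:E * vol r)%E by rewrite mule_ge0.
  rewrite -(ge0_integralZl m measurableT mi i0 c0).
  apply: ae_ge0_le_integral => //.
  - by move=> x _; rewrite mule_ge0// ?mule_ge0// lee_fin.
  - apply: measurable_funeM; apply/measurable_EFinP; exact: measurable_indic.
  have := @ae_ball R d; apply: filterS => x Dx _; rewrite indicE.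
  case: (boolP (x \in _)) => [|_]; last by rewrite mule0.
  by rewrite inE mule1 => Hx; exact: majority_osc.
have mf : m (sdiff (majority A r) A) \is a fin_num.
  exact: (@fin_num_measure _ _ _ (m : {finite_measure set V -> \bar R})).
move: v0 K; rewrite -(fineK mf) -(fineK vf) -!EFinM lte_fin !lee_fin.
move: (fine _) (fine _) => a b b0 H.
by rewrite -(ler_pM2r b0); lra.
Qed.

(** With summable errors, Borel-Cantelli makes the upper limit of majority sets equal to [A] up to a
    null set, and upper limits of upward closed sets are upward closed. *)
Lemma upward_version A : measurable A -> A `<=` D -> mirrored A ->
  exists E, [/\ measurable E, E `<=` D, upward E & m (sdiff E A) = 0%E].
Proof.
move=> mA AD HA.
have H n : exists r, 0 < r /\ (m (sdiff (majority A r) A) <= (1 / 2 ^+ n.+1)%:E)%E.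
  have [|r r0 Hr] := @majority_close A (1 / 2 ^+ n.+1) mA AD; last by exists r.
  by rewrite divr_gt0// exprn_gt0.
pose r n := sval (cid (H n)).
have rP n : (m (sdiff (majority A (r n)) A) <= (1 / 2 ^+ n.+1)%:E)%E.
  by rewrite /r; case: cid => r' [].
pose F n := majority A (r n); pose S n := sdiff (F n) A.
have mF n : measurable (F n) by exact: measurable_majority.
have mS n : measurable (S n) by exact: measurable_sdiff.
have S0 : m (lim_sup_set S) = 0%E.
  apply: lim_sup_set_cvg0 => //.
  apply: (@le_lt_trans _ _ (\sum_(n <oo) (1 / 2 ^+ n.+1)%:E)%E).
    by apply: lee_nneseries => // n _; exact: rP.
  apply: le_lt_trans (ltry (1 : R)).
  have := @epsilon_trick0 R 1 xpredT ler01.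
  by under eq_eseriesr do rewrite natrX.
exists (lim_sup_set F); split.
- apply: bigcapT_measurable => n; apply: bigcup_measurable => j _; exact: mF.
- by move=> x /(_ 0%N I)[j _ [Dx _]].
- move=> x y xy xwy Fx n _; have [j nj Fj] := Fx n I.
  by exists j => //; exact: (upward_majority mA AD HA xy xwy).
apply: (@subset_measure0 _ _ _ m _ (lim_sup_set S)) => //.
- apply: measurable_sdiff => //.
  by apply: bigcapT_measurable => n; apply: bigcup_measurable => j _; exact: mF.
- by apply: bigcapT_measurable => n; apply: bigcup_measurable => j _; exact: mS.
move=> x [[Fx Ax] n _|[Ax Fx] n _].
  by have [j nj Fj] := Fx n I; exists j => //; left.
have [k Fk] : exists k, forall j, (k <= j)%N -> ~ F j x.
  apply: contrapT => /forallNP K; apply: Fx => k _.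
  have /existsNP[j /not_implyP[kj /contrapT Fj]] := K k.
  by exists j.
exists (maxn n k); first by rewrite /= leq_maxl.
by right; split=> //; apply: Fk; exact: leq_maxr.
Qed.

End upward_closed.

(** * Null sets in products *)

Section fubini_null.
Context d1 d2 (T1 : measurableType d1) (T2 : measurableType d2) (R : realType).
Variables (m1 : {sigma_finite_measure set T1 -> \bar R})
          (m2 : {sigma_finite_measure set T2 -> \bar R}).

Lemma ae_exists d0 (T0 : measurableType d0) (mu : {measure set T0 -> \bar R})
    (P : T0 -> Prop) : mu setT != 0%E -> {ae mu, forall x, P x} -> exists x, P x.
Proof.
move=> mu0 [N [mN N0 HN]]; apply: contrapT => /forallNP H.
move/eqP: mu0; apply; rewrite (_ : setT = N)//.
by apply/seteqP; split => x // _; apply: HN; exact: H.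
Qed.

(** By Tonelli, both conditions say that [S] is null for the product measure. *)
Lemma fubini_null (S : set (T1 * T2)) : measurable S ->
  {ae m1, forall x, m2 [set y | S (x, y)] = 0%E} ->
  {ae m2, forall y, m1 [set x | S (x, y)] = 0%E}.
Proof.
move=> mS H.
pose f (xy : T1 * T2) : \bar R := (\1_S xy)%:E.
have mf : measurable_fun setT f.
  by apply/measurable_EFinP; exact: measurable_indic.
have f0 xy : (0 <= f xy)%E by rewrite lee_fin.
have mx x : measurable [set y | S (x, y)].
  have := measurable_xsection x mS; congr measurable.
  by apply/seteqP; split => y; rewrite /xsection/= ?inE.
have my y : measurable [set x | S (x, y)].
  have := measurable_ysection y mS; congr measurable.
  by apply/seteqP; split => x; rewrite /ysection/= ?inE.
have Fx x : (\int[m2]_y f (x, y) = m2 [set y | S (x, y)])%E.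
  transitivity (\int[m2]_y (\1_[set y | S (x, y)] y)%:E)%E.
    by apply: eq_integral => y _; rewrite /f !indicE; congr (_%:R%:E); apply/idP/idP; rewrite !inE.
  by rewrite integral_indic// setIT.
have Fy y : (\int[m1]_x f (x, y) = m1 [set x | S (x, y)])%E.
  transitivity (\int[m1]_x (\1_[set x | S (x, y)] x)%:E)%E.
    by apply: eq_integral => x _; rewrite /f !indicE; congr (_%:R%:E); apply/idP/idP; rewrite !inE.
  by rewrite integral_indic// setIT.
have mF := measurable_fun_fubini_tonelli_F (m2 := m2) f mf f0.
have mG := measurable_fun_fubini_tonelli_G (m1 := m1) f mf f0.
have I0 : (\int[m2]_y `|\int[m1]_x f (x, y)| = 0)%E.
  under eq_integral => y _ do rewrite gee0_abs ?integral_ge0//.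
  rewrite -(fubini_tonelli f mf f0).
  rewrite (ae_eq_integral (cst 0%E))//; first by rewrite integral0.
  by move: H; apply: filterS => x Hx _; rewrite Fx.
have /ae_eq_integral_abs := I0; move=> /(_ measurableT mG).
by apply: filterS => y /(_ I); rewrite Fy.
Qed.

End fubini_null.

(** * Null sets in polar coordinates *)

Section polar.
Context {R : realType} {d : nat}.
Local Notation V := 'rV[R]_d.
Local Notation D := (unit_ball R d).
Local Notation L := (leb R d).
Local Notation L1 := (leb R 1).
Implicit Types (x y z e v : V) (A B E : set V) (r s : R).

Lemma leb_setT_neq0 n : leb R n setT != 0%E.
Proof.
rewrite gt_eqF//; apply: lt_le_trans (leb_eball_gt0 (0 : 'rV[R]_n) ltr01) _.
by apply: le_measure; rewrite ?inE//; exact: measurable_eball.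
Qed.

Lemma leb_set1 n (x : 'rV[R]_n) : (0 < n)%N -> leb R n [set x] = 0%E.
Proof.
case: n x => // n x _.
have -> : [set x] = [set y | forall i, x 0 i <= y 0 i <= x 0 i].
  apply/seteqP; split => y /=; first by move=> -> i; rewrite lexx.
  by move=> H; apply/rowP => i; apply/esym/le_anti.
have := @lebesgue_rV_box R n.+1 x x (fun i => lexx _).
by rewrite big_ord_recl subrr mul0r.
Qed.

Lemma leb_subset0 n (A B : set 'rV[R]_n) : measurable A -> measurable B ->
  A `<=` B -> leb R n B = 0%E -> leb R n A = 0%E.
Proof. by move=> mA mB AB; exact: (@subset_measure0 _ _ _ (leb R n)). Qed.

Lemma measurable_set1V n (x : 'rV[R]_n) : measurable [set x].
Proof.
rewrite -(setCK [set x]); apply: measurableC.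
rewrite (_ : ~` _ = [set y | 0 < enorm (y - x)]).
  apply: (measurable_posset (g := fun y : 'rV[R]_n => enorm (y - x))).
  exact: (measurableT_comp measurable_enorm (measurable_shift (- x))).
apply/seteqP; split => y /=.
  by move=> /eqP yx; rewrite enorm_gt0// subr_eq0.
by move=> + yx; rewrite yx subrr enorm0 ltxx.
Qed.

Lemma ae_neq0 n (P : 'rV[R]_n -> Prop) : (0 < n)%N ->
  {ae leb R n, forall x : 'rV[R]_n, P x} -> exists2 x, x != 0 & P x.
Proof.
move=> n0 H.
have H0 : {ae leb R n, forall x : 'rV[R]_n, x != 0}.
  exists [set 0]; split; first exact: measurable_set1V.
    exact: leb_set1.
  by move=> x /= /negP; rewrite negbK => /eqP.
have [x [x0 Px]] : exists x : 'rV[R]_n, x != 0 /\ P x.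
  by apply: (ae_exists (leb_setT_neq0 n)); apply: filterS2 H0 H.
by exists x.
Qed.

Lemma leb_scale_eq0 n s (A : set 'rV[R]_n) : 0 < s -> measurable A ->
  leb R n ( *:%R s @^-1` A) = 0%E <-> leb R n A = 0%E.
Proof.
move=> s0 mA; rewrite leb_scale//; split => [/eqP|->]; last by rewrite mule0.
by rewrite mule_eq0 eqe gt_eqF ?exprn_gt0 ?invr_gt0//= => /eqP.
Qed.

Lemma measurable_inv_enorm : measurable_fun setT (fun x => (enorm x)^-1).
Proof.
rewrite (_ : (fun x => _) = (fun x => enorm x `^ (-1))); last first.
  by apply/funext => x; rewrite powR_inv1// enorm_ge0.
by apply: (measurableT_comp (measurable_powR _)); exact: measurable_enorm.
Qed.

Lemma measurable_fun_scaleV dT (T : measurableType dT) (f : T -> R) (g : T -> V) :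
  measurable_fun setT f -> measurable_fun setT g ->
  measurable_fun setT (fun t => f t *: g t).
Proof.
move=> mf mg; apply: measurable_fun_rV => i; under eq_fun do rewrite mxE.
by apply: measurable_funM => //; exact: (measurableT_comp (measurable_coord i)).
Qed.

Definition radial (a : R) z : V := (a / enorm z) *: z.

Lemma enorm_radial a z : 0 <= a -> z != 0 -> enorm (radial a z) = a.
Proof.
move=> a0 z0; have zp := enorm_gt0 z0.
by rewrite /radial enormZ ger0_norm ?divr_ge0 ?enorm_ge0// divfK// gt_eqF.
Qed.

Lemma radial_scale a s z : 0 < s -> radial a (s *: z) = radial a z.
Proof.
move=> s0; rewrite /radial enormZ gtr0_norm// scalerA; congr (_ *: _).
have [->|z0] := eqVneq (enorm z) 0; first by rewrite mulr0 invr0 mulr0 mul0r.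
by field; rewrite z0/= gt_eqF.
Qed.

Lemma measurable_radial dT (T : measurableType dT) (f : T -> R) (g : T -> V) :
  measurable_fun setT f -> measurable_fun setT g ->
  measurable_fun setT (fun t => radial (f t) (g t)).
Proof.
move=> mf mg; apply: measurable_fun_scaleV => //; apply: measurable_funM => //.
exact: (measurableT_comp measurable_inv_enorm).
Qed.

Hypothesis d0 : (0 < d)%N.

(** In [Sz] and [Sx] the component in ['rV[R]_1] only supplies the positive factor [enorm s]; as a
    vector it is measured by [leb R 1], to which the scaling lemmas apply. *)
Let Sz E := [set p : 'rV[R]_1 * V | p.1 != 0 /\ E (enorm p.1 *: p.2)].
Let Sx E z := [set p : V * 'rV[R]_1 | p.2 != 0 /\ E (radial (enorm p.2 * enorm p.1) z)].
Let Sxz E := [set p : V * V | E (radial (enorm p.1) p.2)].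

Let meas_n0 dT (T : measurableType dT) n (f : T -> 'rV[R]_n) :
  measurable_fun setT f -> measurable [set t | f t != 0].
Proof.
move=> mf; rewrite (_ : [set _ | _] = [set t | 0 < enorm (f t)]).
  rewrite -[X in measurable X]setTI.
  apply: (measurable_fun_ltr (f := fun=> 0) (g := fun t => enorm (f t))) => //.
  exact: (measurableT_comp measurable_enorm).
apply/seteqP; split => t /=; first exact: enorm_gt0.
by apply: contraTneq => ->; rewrite enorm0 ltxx.
Qed.

Let mSz E : measurable E -> measurable (Sz E).
Proof.
move=> mE; apply: measurableI; first exact: (meas_n0 measurable_fst).
apply: (preimage_measurable _ mE); apply: measurable_fun_scaleV => //.
exact: (measurableT_comp measurable_enorm measurable_fst).
Qed.

Let mSx E z : measurable E -> measurable (Sx E z).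
Proof.
move=> mE; apply: measurableI; first exact: (meas_n0 measurable_snd).
apply: (preimage_measurable _ mE); apply: measurable_radial => //.
apply: measurable_funM.
  exact: (measurableT_comp measurable_enorm measurable_snd).
exact: (measurableT_comp measurable_enorm measurable_fst).
Qed.

Let mSxz E : measurable E -> measurable (Sxz E).
Proof.
move=> mE; apply: (preimage_measurable _ mE); apply: measurable_radial => //.
exact: (measurableT_comp measurable_enorm measurable_fst).
Qed.

Let m_ray E z (a : R) : measurable E ->
  measurable [set s : 'rV[R]_1 | s != 0 /\ E (radial (enorm s * a) z)].
Proof.
move=> mE; apply: measurableI; first exact: (@meas_n0 _ _ 1 (@id 'rV[R]_1)).
apply: (preimage_measurable _ mE); apply: measurable_radial => //.
by apply: measurable_funM => //; exact: measurable_enorm.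
Qed.

Let m_K E z (a : R) : measurable E -> measurable [set x : V | E (radial (a * enorm x) z)].
Proof.
move=> mE; apply: (preimage_measurable _ mE); apply: measurable_radial => //.
by apply: measurable_funM => //; exact: measurable_enorm.
Qed.

Let dil_null E (s : 'rV[R]_1) : measurable E -> s != 0 ->
  L [set z | E (enorm s *: z)] = 0%E <-> L E = 0%E.
Proof. by move=> mE s0; exact: (leb_scale_eq0 (enorm_gt0 s0) mE). Qed.

Let ray_null E z (a : R) : measurable E -> z != 0 -> 0 < a ->
  L1 [set s : 'rV[R]_1 | s != 0 /\ E (radial (enorm s * a) z)] = 0%E <->
  L1 [set s : 'rV[R]_1 | s != 0 /\ E (enorm s *: z)] = 0%E.
Proof.
move=> mE z0 a0; have zp := enorm_gt0 z0.
have q0 : 0 < a / enorm z by rewrite divr_gt0.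
have mr := m_ray z (enorm z) mE.
have E1 : [set s : 'rV[R]_1 | s != 0 /\ E (enorm s *: z)] =
    [set s : 'rV[R]_1 | s != 0 /\ E (radial (enorm s * enorm z) z)].
  by apply/seteqP; split => s /=; rewrite /radial mulfK// gt_eqF.
rewrite E1 -(leb_scale_eq0 q0 mr).
rewrite (_ : [set s | _] = *:%R (a / enorm z) @^-1`
    [set s : 'rV[R]_1 | s != 0 /\ E (radial (enorm s * enorm z) z)])//.
apply/seteqP; split => s /=; rewrite scaler_eq0 gt_eqF//= enormZ gtr0_norm//;
  by rewrite mulrAC divfK ?gt_eqF// mulrC.
Qed.

Let K_null E z (s : 'rV[R]_1) : measurable E -> s != 0 ->
  L [set x : V | E (radial (enorm s * enorm x) z)] = 0%E <->
  L [set x : V | E (radial (enorm x) z)] = 0%E.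
Proof.
move=> mE s0; have sp := enorm_gt0 s0.
have m1 : measurable [set x : V | E (radial (enorm x) z)].
  have := m_K z 1 mE; congr measurable.
  by apply/seteqP; split => x /=; rewrite mul1r.
rewrite -(leb_scale_eq0 sp m1).
rewrite (_ : *:%R (enorm s) @^-1` _ = [set x : V | E (radial (enorm s * enorm x) z)])//.
by apply/seteqP; split => x /=; rewrite enormZ gtr0_norm.
Qed.

(* A scaling in the radius and one in the direction, together with Tonelli,
   replace integration in polar coordinates. *)
Lemma polar_null E : measurable E -> ~ E 0 ->
  L E = 0%E <-> {ae L, forall x, L [set z | E (radial (enorm x) z)] = 0%E}.
Proof.
move=> mE E0.
have z_ne0 : {ae L, forall z : V, z != 0}.
  exists [set 0]; split; first exact: measurable_set1V.
    exact: leb_set1.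
  by move=> x /= /negP; rewrite negbK => /eqP.
(* All dilates of [E] are null as soon as one is, so Tonelli on [Sz] relates this to null
   intersections with almost every ray. *)
have swap_z : L E = 0%E <->
    {ae L, forall z, L1 [set s : 'rV[R]_1 | s != 0 /\ E (enorm s *: z)] = 0%E}.
  split=> [LE|H].
    apply: (fubini_null (m1 := L1) (m2 := L) (mSz mE)).
    apply: aeW => s; have [s0|s0] := eqVneq s 0.
      rewrite (_ : [set _ | _] = set0) ?measure0//.
      by apply/seteqP; split => z //= []; rewrite s0 eqxx.
    rewrite (_ : [set _ | _] = [set z | E (enorm s *: z)]); first exact/dil_null.
    by apply/seteqP; split => z //= [].
  have mS' : measurable [set p : V * 'rV[R]_1 | Sz E (p.2, p.1)].
    apply: (preimage_measurable (f := fun p : V * 'rV[R]_1 => (p.2, p.1)) _ (mSz mE)).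
    exact: measurable_fun_pair.
  have := fubini_null (m1 := L) (m2 := L1) mS' H.
  move=> /(ae_neq0 (n := 1) isT)[s s0].
  rewrite (_ : [set _ | _] = [set z | E (enorm s *: z)]); first exact: (dil_null mE s0).1.
  by apply/seteqP; split => z //= [].
(* On a fixed ray the radius may be measured by a one-dimensional [s] or by a [d]-dimensional [x]:
   in [Sx], apart from [s = 0], membership depends only on the product of the two norms. *)
have swap_x z : z != 0 ->
    L1 [set s : 'rV[R]_1 | s != 0 /\ E (enorm s *: z)] = 0%E <->
    L [set x : V | E (radial (enorm x) z)] = 0%E.
  move=> z0; split => H.
    have : {ae L1, forall s : 'rV[R]_1, L [set x : V | Sx E z (x, s)] = 0%E}.
      apply: (fubini_null (m1 := L) (m2 := L1) (mSx z mE)).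
      apply: aeW => x; have [x0|x0] := eqVneq x 0.
        rewrite (_ : [set _ | _] = set0) ?measure0//.
        apply/seteqP; split => s //= []; rewrite x0 enorm0 mulr0.
        by rewrite /radial mul0r scale0r.
      by apply/(ray_null mE z0 (enorm_gt0 x0)).
    move=> /(ae_neq0 (n := 1) isT)[s s0].
    rewrite (_ : [set _ | _] = [set x : V | E (radial (enorm s * enorm x) z)]).
      exact: (K_null z mE s0).1.
    by apply/seteqP; split => x //= [].
  have mS' : measurable [set p : 'rV[R]_1 * V | Sx E z (p.2, p.1)].
    apply: (preimage_measurable (f := fun p : 'rV[R]_1 * V => (p.2, p.1)) _ (mSx z mE)).
    exact: measurable_fun_pair.
  have : {ae L, forall x : V, L1 [set s : 'rV[R]_1 | Sx E z (x, s)] = 0%E}.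
    apply: (fubini_null (m1 := L1) (m2 := L) mS').
    apply: aeW => s; have [s0|s0] := eqVneq s 0.
      rewrite (_ : [set _ | _] = set0) ?measure0//.
      by apply/seteqP; split => x //= []; rewrite s0 eqxx.
    rewrite (_ : [set _ | _] = [set x : V | E (radial (enorm s * enorm x) z)]).
      exact/(K_null z mE s0).
    by apply/seteqP; split => x //= [].
  by move=> /(ae_neq0 d0)[x x0 Hx]; apply/(ray_null mE z0 (enorm_gt0 x0)).
have mS' : measurable [set p : V * V | Sxz E (p.2, p.1)].
  apply: (preimage_measurable (f := fun p : V * V => (p.2, p.1)) _ (mSxz mE)).
  exact: measurable_fun_pair.
rewrite swap_z; split => H.
  apply: (fubini_null (m1 := L) (m2 := L) mS').
  by move: H; apply: filterS2 z_ne0 => z z0 /(swap_x z z0).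
have := fubini_null (m1 := L) (m2 := L) (mSxz mE) H.
by apply: filterS2 z_ne0 => z z0 /(swap_x z z0).
Qed.

(** Each line of direction [v] meets [E] at most once. Fubini is applied to the sheared set [S],
    whose sections at fixed [s] are translates of [E]. *)
Lemma line_null E v : measurable E ->
  (forall z (s t : R), E (z + s *: v) -> E (z + t *: v) -> s = t) -> L E = 0%E.
Proof.
move=> mE H.
pose S := [set p : V * 'rV[R]_1 | E (p.1 + p.2 0 0 *: v)].
have mS : measurable S.
  apply: (preimage_measurable _ mE); apply: measurable_fun_addV => //.
  apply: measurable_fun_scaleV => //.
  exact: (measurableT_comp (measurable_coord 0) measurable_snd).
have : {ae L1, forall s : 'rV[R]_1, L [set z : V | S (z, s)] = 0%E}.
  apply: (fubini_null (m1 := L) (m2 := L1) mS); apply: aeW => z.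
  have mz : measurable [set s : 'rV[R]_1 | S (z, s)].
    have := measurable_xsection z mS; congr measurable.
    by apply/seteqP; split => y; rewrite /xsection/= ?inE.
  have [[s Ss]|/forallNP nS] := pselect (exists s : 'rV[R]_1, S (z, s)); last first.
    rewrite (_ : [set _ | _] = set0) ?measure0//.
    by apply/seteqP; split => s // /nS.
  apply: (leb_subset0 mz _ _ (leb_set1 s isT)).
    exact: measurable_set1V.
  move=> t St; apply/rowP => i; rewrite ord1.
  exact: (H z _ _ St Ss).
move=> /(ae_neq0 (n := 1) isT)[s _].
rewrite (_ : [set _ | _] = (fun z => z + s 0 0 *: v) @^-1` E)//.
by rewrite leb_shift.
Qed.

End polar.

(** * Circular cones about an axis *)

Section cones.
Context {R : realType} {d : nat}.
Local Notation V := 'rV[R]_d.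
Local Notation D := (unit_ball R d).
Local Notation L := (leb R d).
Implicit Types (x y z e v : V) (A B E : set V) (r s q : R).
Variable w : V.
Hypothesis w1 : enorm w = 1.

Definition shell r : set V := [set z | 0 < enorm z < r].
(** The part within radius [r] of the cone over [E] on the sphere of radius [r]; its volume is
    proportional to the surface measure of that section. *)
Definition slice r E : set V := shell r `&` [set z | E (radial r z)].
Definition cap_cone q : set V := [set z | q * enorm z < dot z w].
Definition level_cone q : set V := [set z | dot z w = q * enorm z].

Lemma measurable_dotr : measurable_fun setT (fun z => dot z w).
Proof. exact: continuous_measurable_rV (@continuous_dotr R d w). Qed.

Lemma measurable_shell r : measurable (shell r).
Proof.
have me := @measurable_enorm R d.
apply: (preimage_measurable (f := @enorm R d) (A := `]0, r[%classic)) => //.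
Qed.

Lemma measurable_slice r E : measurable E -> measurable (slice r E).
Proof.
move=> mE; apply: measurableI; first exact: measurable_shell.
by apply: (preimage_measurable _ mE); exact: measurable_radial.
Qed.

Lemma measurable_cone_gt q : measurable (cap_cone q).
Proof.
rewrite -[X in measurable X]setTI; apply: measurable_fun_ltr => //.
  by apply: measurable_funM => //; exact: measurable_enorm.
exact: measurable_dotr.
Qed.

Lemma measurable_cone_eq q : measurable (level_cone q).
Proof.
rewrite (_ : level_cone q = (fun z => dot z w - q * enorm z) @^-1` [set 0]).
  apply: preimage_measurable; last exact: measurable_set1.
  apply: measurable_funB; first exact: measurable_dotr.
  by apply: measurable_funM => //; exact: measurable_enorm.
apply/seteqP; split => z /=; first by move=> ->; rewrite subrr.
by move=> /eqP; rewrite subr_eq0 => /eqP.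
Qed.

Lemma leb_shell_fin r (E : set V) : measurable E ->
  L (shell r `&` E) \is a fin_num.
Proof.
move=> mE; rewrite ge0_fin_numE//; apply: le_lt_trans (leb_eball_ltoo 0 r).
apply: le_measure; rewrite ?inE; [|exact: measurable_eball|].
  by apply: measurableI => //; exact: measurable_shell.
by move=> z [/andP[_ zr] _]; rewrite /eball/= subr0.
Qed.

Definition perp z : V := z - dot z w *: w.

Lemma perp_dot z : dot (perp z) w = 0.
Proof. by rewrite /perp dotBl dotZl -enorm_dot w1 expr1n mulr1 subrr. Qed.

Lemma perp_line z (s : R) : perp (z + s *: w) = perp z.
Proof.
rewrite /perp dotDl dotZl -enorm_dot w1 expr1n mulr1 scalerDl opprD addrACA.
by rewrite subrr addr0.
Qed.

Lemma perpB x y : perp (x - y) = perp x - perp y.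
Proof. by rewrite /perp dotBl scalerBl !opprD !opprK addrACA. Qed.

Lemma enorm_perp z : enorm z ^+ 2 = enorm (perp z) ^+ 2 + dot z w ^+ 2.
Proof.
have E : z = perp z + dot z w *: w by rewrite subrK.
have wp : dot w (perp z) = 0 by rewrite dotC perp_dot.
rewrite {1}E; move: (dot z w) (perp z) wp => c p wp.
rewrite !enorm_dot dotDl !dotDr !dotZl !dotZr (dotC p w) wp -(enorm_dot w) w1.
by ring.
Qed.

Lemma measurable_perp0 : measurable [set z | perp z = 0].
Proof.
have mp : measurable_fun setT perp.
  apply: measurable_fun_subV; first exact: measurable_id.
  by apply: measurable_fun_scaleV; [exact: measurable_dotr|exact: measurable_cst].
exact: (preimage_measurable mp (measurable_set1V 0)).
Qed.

Hypothesis d2 : (1 < d)%N.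

(** Otherwise two distinct basis vectors, which are orthogonal, would both be multiples of [w]. *)
Lemma not_parallel : exists v, perp v <> 0.
Proof.
apply: contrapT => /forallNP H.
have P v : v = dot v w *: w.
  by have /contrapT/eqP := H v; rewrite subr_eq0 => /eqP.
pose i : 'I_d := Ordinal (ltnW d2); pose j : 'I_d := Ordinal d2.
have Ei : w 0 i ^+ 2 = 1.
  have := congr1 (fun v => dot v v) (P (delta_mx 0 i)).
  rewrite dotZl dotZr -(enorm_dot w) w1 expr1n mulr1 -enorm_dot enorm_delta expr1n.
  by rewrite dotC dot_delta.
have Ej : w 0 j ^+ 2 = 1.
  have := congr1 (fun v => dot v v) (P (delta_mx 0 j)).
  rewrite dotZl dotZr -(enorm_dot w) w1 expr1n mulr1 -enorm_dot enorm_delta expr1n.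
  by rewrite dotC dot_delta.
have Eij : w 0 i * w 0 j = 0.
  have := congr1 (fun v => dot v (delta_mx 0 j)) (P (delta_mx 0 i)).
  by rewrite dotZl !dot_delta dotC dot_delta !mxE.
have : (w 0 i * w 0 j) ^+ 2 = 1 by rewrite exprMn Ei Ej mulr1.
by rewrite Eij expr0n/= => /esym/eqP; rewrite oner_eq0.
Qed.

Lemma axis_null : L [set z | perp z = 0] = 0%E.
Proof.
have [v v0] := not_parallel; apply: (line_null (v := v)); first exact: measurable_perp0.
move=> z s t /= Hs Ht; apply: contrapT => /eqP st; apply: v0.
have E : perp ((s - t) *: v) = 0.
  have -> : (s - t) *: v = (z + s *: v) - (z + t *: v).
    by rewrite opprD addrACA subrr add0r scalerBl.
  by rewrite perpB Hs Ht subrr.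
move: E; rewrite /perp dotZl -scalerA -scalerBr => /eqP.
by rewrite scaler_eq0 subr_eq0 (negbTE st)/= => /eqP.
Qed.

(** Off the axis, a line of direction [w] meets the cone at most once: its distance [k] from the
    axis gives [|z|^2 (1 - q^2) = k^2], which fixes [|z|] and then [z.w = q |z|]. The axis itself is
    null. *)
Lemma cone_eq_null q : L (level_cone q) = 0%E.
Proof.
have mA := measurable_perp0; have mC := measurable_cone_eq q.
have mCA : measurable (level_cone q `\` [set z | perp z = 0]) by exact: measurableD.
have N : L (level_cone q `\` [set z | perp z = 0]) = 0%E.
  apply: (line_null (v := w)) => // z s t [/= Hs Ps] [/= Ht _].
  move: Hs Ht Ps; rewrite /level_cone/= !dotDl !dotZl -(enorm_dot w) w1 expr1n !mulr1.
  have := enorm_perp (z + s *: w); have := enorm_perp (z + t *: w).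
  rewrite !perp_line !dotDl !dotZl -(enorm_dot w) w1 expr1n !mulr1.
  have ns := enorm_ge0 (z + s *: w); have nt := enorm_ge0 (z + t *: w).
  move=> Et Es Hs Ht /eqP/enorm_gt0 k0; rewrite Hs in Es; rewrite Ht in Et.
  have k2 : 0 < enorm (perp z) ^+ 2 by rewrite exprn_gt0.
  move: Hs Ht Et Es ns nt k2; move: (enorm (z + s *: w)) (enorm (z + t *: w)).
  move: (enorm (perp z) ^+ 2) (dot z w) => k c a b Hs Ht Et Es a0 b0 k0'.
  have ab : a ^+ 2 = b ^+ 2.
    have A : a ^+ 2 * (1 - q ^+ 2) = k by rewrite mulrBr mulr1 {1}Es; ring.
    have B : b ^+ 2 * (1 - q ^+ 2) = k by rewrite mulrBr mulr1 {1}Et; ring.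
    have q1 : 1 - q ^+ 2 != 0.
      by apply/eqP => q0; move: A k0'; rewrite q0 mulr0 => <-; rewrite ltxx.
    by apply: (mulIf q1); rewrite A B.
  have ab' : a = b by apply/eqP; rewrite -(@eqrXn2 _ 2)// ab.
  by apply: (@addrI _ c); rewrite Hs Ht ab'.
apply: (leb_subset0 mC (B := (level_cone q `\` [set z | perp z = 0]) `|` [set z | perp z = 0])).
- exact: measurableU.
- by move=> z Cz; have [?|?] := pselect (perp z = 0); [right|left].
- by apply: null_set_setU => //; exact: axis_null.
Qed.

Lemma cone_gt_le q q' : q <= q' -> cap_cone q' `<=` cap_cone q.
Proof.
move=> qq z; apply: le_lt_trans; apply: ler_wpM2r => //; exact: enorm_ge0.
Qed.

Definition capvol r q : \bar R := L (shell r `&` cap_cone q).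

Lemma measurable_shell_cone r q : measurable (shell r `&` cap_cone q).
Proof. by apply: measurableI; [exact: measurable_shell|exact: measurable_cone_gt]. Qed.

Lemma cap_vol_le r q q' : q <= q' -> (capvol r q' <= capvol r q)%E.
Proof.
move=> qq; apply: le_measure; rewrite ?inE; [exact: measurable_shell_cone..|].
by apply: setIS; exact: cone_gt_le.
Qed.

Definition cos_axis z : R := dot z w / enorm z.

Lemma cosine_bound z : -1 <= cos_axis z <= 1.
Proof.
rewrite -ler_norml /cos_axis normrM normfV (ger0_norm (enorm_ge0 z)).
have [z0|z0] := eqVneq (enorm z) 0; first by rewrite z0 invr0 mulr0.
have zp : 0 < enorm z by rewrite lt0r z0 enorm_ge0.
by rewrite ler_pdivrMr// mul1r (le_trans (dot_norm_le _ _))// w1 mulr1.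
Qed.

Lemma cone_gt_cosine z q : 0 < enorm z -> cap_cone q z <-> q < cos_axis z.
Proof. by move=> z0; rewrite /cap_cone/= /cos_axis ltr_pdivlMr. Qed.

Lemma cone_eq_cosine z q : 0 < enorm z -> level_cone q z <-> cos_axis z = q.
Proof.
move=> z0; rewrite /level_cone/= /cos_axis; split => [->|<-].
  by rewrite mulfK// gt_eqF.
by rewrite divfK// gt_eqF.
Qed.

Lemma cap_vol_tie r q q' : q <= q' -> capvol r q = capvol r q' ->
  L (shell r `&` cap_cone q `\` cap_cone q') = 0%E.
Proof.
move=> qq E.
have -> : shell r `&` cap_cone q `\` cap_cone q' =
    (shell r `&` cap_cone q) `\` (shell r `&` cap_cone q').
  by apply/seteqP; split => z; [move=> [[? ?] ?]; split=> // -[]|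
    move=> [[? ?] H]; split=> // ?; exact: H].
have m1 := measurable_shell_cone r q; have m2 := measurable_shell_cone r q'.
have f1 := leb_shell_fin r (measurable_cone_gt q).
have sub : shell r `&` cap_cone q' `<=` shell r `&` cap_cone q.
  by apply: setIS; exact: cone_gt_le.
rewrite measureD//; last by rewrite -ge0_fin_numE.
rewrite [X in (_ - L X)%E](_ : _ = shell r `&` cap_cone q'); last exact/setIidPr.
move: E; rewrite /capvol => <-; exact: subee.
Qed.

(* The distribution of the cosine has no atom, so its tail function takes a
   given value only on a null cone. *)
Lemma shell_tie_null r (c : \bar R) :
  L.-negligible (shell r `&` [set z | capvol r (cos_axis z) = c]).
Proof.
set G := _ `&` _.
pose Q := [set cos_axis z | z in G].
have [[z0 Gz0]|/forallNP G0] := pselect (exists z, G z); last first.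
  rewrite (_ : G = set0); first exact: negligible_set0.
  by apply/seteqP; split => z // /G0.
have Q0 : Q !=set0 by exists (cos_axis z0), z0.
have Ql : has_lbound Q.
  by exists (-1) => _ [z _ <-]; case/andP: (cosine_bound z).
have Qu : has_ubound Q.
  by exists 1 => _ [z _ <-]; case/andP: (cosine_bound z).
(* [capvol r] takes the same value at all cosines in [Q], so the cone between any two of them is
   null. Cosines near [a] and near [b] exhaust what lies strictly between. *)
pose a := inf Q; pose b := sup Q.
have H n : exists z z', [/\ G z, G z', cos_axis z < a + n.+1%:R^-1 &
    b - n.+1%:R^-1 < cos_axis z'].
  have n0 : 0 < n.+1%:R^-1 :> R by rewrite invr_gt0.
  have [_ [z Gz <-] Hz] := inf_adherent n0 (conj Q0 Ql).
  have [_ [z' Gz' <-] Hz'] := sup_adherent n0 (conj Q0 Qu).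
  by exists z, z'.
pose zn n := sval (cid (H n)); pose zn' n := sval (cid (svalP (cid (H n)))).
have HP n : [/\ G (zn n), G (zn' n), cos_axis (zn n) < a + n.+1%:R^-1 &
    b - n.+1%:R^-1 < cos_axis (zn' n)] := svalP (cid (svalP (cid (H n)))).
pose S n := shell r `&` cap_cone (cos_axis (zn n)) `\` cap_cone (cos_axis (zn' n)).
have mS n : measurable (S n).
  apply: measurableD; [exact: measurable_shell_cone|exact: measurable_cone_gt].
have S0 n : L (S n) = 0%E.
  have [[_ E1] [_ E2] _ _] := HP n.
  have [le|/ltW ge] := leP (cos_axis (zn n)) (cos_axis (zn' n)).
    by apply: cap_vol_tie => //; rewrite E1 E2.
  rewrite (_ : S n = set0) ?measure0//; apply/seteqP; split => z //.
  by move=> [[_ zc] zc']; apply: zc'; exact: cone_gt_le zc.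
have neg : L.-negligible (level_cone a `|` level_cone b `|` \bigcup_n S n).
  apply: negligibleU; first apply: negligibleU.
  - by apply/negligibleP; [exact: measurable_cone_eq|exact: cone_eq_null].
  - by apply/negligibleP; [exact: measurable_cone_eq|exact: cone_eq_null].
  - apply: (@negligible_bigcup _ _ _ L S) => n; exists (S n).
    by split; [exact: mS|exact: S0|].
apply: negligibleS neg.
move=> z Gz; have [/andP[zp zr] _] := Gz.
have az : a <= cos_axis z by apply: ge_inf => //; exists z.
have zb : cos_axis z <= b by apply: sup_upper_bound => //; exists z.
have [az'|az'] := eqVneq (cos_axis z) a; first by left; left; apply/cone_eq_cosine.
have [bz'|bz'] := eqVneq (cos_axis z) b; first by left; right; apply/cone_eq_cosine.
right; have k0 : 0 < Num.min (cos_axis z - a) (b - cos_axis z).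
  by rewrite lt_min !subr_gt0 !lt_neqAle az zb eq_sym az' bz'.
have [n _ /(_ n (leqnn _)) nk] := near_infty_natSinv_lt (PosNum k0).
have {}nk : n.+1%:R^-1 < Num.min (cos_axis z - a) (b - cos_axis z) := nk.
move: nk; rewrite lt_min => /andP[k1 k2].
have [_ _ H1 H2] := HP n; exists n => //; split.
  split; first by rewrite /shell/= zp.
  by apply/cone_gt_cosine => //; move: k1 H1; move: (_^-1) => *; lra.
by move=> /(cone_gt_cosine _ zp); move: k2 H2; move: (_^-1) => *; lra.
Qed.

End cones.

(** * Spherical caps of prescribed measure *)

Section slices.
Context {R : realType} {d : nat}.
Local Notation V := 'rV[R]_d.
Local Notation L := (leb R d).
Implicit Types (x y z e v : V) (A B E : set V) (r s q : R).
Variable w : V.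
Hypothesis w1 : enorm w = 1.
Local Notation cone_gt := (cap_cone w).
Local Notation cone_eq := (level_cone w).
Local Notation cosine := (cos_axis w).
Local Notation cap_vol := (capvol w).

Lemma shell_neq0 r z : shell r z -> z != 0.
Proof. by move=> /andP[z0 _]; apply: contraTneq z0 => ->; rewrite enorm0 ltxx. Qed.

Lemma cone_gt_radial q r z : 0 < r -> z != 0 -> cone_gt q (radial r z) <-> cone_gt q z.
Proof.
move=> r0 z0; have zp := enorm_gt0 z0.
rewrite /cap_cone/= enorm_radial ?(ltW r0)// /radial dotZl.
by rewrite mulrAC -mulrA (mulrC q) ltr_pM2l// ltr_pdivlMr.
Qed.

Lemma dist_axis x (a : R) :
  enorm (x - a *: w) ^+ 2 = enorm x ^+ 2 - 2 * a * dot x w + a ^+ 2.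
Proof.
rewrite !enorm_dot !dotBl !dotBr !dotZl !dotZr -(enorm_dot w) w1 (dotC w).
by move: (dot x x) (dot x w) => p q; ring.
Qed.

(** Law of cosines on the sphere through [x]. *)
Lemma eball_cone_gt x (rho : R) : 0 < enorm x -> 0 <= rho ->
  eball (enorm x *: w) rho x <-> cone_gt (1 - rho ^+ 2 / (2 * enorm x ^+ 2)) x.
Proof.
move=> x0 rho0; rewrite /eball/= -(@ltr_pXn2r _ 2)// ?nnegrE ?enorm_ge0//.
rewrite dist_axis.
rewrite /cap_cone/= mulrBl mul1r.
have -> : rho ^+ 2 / (2 * enorm x ^+ 2) * enorm x = rho ^+ 2 / (2 * enorm x).
  by field; rewrite gt_eqF.
rewrite ltrBlDr -ltrBlDl ltr_pdivlMr ?mulr_gt0//.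
by move: (enorm x) (dot x w) (rho ^+ 2) => a b c; split => H; nra.
Qed.

Lemma slice_eball r (rho : R) : 0 < r -> 0 <= rho ->
  slice r (eball (r *: w) rho) =
  shell r `&` cone_gt (1 - rho ^+ 2 / (2 * r ^+ 2)).
Proof.
move=> r0 rho0; apply/seteqP; split => z [zs H]; split=> //.
  have z0 := shell_neq0 zs; have er := enorm_radial (ltW r0) z0.
  apply/(cone_gt_radial _ r0 z0); rewrite -{1}er; apply/eball_cone_gt => //.
    by rewrite er.
  by rewrite er.
have z0 := shell_neq0 zs; have er := enorm_radial (ltW r0) z0.
move: H => /(cone_gt_radial _ r0 z0) H; rewrite /= -{1}er.
by apply/eball_cone_gt => //; rewrite er.
Qed.

Lemma radius_of_height r q : 0 < r -> q <= 1 ->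
  exists2 rho : R, 0 <= rho & 1 - rho ^+ 2 / (2 * r ^+ 2) = q.
Proof.
move=> r0 q1; exists (Num.sqrt (2 * r ^+ 2 * (1 - q))); first exact: sqrtr_ge0.
rewrite sqr_sqrtr; last by rewrite mulr_ge0 ?subr_ge0// mulr_ge0 ?sqr_ge0.
rewrite mulrAC divff ?mul1r; first by rewrite opprB addrC subrK.
by rewrite mulf_neq0// expf_neq0// gt_eqF.
Qed.

Lemma cap_vol1 r : cap_vol r 1 = 0%E.
Proof.
rewrite /capvol (_ : _ `&` _ = set0) ?measure0//.
apply/seteqP; split => z // [_]; rewrite /cap_cone/= mul1r => H.
by have := dot_le z w; rewrite w1 mulr1 leNgt H.
Qed.

Lemma measurable_cap r q : measurable (shell r `&` cone_gt q).
Proof. exact: measurable_shell_cone. Qed.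

(** Intermediate values of the tail function: at the infimum [a] of the heights with measure at most
    [c], increasing unions give one inequality and decreasing intersections the other, as level
    cones are null. *)
Lemma quantile r (c : \bar R) : (1 < d)%N -> 0 < r -> (0 <= c)%E -> (c <= L (shell r))%E ->
  exists2 q, q <= 1 & cap_vol r q = c.
Proof.
move=> d2 r0 c0 cs.
pose S := [set q | -1 <= q <= 1 /\ (cap_vol r q <= c)%E].
have S1 : S 1 by split; [apply/andP; split; lra|rewrite cap_vol1].
have lS : has_lbound S by exists (-1) => q [/andP[]].
pose a := inf S.
have a1 : a <= 1 by exact: ge_inf.
have aN1 : -1 <= a by apply: lb_le_inf; [exists 1|move=> q [/andP[]]].
exists a => //; apply/eqP; rewrite eq_le; apply/andP; split.
  pose F (n : nat) := shell r `&` cone_gt (a + n.+1%:R^-1).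
  have E : shell r `&` cone_gt a = \bigcup_n F n.
    apply/seteqP; split => z; last first.
      move=> [n _ [zs zc]]; split=> //; apply: cone_gt_le zc.
      by rewrite lerDl invr_ge0.
    move=> [zs zc]; have [zp _] := andP zs.
    have k0 : 0 < cosine z - a by rewrite subr_gt0; apply/cone_gt_cosine.
    have [n _ /(_ n (leqnn _)) nk] := near_infty_natSinv_lt (PosNum k0).
    have {}nk : n.+1%:R^-1 < cosine z - a := nk.
    by exists n => //; split=> //; apply/cone_gt_cosine => //; rewrite -ltrBrDl.
  have C : L (F n) @[n --> \oo] --> L (\bigcup_n F n).
    apply: (@nondecreasing_cvg_mu _ _ _ L).
    - by move=> n; exact: measurable_cap.
    - by apply: bigcup_measurable => n _; exact: measurable_cap.
    - move=> n k nk; apply/subsetPset; apply: setIS; apply: cone_gt_le.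
      by rewrite lerD2l lef_pV2 ?posrE// ler_nat.
  rewrite /capvol E -(cvg_lim (@ereal_hausdorff R) C).
  apply: lime_le; first by apply/cvg_ex; exists (L (\bigcup_n F n)).
  apply: nearW => n; have n0 : 0 < n.+1%:R^-1 :> R by rewrite invr_gt0.
  have [q [_ Hq] qa] := inf_adherent n0 (conj (ex_intro _ 1 S1) lS).
  by apply: le_trans Hq; apply: cap_vol_le; exact: ltW.
have null q : L (shell r `&` cone_eq q) = 0%E.
  apply: (leb_subset0 _ (measurable_cone_eq w q)) => //; last exact: cone_eq_null.
  by apply: measurableI; [exact: measurable_shell|exact: measurable_cone_eq].
have mce q : measurable (shell r `&` cone_eq q).
  by apply: measurableI; [exact: measurable_shell|exact: measurable_cone_eq].
have bound X : measurable X -> X `<=` (shell r `&` cone_gt a) `|` (shell r `&` cone_eq a) ->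
    (L X <= cap_vol r a)%E.
  move=> mX sub; apply: (@le_trans _ _ (L ((shell r `&` cone_gt a) `|` (shell r `&` cone_eq a)))).
    apply: le_measure; rewrite ?inE//; apply: measurableU => //; exact: measurable_cap.
  apply: le_trans (measureU2 _ _ _) _ => //; first exact: measurable_cap.
  by rewrite [X in (_ + X <= _)%E]null adde0.
(* No smaller height is available at -1, but there the cap is the whole shell up to a null cone. *)
have [aE|aE] := eqVneq a (-1).
  apply: le_trans cs _; apply: bound; first exact: measurable_shell.
  move=> z zs; have [zp _] := andP zs; have /andP[c1 _] := cosine_bound w1 z.
  have [ac|ac] := ltP a (cosine z); first by left; split=> //; apply/cone_gt_cosine.
  right; split=> //; apply/cone_eq_cosine => //.
  by apply: le_anti; rewrite ac aE c1.
have a1' : 0 < a + 1 by rewrite -ltrBlDr sub0r lt_neqAle eq_sym aE.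
(* Scaling the offsets by [a + 1] keeps [an n] below [a] and at least -1, the range allowed in
   [S]. *)
pose an (n : nat) := a - (a + 1) * n.+1%:R^-1.
pose F (n : nat) := shell r `&` cone_gt (an n).
have C : L (F n) @[n --> \oo] --> L (\bigcap_n F n).
  apply: (@nonincreasing_cvg_mu _ _ _ L).
  - by rewrite -ge0_fin_numE//; apply: leb_shell_fin; exact: measurable_cone_gt.
  - by move=> n; exact: measurable_cap.
  - by apply: bigcapT_measurable => n; exact: measurable_cap.
  - move=> n k nk; apply/subsetPset; apply: setIS; apply: cone_gt_le.
    by rewrite lerD2l lerN2 ler_pM2l// lef_pV2 ?posrE// ler_nat.
apply: (@le_trans _ _ (L (\bigcap_n F n))).
  rewrite -(cvg_lim (@ereal_hausdorff R) C).
  apply: lime_ge; first by apply/cvg_ex; exists (L (\bigcap_n F n)).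
  apply: nearW => n; rewrite leNgt; apply/negP => /ltW H.
  have n0 : 0 < n.+1%:R^-1 :> R by rewrite invr_gt0.
  have n1 : n.+1%:R^-1 <= 1 :> R by rewrite invf_le1// ler1n.
  have : a <= an n.
    apply: ge_inf => //; split=> //; rewrite /an; apply/andP; split.
      have : (a + 1) * n.+1%:R^-1 <= a + 1 by rewrite ler_piMr// ltW.
      by move: (_ * _) => k; lra.
    by rewrite lerBlDr (le_trans a1)// lerDl mulr_ge0 ?ltW.
  by rewrite /an lerBrDr gerDl leNgt mulr_gt0.
apply: bound.
  by apply: bigcapT_measurable => n; exact: measurable_cap.
move=> z Hz; have [zs _] := Hz 0%N I; have [zp _] := andP zs.
have [ac|ac] := ltP a (cosine z); first by left; split=> //; apply/cone_gt_cosine.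
right; split=> //; apply/cone_eq_cosine => //; apply: le_anti; rewrite ac/= leNgt.
apply/negP => ca; have k0 : 0 < (a - cosine z) / (a + 1) by rewrite divr_gt0// subr_gt0.
have [n _ /(_ n (leqnn _)) nk] := near_infty_natSinv_lt (PosNum k0).
have {}nk : n.+1%:R^-1 < (a - cosine z) / (a + 1) := nk.
have [_ /(cone_gt_cosine w _ zp)] := Hz n I; apply/negP; rewrite -leNgt /an.
by move: nk; rewrite ltr_pdivlMr// mulrC; move: (_ * _) => k; lra.
Qed.

Lemma slice_shell r E : slice r E `<=` shell r.
Proof. by move=> z []. Qed.

Lemma rho_exists2 r A : (1 < d)%N -> 0 < r -> measurable A ->
  exists2 rho : R, 0 <= rho & L (slice r (eball (r *: w) rho)) = L (slice r A).
Proof.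
move=> d2 r0 mA; have mS := measurable_slice r mA.
have [||q q1 Hq] := @quantile r (L (slice r A)) d2 r0; first by [].
  by apply: le_measure; rewrite ?inE//; [exact: measurable_shell|exact: slice_shell].
have [rho rho0 E] := radius_of_height r0 q1.
by exists rho => //; rewrite slice_eball// E.
Qed.

(* In dimension one this half ball is the cone over a point of the sphere. *)
Lemma ray_ball_gt0 r v : 0 < r -> enorm v = 1 ->
  (0 < L (shell r `&` [set z | (0 < dot z v)%R]))%E.
Proof.
move=> r0 v1; have r2 : 0 < r / 2 by rewrite divr_gt0.
apply: lt_le_trans (leb_eball_gt0 ((r / 2) *: v) r2) _.
have mP : measurable [set z | 0 < dot z v].
  apply: (measurable_posset (g := fun z => dot z v)).
  exact: continuous_measurable_rV (@continuous_dotr R d v).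
apply: le_measure; rewrite ?inE; [exact: measurable_eball| |].
  by apply: measurableI => //; exact: measurable_shell.
move=> z; rewrite /eball/= => zb.
have dz : 0 < dot z v.
  have := dot_le ((r / 2) *: v - z) v.
  rewrite dotBl dotZl -enorm_dot v1 enorm_distC expr1n !mulr1.
  by move: zb; move: (enorm _) (dot z v) => a b *; lra.
split=> //; apply/andP; split.
  by apply: enorm_gt0; apply: contraTneq dz => ->; rewrite dot0l ltxx.
have := enormD ((r / 2) *: v) (z - (r / 2) *: v).
have -> : enorm ((r / 2) *: v) = r / 2 by rewrite enormZ v1 mulr1 ger0_norm// ltW.
rewrite addrC subrK.
by move: zb; move: (enorm _) (enorm _) => a b *; lra.
Qed.

End slices.

(** * Caps in dimension one *)

Section dimension_one.
Context {R : realType}.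
Local Notation V := 'rV[R]_1.
Local Notation L := (leb R 1).
Implicit Types (x y z : V) (A B E : set V) (r : R).
Variable w : V.
Hypothesis w1 : enorm w = 1.

Lemma rV1E x : x = dot x w *: w.
Proof.
apply/rowP => i; rewrite ord1 mxE /dot big_ord1.
have : w 0 0 ^+ 2 = 1 by have := enorm_dot w; rewrite w1 expr1n /dot big_ord1.
by rewrite -mulrA -expr2 => ->; rewrite mulr1.
Qed.

Lemma enorm_rV1 x : enorm x = `|dot x w|.
Proof. by rewrite {1}(rV1E x) enormZ w1 mulr1. Qed.

Lemma radial_rV1 r z : z != 0 -> radial r z = (if 0 < dot z w then r else - r) *: w.
Proof.
move=> z0; have zp := enorm_gt0 z0; rewrite /radial {2}(rV1E z) scalerA; congr (_ *: _).
move: zp; rewrite enorm_rV1; have [p _|p] := ltP 0 (dot z w).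
  by rewrite gtr0_norm// divfK// gt_eqF.
rewrite ler0_norm// oppr_gt0 => n.
by rewrite invrN mulrN mulNr divfK// lt_eqF.
Qed.

Lemma slice_rV1 r A z : slice r A z <->
  shell r z /\ A ((if 0 < dot z w then r else - r) *: w).
Proof.
split=> -[zs H]; split=> //; have z0 := shell_neq0 zs.
  by rewrite -radial_rV1.
by rewrite /= radial_rV1.
Qed.

(** The sphere has two points: radius [3 r] captures both, [r] only [r w], and 0 neither. If [A]
    contains only [- r w], its slice is the mirror image of that of the cap. *)
Lemma rho_exists1 r A : 0 < r -> measurable A ->
  exists2 rho : R, 0 <= rho & L (slice r (eball (r *: w) rho)) = L (slice r A).
Proof.
move=> r0 mA.
have B1 (rho : R) : 0 < rho -> eball (r *: w) rho (r *: w).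
  by move=> p; rewrite /eball/= subrr enorm0.
have B2 (rho : R) : eball (r *: w) rho (- r *: w) <-> 2 * r < rho.
  rewrite /eball/= -scalerBl enormZ w1 mulr1 -opprD normrN ger0_norm ?addr_ge0 ?ltW//.
  by rewrite (_ : r + r = 2 * r)//; lra.
have ext X Y : (X (r *: w) <-> Y (r *: w)) -> (X (- r *: w) <-> Y (- r *: w)) ->
    slice r X = slice r Y.
  by move=> h1 h2; apply/seteqP; split => z /slice_rV1[zs H]; apply/slice_rV1;
    split=> //; move: H; case: ifP => _; rewrite ?h1 ?h2.
have [A1|A1] := pselect (A (r *: w)); have [A2|A2] := pselect (A (- r *: w)).
- exists (3 * r); first by rewrite mulr_ge0 ?ltW.
  by congr L; apply: ext; split=> // _; [apply: B1|apply/B2]; lra.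
- exists r; first exact: ltW.
  congr L; apply: ext; first by split=> // _; exact: B1.
  by split=> // /B2; lra.
- exists r; first exact: ltW.
  rewrite -(leb_opp (measurable_slice r mA)); congr L.
  have dz0 z : shell r z -> dot z w != 0.
    by move=> /shell_neq0; apply: contraNneq => E; rewrite (rV1E z) E scale0r.
  apply/seteqP; split => z.
    move=> /slice_rV1[zs H]; apply/slice_rV1; have z0 := dz0 _ zs.
    split; first by rewrite /shell/= enormN.
    rewrite dotNl oppr_gt0; move: H; have [p|p|p] := ltgtP (dot z w) 0.
    - by move=> /B2; lra.
    - by [].
    - by rewrite p eqxx in z0.
  move=> /slice_rV1[zs H]; apply/slice_rV1.
  have zs' : shell r z by move: zs; rewrite /shell/= enormN.
  split=> //; have z0 := dz0 _ zs'; move: H; rewrite dotNl oppr_gt0.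
  have [p|p|p] := ltgtP (dot z w) 0.
  - by [].
  - by move=> _; exact: B1.
  - by rewrite p eqxx in z0.
- exists 0 => //; congr L; apply: ext; split=> //.
    by rewrite /eball/= subrr enorm0 ltxx.
  by move=> /B2; lra.
Qed.

End dimension_one.

(** * Points where slice measures do not decide membership *)

Section caps.
Context {R : realType} {d : nat}.
Local Notation V := 'rV[R]_d.
Local Notation D := (unit_ball R d).
Local Notation m := (mball R d).
Local Notation L := (leb R d).
Implicit Types (x y z e v : V) (A B E X : set V) (r s q : R).
Variable w : V.
Hypothesis w1 : enorm w = 1.
Hypothesis d0 : (0 < d)%N.
Local Notation cone_gt := (cap_cone w).
Local Notation cone_eq := (level_cone w).
Local Notation cosine := (cos_axis w).
Local Notation cap_vol := (capvol w).

Definition above x : set V := shell (enorm x) `&` cone_gt (cosine x).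
Definition level x : set V := shell (enorm x) `&` cone_eq (cosine x).
(* Negligible unless d = 1, where the sphere has only two points. *)
Definition own x : set V := slice (enorm x) [set x].

Lemma measurable_above x : measurable (above x).
Proof. exact: measurable_shell_cone. Qed.

Lemma measurable_level x : measurable (level x).
Proof. by apply: measurableI; [exact: measurable_shell|exact: measurable_cone_eq]. Qed.

Lemma measurable_own x : measurable (own x).
Proof. exact: (measurable_slice _ (measurable_set1V x)). Qed.

Lemma cosineK x : 0 < enorm x -> cosine x * enorm x = dot x w.
Proof. by move=> x0; rewrite /cos_axis divfK// gt_eqF. Qed.

Lemma above_radial x z : 0 < enorm x -> shell (enorm x) z ->
  above x z <-> dot x w < dot (radial (enorm x) z) w.
Proof.
move=> x0 zs; have z0 := shell_neq0 zs; rewrite /above.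
have := cone_gt_radial w (cosine x) x0 z0.
rewrite {1}/cap_cone/= enorm_radial ?(ltW x0)// cosineK// => H.
by split=> [[_ /H]|/H].
Qed.

Lemma level_radial x z : 0 < enorm x -> shell (enorm x) z ->
  level x z <-> dot x w = dot (radial (enorm x) z) w.
Proof.
move=> x0 zs; have z0 := shell_neq0 zs; have zp := enorm_gt0 z0.
rewrite /level /level_cone/= /radial dotZl -(cosineK x0).
split=> [[_ /= ->]|H]; first by field; rewrite gt_eqF.
split=> //=; apply: (@mulfI _ (enorm x / enorm z)).
  by rewrite mulf_neq0 ?invr_neq0// gt_eqF.
by rewrite -H; field; rewrite gt_eqF.
Qed.

(** Gives the lower bound in [tie], and [key_out] the upper one: if two upward closed sets have
    slices of equal measure and only one contains [x], then [x] is a tie. *)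
Lemma key_in E x : 0 < enorm x -> E x ->
  (forall y, enorm x = enorm y -> dot x w < dot y w -> E y) ->
  above x `|` own x `<=` slice (enorm x) E.
Proof.
move=> x0 Ex up z [Hz|[zs Hz]]; last by split=> //=; rewrite [X in E X]Hz.
have [zs _] := Hz; split=> //=; apply: up.
  by rewrite enorm_radial ?(ltW x0)//; exact: shell_neq0 zs.
by apply/above_radial.
Qed.

Lemma key_out E x : 0 < enorm x -> ~ E x ->
  (forall y, enorm y = enorm x -> dot y w < dot x w -> E y -> E x) ->
  slice (enorm x) E `<=` above x `|` (level x `\` own x).
Proof.
move=> x0 Ex up z [zs Ez]; have z0 := shell_neq0 zs.
have er : enorm (radial (enorm x) z) = enorm x by rewrite enorm_radial ?ltW.
have [lt|lt|eq] := ltgtP (dot (radial (enorm x) z) w) (dot x w).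
- by exfalso; apply: Ex; exact: up Ez.
- by left; apply/above_radial.
right; split; first by apply/level_radial.
by move=> [_ /= H]; apply: Ex; rewrite -H.
Qed.

(* The points at which the measure of the slice of A does not decide membership
   in the cap symmetrisation. *)
Definition tie A : set V := [set x | 0 < enorm x /\
  (L (above x `|` own x) <= L (slice (enorm x) A) <=
   L (above x `|` (level x `\` own x)))%E].

Lemma cap_vol_fin r q : cap_vol r q \is a fin_num.
Proof. by apply: leb_shell_fin; exact: measurable_cone_gt. Qed.

Lemma tie_cap_vol A x : (1 < d)%N -> tie A x ->
  cap_vol (enorm x) (cosine x) = L (slice (enorm x) A).
Proof.
move=> d2 [x0 /andP[h1 h2]]; apply: le_anti; apply/andP; split.
  apply: le_trans h1; apply: le_measure; rewrite ?inE; [exact: measurable_above| |].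
    by apply: measurableU; [exact: measurable_above|exact: measurable_own].
  exact: subsetUl.
apply: le_trans h2 _.
have mlo : measurable (level x `\` own x).
  by apply: measurableD; [exact: measurable_level|exact: measurable_own].
apply: le_trans (measureU2 _ _ _) _ => //; first exact: measurable_above.
rewrite [X in (_ + X <= _)%E](_ : _ = 0%E) ?adde0//.
apply: (leb_subset0 mlo (measurable_cone_eq w (cosine x))).
  by move=> z [[]].
exact: cone_eq_null.
Qed.

Lemma measurable_leb_section (S : set (V * V)) : measurable S ->
  measurable_fun setT (fun x => L [set y | S (x, y)]).
Proof.
move=> mS; have := measurable_fun_xsection L mS; congr measurable_fun.
apply/funext => x /=; congr L.
by apply/seteqP; split => y; rewrite /xsection/= ?inE.
Qed.

Let m1 : measurable_fun setT (fun p : V * V => enorm p.1).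
Proof. exact: (measurableT_comp measurable_enorm measurable_fst). Qed.

Let m2 : measurable_fun setT (fun p : V * V => enorm p.2).
Proof. exact: (measurableT_comp measurable_enorm measurable_snd). Qed.

Let mshell2 : measurable [set p : V * V | shell (enorm p.1) p.2].
Proof.
rewrite (_ : [set _ | _] = [set p : V * V | 0 < enorm p.2] `&`
    [set p | enorm p.2 < enorm p.1]); last first.
  by apply/seteqP; split => p /= => [/andP[]|[? ?]]//; apply/andP.
apply: measurableI; rewrite -[X in measurable X]setTI.
  by apply: (measurable_fun_ltr (f := fun=> 0) (g := fun p : V * V => enorm p.2)).
exact: (measurable_fun_ltr m2 m1).
Qed.

Lemma measurable_leb_slice A : measurable A ->
  measurable_fun setT (fun x : V => L (slice (enorm x) A)).
Proof.
move=> mA; apply: (measurable_leb_section (S := [set p : V * V | shell (enorm p.1) p.2]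
  `&` [set p : V * V | A (radial (enorm p.1) p.2)])).
apply: measurableI => //; apply: (preimage_measurable _ mA).
exact: measurable_radial.
Qed.

Lemma measurable_cosine : measurable_fun setT cosine.
Proof.
by apply: measurable_funM; [exact: measurable_dotr|exact: measurable_inv_enorm].
Qed.

Lemma measurable_cap_vol_cosine :
  measurable_fun setT (fun x : V => cap_vol (enorm x) (cosine x)).
Proof.
apply: (measurable_leb_section (S := [set p : V * V | shell (enorm p.1) p.2]
  `&` [set p : V * V | cosine p.1 * enorm p.2 < dot p.2 w])).
apply: measurableI => //; rewrite -[X in measurable X]setTI.
apply: measurable_fun_ltr => //.
  apply: measurable_funM => //.
  exact: (measurableT_comp measurable_cosine measurable_fst).
exact: (measurableT_comp (measurable_dotr w) measurable_snd).
Qed.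

(** The integer dilates of the part in the shell are null and cover the cone. *)
Lemma cone_null_shell (G : set V) r : measurable G -> 0 < r -> ~ G 0 ->
  (forall s z, 0 < s -> G z -> G (s *: z)) -> L (shell r `&` G) = 0%E -> L G = 0%E.
Proof.
move=> mG r0 G0 cG N.
have mS : measurable (shell r `&` G) by apply: measurableI => //; exact: measurable_shell.
have NF : L.-negligible (\bigcup_n ( *:%R (n.+1%:R^-1 : R) @^-1` (shell r `&` G) : set V)).
  apply: (@negligible_bigcup _ _ _ L) => n.
  have n0 : 0 < n.+1%:R^-1 :> R by rewrite invr_gt0.
  exists ( *:%R (n.+1%:R^-1 : R) @^-1` (shell r `&` G)); split=> //.
    by apply: (preimage_measurable _ mS); exact: measurable_fun_scaleV.
  exact/leb_scale_eq0.
apply/(negligibleP _ mG); apply: negligibleS NF => z Gz.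
have z0 : 0 < enorm z by apply: enorm_gt0; apply: contra_not_neq G0 => <-.
have k0 : 0 < r / enorm z by rewrite divr_gt0.
have [n _ /(_ n (leqnn _)) nk] := near_infty_natSinv_lt (PosNum k0).
have {}nk : n.+1%:R^-1 < r / enorm z := nk.
have n0 : 0 < n.+1%:R^-1 :> R by rewrite invr_gt0.
exists n => //=; split; last exact: cG.
by rewrite /shell/= enormZ gtr0_norm// mulr_gt0//= -ltr_pdivlMr.
Qed.

Lemma cosine_scale s z : 0 < s -> cosine (s *: z) = cosine z.
Proof.
move=> s0; rewrite /cos_axis dotZl enormZ gtr0_norm//.
by rewrite invfM mulrACA divff ?mul1r// gt_eqF.
Qed.

(** By [polar_null] one sphere at a time suffices, and there a tie is a point where the tail
    function of the cosine takes one prescribed value. *)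
Lemma tie_null2 A : (1 < d)%N -> measurable A -> L.-negligible (tie A).
Proof.
move=> d2 mA.
pose T := [set x : V | 0 < enorm x] `&`
  [set x | cap_vol (enorm x) (cosine x) = L (slice (enorm x) A)].
have mT : measurable T.
  apply: measurableI; first exact: (measurable_posset measurable_enorm).
  rewrite -[X in measurable X]setTI.
  exact: (measurable_eqe measurableT measurable_cap_vol_cosine (measurable_leb_slice mA)).
apply: (@negligibleS _ _ _ L T).
  by move=> x Tx; split; [case: Tx|exact: tie_cap_vol].
apply/(negligibleP _ mT)/(polar_null d0 mT).
  by rewrite /T/= enorm0 ltxx => -[].
apply: aeW => x; have [->|x0] := eqVneq x 0.
  rewrite (_ : [set _ | _] = set0) ?measure0//; apply/seteqP; split => z //=.
  by rewrite /T/= enorm0 /radial mul0r scale0r enorm0 ltxx => -[].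
have xp := enorm_gt0 x0; set r := enorm x in xp *.
have mG : measurable [set z | T (radial r z)].
  by apply: (preimage_measurable _ mT); exact: measurable_radial.
apply: (cone_null_shell mG xp).
- by rewrite /T/= /radial scaler0 enorm0 ltxx => -[].
- by move=> s z s0 /=; rewrite radial_scale.
have mS : measurable (shell r `&` [set z | T (radial r z)]).
  by apply: measurableI => //; exact: measurable_shell.
apply/(negligibleP _ mS).
apply: negligibleS (shell_tie_null w1 d2 r (L (slice r A))).
move=> z [zs [/= _ H]]; split=> //=; have z0 := shell_neq0 zs.
move: H; rewrite enorm_radial ?(ltW xp)// {1}/radial cosine_scale//.
by rewrite divr_gt0// enorm_gt0.
Qed.

End caps.

(** In dimension one each level contains a single point of the sphere, so [level] without [own] is
    empty while [own] has positive measure: there are no ties. *)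
Lemma tie_null {R : realType} {d : nat} (w : 'rV[R]_d) (A : set 'rV[R]_d) :
  enorm w = 1 -> (0 < d)%N -> measurable A -> (leb R d).-negligible (tie w A).
Proof.
case: d w A => // -[|d] w A w1 _ mA; last exact: tie_null2.
rewrite (_ : tie w A = set0); first exact: negligible_set0.
apply/seteqP; split => x // [x0 /andP[h1 h2]].
have := le_trans h1 h2.
have -> : level w x `\` own x = set0.
  apply/seteqP; split => z // [Hz Hz']; have [zs _] := Hz; apply: Hz'; split=> //=.
  by move: Hz => /(level_radial w x0 zs) H; rewrite [RHS](rV1E w1) H -(rV1E w1).
rewrite setU0 measureU; [|exact: measurable_above|exact: measurable_own|]; last first.
  apply/seteqP; split => z // [Hz [zs H]]; move: Hz.
  by move=> /(above_radial w x0 zs); rewrite [radial _ _]H ltxx.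
have fa : leb R 1 (above w x) \is a fin_num by exact: cap_vol_fin.
rewrite -[leRHS]adde0 leeD2lE// leNgt => /negP; apply.
pose v := (enorm x)^-1 *: x.
have v1 : enorm v = 1 by rewrite enormZ gtr0_norm ?invr_gt0// mulVf// gt_eqF.
apply: lt_le_trans (ray_ball_gt0 x0 v1) _.
have mv : measurable [set z : 'rV[R]_1 | 0 < dot z v].
  by apply: (measurable_posset (g := fun z => dot z v)); exact: measurable_dotr.
apply: le_measure; rewrite ?inE; [|exact: measurable_own|].
  by apply: measurableI => //; exact: measurable_shell.
move=> z [zs /= zv]; split=> //=; rewrite (radial_rV1 v1 _ (shell_neq0 zs)) zv.
by rewrite /v scalerA divff ?scale1r// gt_eqF.
Qed.

(** * Cap symmetrisation of mirrored sets and functions *)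

Section cap_sets.
Context {R : realType} {d : nat}.
Local Notation V := 'rV[R]_d.
Local Notation D := (unit_ball R d).
Local Notation m := (mball R d).
Local Notation L := (leb R d).
Implicit Types (x y z e : V) (A B E X : set V) (r s q : R).
Variable w : V.
Hypothesis w1 : enorm w = 1.
Hypothesis d0 : (0 < d)%N.

Lemma slice_sphere r E : 0 < r -> slice r (E `&` esphere r) = slice r E.
Proof.
move=> r0; apply/seteqP; split => z [zs]; first by move=> [Ez _]; split.
by move=> Ez; split=> //; split=> //; apply: enorm_radial; [exact: ltW|exact: shell_neq0 zs].
Qed.

Lemma surface_measureE r E : 0 < r ->
  surface_measure r (E `&` esphere r) = ((d%:R / r)%:E * L (slice r E))%E.
Proof. by move=> r0; rewrite -[in RHS](slice_sphere E r0). Qed.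

Lemma surface_measure_eq r A B : 0 < r ->
  surface_measure r (A `&` esphere r) = surface_measure r (B `&` esphere r) <->
  L (slice r A) = L (slice r B).
Proof.
move=> r0; rewrite !surface_measureE//; split=> [|->//].
by apply: eq_pmule; rewrite ltry andbT lte_fin divr_gt0// ltr0n.
Qed.

Lemma rho_exists r A : 0 < r -> measurable A ->
  exists2 rho : R, 0 <= rho & L (slice r (eball (r *: w) rho)) = L (slice r A).
Proof.
move: w w1 d0; case: d A => // -[|n] A v v1 _ r0 mA.
  exact: rho_exists1.
exact: rho_exists2.
Qed.

Lemma slice_ext r A B : 0 < r -> A `&` esphere r = B `&` esphere r ->
  slice r A = slice r B.
Proof. by move=> r0 AB; rewrite -(slice_sphere A r0) AB slice_sphere. Qed.

Lemma cap_set_exists A : measurable A -> A `<=` D ->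
  exists B, cap_symmetrisation_set w A B.
Proof.
move=> mA AD.
have H r : exists rho : R, 0 < r -> 0 <= rho /\
    L (slice r (eball (r *: w) rho)) = L (slice r A).
  have [r0|r0] := ltP 0 r; last by exists 0.
  by have [rho h1 h2] := rho_exists r0 mA; exists rho.
pose rho r := sval (cid (H r)).
have rhoP r : 0 < r -> 0 <= rho r /\
    L (slice r (eball (r *: w) (rho r))) = L (slice r A) := svalP (cid (H r)).
pose B := (A `&` [set 0]) `|`
  (D `&` [set x | x != 0 /\ eball (enorm x *: w) (rho (enorm x)) x]).
have BS r : 0 < r < 1 -> B `&` esphere r = eball (r *: w) (rho r) `&` esphere r.
  move=> /andP[r0 r1]; apply/seteqP; split => x [Bx xr]; split=> //.
    case: Bx => [[_ /= x0]|[_ [_]]]; last by rewrite xr.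
    by move: xr; rewrite /esphere/= x0 enorm0 => rE; rewrite rE ltxx in r0.
  right; split; first by rewrite /unit_ball/eball/= subr0 xr.
  rewrite /= xr; split=> //.
  by apply: contraTneq r0 => x0; rewrite -xr x0 enorm0 ltxx.
exists B; split.
- by move=> x [[/AD]|[]].
- apply/seteqP; split => x; last by move=> [Ax x0]; split=> //; left.
  by move=> [[//|[_ [+ _]]] /= x0]; rewrite x0 eqxx.
move=> r r01; have /andP[r0 r1] := r01; have [h1 h2] := rhoP _ r0.
exists (rho r); split=> //; first exact: BS.
apply/(surface_measure_eq _ _ r0); rewrite -h2; congr L.
by apply: slice_ext => //; exact: BS.
Qed.

(** By [polar_null], almost every sphere meets the null symmetric difference in a null cone; the
    origin is removed to meet its hypothesis. *)
Lemma sdiff_slice A B : measurable A -> measurable B -> L (sdiff A B) = 0%E ->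
  {ae L, forall x, x != 0 -> L (slice (enorm x) A) = L (slice (enorm x) B)}.
Proof.
move=> mA mB N0; pose N := sdiff A B `\` [set 0].
have mN : measurable N.
  by apply: measurableD; [exact: measurable_sdiff|exact: measurable_set1V].
have LN : L N = 0%E.
  by apply: (leb_subset0 mN (measurable_sdiff mA mB)) => //; exact: subDsetl.
have N00 : ~ N 0 by move=> [_]; apply.
have := (polar_null d0 mN N00).1 LN; apply: filterS => x Hx x0.
have xp := enorm_gt0 x0.
have mr X : measurable X -> measurable [set z | X (radial (enorm x) z)].
  by move=> mX; apply: (preimage_measurable _ mX); exact: measurable_radial.
have key X Y : measurable X -> measurable Y ->
    (forall z, X z -> Y z \/ sdiff A B z) ->
    (L (slice (enorm x) X) <= L (slice (enorm x) Y))%E.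
  move=> mX mY XY; have mSY := measurable_slice (enorm x) mY.
  apply: (@le_trans _ _ (L (slice (enorm x) Y `|` [set z | N (radial (enorm x) z)]))).
    apply: le_measure; rewrite ?inE; [exact: measurable_slice| |].
      by apply: measurableU => //; exact: mr.
    move=> z [zs /XY[Yz|Nz]]; [by left|right; split=> //= r0].
    have := enorm_radial (ltW xp) (shell_neq0 zs); rewrite r0 enorm0 => x0'.
    by rewrite -x0' ltxx in xp.
  apply: le_trans (measureU2 _ _ _) _ => //; first exact: mr.
  by rewrite [X in (_ + X <= _)%E]Hx adde0.
apply: le_anti; apply/andP; split; apply: key => // z Xz.
  by have [Yz|Yz] := pselect (B z); [left|right; left].
by have [Yz|Yz] := pselect (A z); [left|right; right].
Qed.

(* The symmetrised set and the upward closed version of A are both upward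
   closed, with slices of the same measure, so they differ only at ties. *)
Lemma cap_set_ae A B : measurable A -> A `<=` D -> mirrored w A ->
  cap_symmetrisation_set w A B -> L.-negligible (sdiff A B).
Proof.
move=> mA AD HA [BD B0 BS].
have [E [mE ED upE N]] := upward_version mA AD HA.
have mN := measurable_sdiff mE mA.
have LN : L (sdiff E A) = 0%E.
  by rewrite -N mballE setIidl// => x [[/ED]|[/AD]].
have neg : L.-negligible (sdiff E A `|` [set 0] `|`
    ~` [set x | x != 0 -> L (slice (enorm x) E) = L (slice (enorm x) A)] `|` tie w A).
  apply: negligibleU; last exact: tie_null.
  apply: negligibleU; last exact: (sdiff_slice mE mA LN).
  apply: negligibleU; first exact/(negligibleP _ mN).
  by apply/negligibleP; [exact: measurable_set1V|exact: leb_set1].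
apply: negligibleS neg => x Hx.
have [x0|/eqP x0] := pselect (x = 0); first by left; left; right.
have [Hs|Hs] := pselect (x != 0 -> L (slice (enorm x) E) = L (slice (enorm x) A));
  last by left; right.
have {Hs} sE := Hs x0.
have [NE|NE] := pselect (sdiff E A x); first by left; left; left.
right; have xp := enorm_gt0 x0.
have xD : D x by case: Hx => -[]; [move/AD|move/BD].
have x1 : enorm x < 1 by move: xD; rewrite /unit_ball/eball/= subr0.
have r01 : 0 < enorm x < 1 by rewrite xp.
have [rho [rho0 Brho /(surface_measure_eq _ _ xp) sB]] := BS _ r01.
have upB y z : enorm y = enorm x -> enorm z = enorm x -> dot y w < dot z w -> B y -> B z.
  move=> yx zx yz By.
  have [Hy _] : (eball (enorm x *: w) rho `&` esphere (enorm x)) y.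
    by rewrite -Brho; split.
  have /(eball_cone_gt w1 _ rho0) : eball (enorm y *: w) rho y by rewrite yx.
  rewrite yx => /(_ xp); rewrite /cap_cone/= yx => Hy'.
  have [] : (B `&` esphere (enorm x)) z; last by [].
  rewrite Brho; split=> //; rewrite -zx; apply/(eball_cone_gt w1 _ rho0).
    by rewrite zx.
  by rewrite /cap_cone/= zx; exact: lt_trans Hy' yz.
have mslB : measurable (slice (enorm x) B).
  by rewrite (slice_ext xp Brho); apply: measurable_slice; exact: measurable_eball.
have mslE := measurable_slice (enorm x) mE.
have mao : measurable (above w x `|` own x).
  by apply: measurableU; [exact: measurable_above|exact: measurable_own].
have mal : measurable (above w x `|` (level w x `\` own x)).
  apply: measurableU; first exact: measurable_above.
  by apply: measurableD; [exact: measurable_level|exact: measurable_own].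
split=> //; case: Hx => [[Ax Bx]|[Bx Ax]].
  have Ex : E x by apply: contrapT => nE; apply: NE; right.
  apply/andP; split.
    rewrite -sE; apply: le_measure; rewrite ?inE//.
    by apply: key_in => // y xy lt; exact: (upE x y xy lt).
  rewrite -sB; apply: le_measure; rewrite ?inE//.
  by apply: key_out => // y yx lt By; exfalso; apply: Bx; exact: upB By.
have Ex : ~ E x by move=> nE; apply: NE; left.
apply/andP; split.
  rewrite -sB; apply: le_measure; rewrite ?inE//.
  by apply: key_in => // y xy lt; exact: upB Bx.
rewrite -sE; apply: le_measure; rewrite ?inE//.
by apply: key_out => // y yx lt; exact: (upE y x yx lt).
Qed.

Lemma sdiff_sym_negligible A B C : L.-negligible (sdiff A B) -> L.-negligible (sdiff A C) ->
  L.-negligible (sdiff C B).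
Proof.
move=> nB nC; apply: negligibleS (negligibleU nB nC) => x.
move=> [[Cx Bx]|[Bx Cx]]; have [Ax|Ax] := pselect (A x).
- by left; left.
- by right; right.
- by right; left.
- by left; right.
Qed.

(** [f] is itself a cap symmetrisation, so [xget] does not fall back on its default. The function
    chosen has the same superlevel sets up to null sets, and the rational levels determine it almost
    everywhere. *)
Lemma cap_symmetrisation_ae (f : V -> R) : measurable_fun setT f ->
  (forall t : R, mirrored w (D `&` [set x | t < f x])) ->
  {ae m, forall x, f x = cap_symmetrisation w f x}.
Proof.
move=> mf Hf.
have mlev (h : V -> R) (t : R) : measurable_fun setT h ->
    measurable (D `&` [set x | t < h x]).
  move=> mh; apply: measurableI; first exact: measurable_unit_ball.
  rewrite -[X in measurable X]setTI.
  by apply: (measurable_fun_ltr (f := fun=> t) (g := h)).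
have AD (h : V -> R) (t : R) : D `&` [set x | t < h x] `<=` D by move=> x [].
have capf : is_cap_symmetrisation w f f.
  split=> // t; have [B HB] := cap_set_exists (mlev f t mf) (AD f t).
  exists B => //; have := cap_set_ae (mlev f t mf) (AD f t) (Hf t) HB; exact.
have [mg Hg] : is_cap_symmetrisation w f (cap_symmetrisation w f).
  exact: (xgetI (cst 0) capf).
set g := cap_symmetrisation w f in mg Hg *.
have K (t : R) : L.-negligible (sdiff (D `&` [set x | t < f x]) (D `&` [set x | t < g x])).
  have [B HB gB] := Hg t.
  have fB := cap_set_ae (mlev f t mf) (AD f t) (Hf t) HB.
  apply: (@sdiff_sym_negligible B); rewrite /sdiff setUC.
    exact: gB.
  exact: fB.
have KQ : {ae m, forall x, forall n : nat,
    if unpickle n is Some q then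
      ~ sdiff (D `&` [set x | ratr (q : rat) < f x]) (D `&` [set x | ratr q < g x]) x
    else True}.
  apply/ae_foralln => n; case: (unpickle n) => [q|]; last exact: aeW.
  have [N [mN N0 HN]] := K (ratr q); exists N; split=> //.
    have mN0 : (m N <= L N)%E.
      rewrite mballE; apply: le_measure; rewrite ?inE//.
      by apply: measurableI => //; exact: measurable_unit_ball.
    by apply/eqP; rewrite -measure_le0 -N0.
  by move=> x /= /contrapT Hx; exact: HN.
have := @ae_ball R d; apply: filterS2 KQ => x Hx Dx.
apply/eqP; rewrite eq_le; apply/andP; split; rewrite leNgt; apply/negP => lt.
  have [q] := rat_in_itvoo lt; rewrite in_itv/= => /andP[q1 q2].
  have := Hx (pickle q); rewrite pickleK; apply; left; split; first by split.
  by move=> [_ /= /(lt_trans q1)]; rewrite ltxx.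
have [q] := rat_in_itvoo lt; rewrite in_itv/= => /andP[q1 q2].
have := Hx (pickle q); rewrite pickleK; apply; right; split; first by split.
by move=> [_ /= /(lt_trans q1)]; rewrite ltxx.
Qed.

End cap_sets.

(** * The axis of symmetry *)

Section axis.
Context {R : realType} {d : nat}.
Local Notation V := 'rV[R]_d.
Local Notation D := (unit_ball R d).
Local Notation m := (mball R d).
Local Notation ip := (l2ip m).
Implicit Types (f : V -> R) (x e : V).

(** The indicator gives the linear function a global bound. *)
Definition lin e x : R := \1_D x * dot x e.

Lemma sq_lin e : sq m (lin e).
Proof.
apply: (@sq_bounded _ _ _ (m : {finite_measure set V -> \bar R}) _ (enorm e)).
  apply: measurable_funM; last exact: measurable_dotr.
  exact: (measurable_indic measurable_unit_ball).
move=> x; rewrite /lin indicE; case: (boolP (x \in D)) => [|_].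
  rewrite inE mul1r /unit_ball/eball/= subr0 => /ltW x1.
  by rewrite (le_trans (dot_norm_le x e))// ler_piMl// enorm_ge0.
by rewrite mul0r normr0 enorm_ge0.
Qed.

Lemma indic_ball_refl e : enorm e = 1 -> (\1_D : V -> R) \o refl e = \1_D.
Proof.
move=> e1; apply/funext => x /=; rewrite !indicE (_ : (refl e x \in D) = (x \in D))//.
by apply/idP/idP; rewrite !inE /unit_ball/eball/= !subr0 enorm_refl.
Qed.

Lemma lin_refl e x : enorm e = 1 -> lin e (refl e x) = - lin e x.
Proof.
by move=> e1; rewrite /lin dot_refl// mulrN -[\1_D (refl e x)]/((\1_D \o refl e) x) indic_ball_refl.
Qed.

Lemma ip_lin e f : sq m f ->
  ip (lin e) f = dot (\row_i ip (lin (delta_mx 0 i)) f) e.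
Proof.
move=> sf.
have -> : lin e = fun x => \sum_i e 0 i * lin (delta_mx 0 i) x.
  apply/funext => x; rewrite /lin {1}/dot mulr_sumr; apply: eq_bigr => i _.
  by rewrite dot_delta; ring.
rewrite /l2ip; under eq_Rintegral do rewrite mulr_suml.
have [-> _] := @Rintegral_sumr R d _ (index_enum 'I_d)
  (fun i x => e 0 i * lin (delta_mx 0 i) x * f x)
  (fun i => sqM (sqZ (e 0 i) (sq_lin (delta_mx 0 i))) sf).
apply: eq_bigr => i _; rewrite mxE mulrC.
exact: (ipZl (e 0 i) (sq_lin (delta_mx 0 i)) sf).
Qed.

(** The moment sees only [f - f o refl e], whose product with [x.e] is nonpositive under the first
    inequality; a nonnegative moment then forces that difference to vanish. *)
Lemma moment_alternative e f : enorm e = 1 -> sq m f ->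
  {ae m, forall x, D x -> 0 < dot x e -> f x <= f (refl e x)} ->
  0 <= ip (lin e) f ->
  {ae m, forall x, D x -> 0 < dot x e -> f (refl e x) <= f x}.
Proof.
move=> e1 sf H I0; have sft := sq_refl e1 sf.
pose g x := f x - f (refl e x); have sg : sq m g by exact: sqB.
pose sgn x : R := if 0 < dot x e then 1 else -1.
have Dr x : D x -> D (refl e x) by rewrite /unit_ball/eball/= !subr0 enorm_refl.
have msgn : measurable_fun setT sgn.
  apply: measurable_fun_ifT => //.
  by apply: measurable_fun_ltr => //; exact: measurable_dotr.
have sh : sq m (fun x => - (sgn x * `|g x|)).
  apply: sqN; apply: (sq_le _ sg) => [|x].
    by apply: measurable_funM => //; apply: measurableT_comp => //; exact: sq_meas sg.
  by rewrite normrM normr_id /sgn; case: ifP => _; rewrite ?normrN normr1 mul1r.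
have gh : {ae m, forall x, g x = - (sgn x * `|g x|)}.
  have := ae_refl e1 H; have := @ae_ball R d.
  apply: filterS3 H => x Hx Dx Hrx; rewrite /sgn.
  have [xe|xe|xe] := ltgtP 0 (dot x e).
  - by rewrite mul1r ler0_norm ?opprK// subr_le0 Hx.
  - have := Hrx (Dr _ Dx); rewrite dot_refl// oppr_gt0 reflK// => /(_ xe) le.
    by rewrite mulN1r opprK ger0_norm// subr_ge0.
  - by rewrite /g refl_fix// subrr normr0 mulr0 oppr0.
have E : ip (lin e) g = ip (lin e) f + ip (lin e) f.
  rewrite (ipBr sf sft (sq_lin e)) -[X in _ - X = _](ip_refl e1 (sq_lin e) sft).
  rewrite refl_comp2//.
  have -> : lin e \o refl e = fun x => - lin e x.
    by apply/funext => x /=; exact: lin_refl.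
  by rewrite (ipNl (sq_lin e) sf) opprK.
have k0 x : (0 <= (\1_D x * `|dot x e| * `|g x|)%:E)%E.
  by rewrite lee_fin !mulr_ge0// indicE.
have kE x : \1_D x * `|dot x e| * `|g x| = - (lin e x * (- (sgn x * `|g x|))).
  rewrite /lin /sgn; have [xe|xe] := ltP 0 (dot x e).
    by rewrite gtr0_norm//; ring.
  by rewrite ler0_norm//; ring.
have Ik := sqM (sqN (sq_lin e)) sh.
have mk : measurable_fun setT (fun x => (\1_D x * `|dot x e| * `|g x|)%:E).
  have := measurable_int _ Ik; congr measurable_fun.
  by apply/funext => x; rewrite kE mulNr.
have Ik0 : (\int[m]_x (\1_D x * `|dot x e| * `|g x|)%:E = 0)%E.
  have fin : (\int[m]_x (\1_D x * `|dot x e| * `|g x|)%:E)%E \is a fin_num.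
    have := integrable_fin_num measurableT Ik; congr (_ \is a _).
    by apply: eq_integral => x _; rewrite kE mulNr.
  apply/eqP; rewrite eq_le integral_ge0 ?andbT; last by move=> x _; exact: k0.
  rewrite -(fineK fin) lee_fin -[fine _]/(\int[m]_x (\1_D x * `|dot x e| * `|g x|)).
  have -> : \int[m]_x (\1_D x * `|dot x e| * `|g x|) = - ip (lin e) g.
    rewrite (ipC m _ g) (ip_ae sg sh (sq_lin e) gh) ipC -(ipNl (sq_lin e) sh).
    by apply: eq_Rintegral => x _; rewrite kE mulNr.
  by rewrite oppr_le0 E addr_ge0.
have := ae_eq0_integral mk k0 Ik0; apply: filterS => x [] /eqP + Dx xe.
rewrite indicE mem_set// mul1r mulf_eq0 !normr_eq0 (gt_eqF xe)/= subr_eq0.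
by move=> /eqP ->.
Qed.

Lemma axis_exists f : (0 < d)%N -> sq m f ->
  (forall e, enorm e = 1 ->
    {ae m, forall x, D x -> 0 < dot x e -> f (refl e x) <= f x} \/
    {ae m, forall x, D x -> 0 < dot x e -> f x <= f (refl e x)}) ->
  exists w, enorm w = 1 /\ forall e, enorm e = 1 -> 0 < dot e w ->
    {ae m, forall x, D x -> 0 < dot x e -> f (refl e x) <= f x}.
Proof.
move=> d0 sf H; pose M : V := \row_i ip (lin (delta_mx 0 i)) f.
have key w : (forall e, 0 < dot e w -> 0 <= dot M e) ->
    forall e, enorm e = 1 -> 0 < dot e w ->
    {ae m, forall x, D x -> 0 < dot x e -> f (refl e x) <= f x}.
  move=> Hw e e1 ew; have [//|He] := H e e1.
  by apply: moment_alternative => //; rewrite (ip_lin e sf); exact: Hw.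
have [M0|M0] := eqVneq M 0.
  (* With zero moment the sign condition holds in every direction, so any unit vector serves as
     axis. *)
  exists (delta_mx 0 (Ordinal d0)); split; first exact: enorm_delta.
  by apply: key => e _; rewrite M0 dot0l.
have Mp := enorm_gt0 M0; exists ((enorm M)^-1 *: M); split.
  by rewrite enormZ gtr0_norm ?invr_gt0// mulVf// gt_eqF.
apply: key => e; rewrite dotZr pmulr_rgt0 ?invr_gt0// dotC.
exact: ltW.
Qed.

End axis.

Unset Implicit Arguments.

Theorem theorem1p2 (R : realType) (d : nat) (hd : (1 <= d)%N)
    (t : R) (ht0 : 0 < t) (ht1 : t < @inner R d torsion (cst 1))
    (f : 'rV[R]_d -> R) (hf : V t f) (hJ : @beta R d t = (J f)%:E) :
  exists w : 'rV[R]_d, enorm w = 1 /\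
    {ae lebesgue_ball R d, forall x, f x = cap_symmetrisation w f x}.
Proof.
have [fL f01 ft] := hf; pose i0 := Ordinal hd.
have sf : sq (mball R d) f by apply/sq_Lfun.
have s1 : sq (mball R d) \1_(unit_ball R d) by exact: sq_indic measurable_unit_ball.
have [sT _ _ _] := greenP i0 s1.
have Jpol e : enorm e = 1 -> J (polarise e f) <= J f.
  move=> e1; have sp := sq_pol e1 sf.
  suff Vp : V t (polarise e f).
    have : ((J (polarise e f))%:E <= @beta R d t)%E.
      by apply: ereal_sup_ubound; exact: (imageP (fun h => (J h)%:E) Vp).
    by rewrite hJ lee_fin.
  split.
  - by apply/sq_Lfun.
  - have := ae_refl e1 f01; apply: filterS2 f01 => x /andP[a0 a1] /andP[b0 b1].
    rewrite /polarise /Num.max /Num.min; case: ifP => _; case: ifP => _;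
      by apply/andP.
  (* Invariance of [1_D] under the reflection passes to the torsion function through
     [green_even]. *)
  have -> : inner (polarise e f) torsion = inner f torsion; last exact: ft.
  apply: (ip_pol_even e1 sf sT); exact: (green_even e1 i0 s1 (indic_ball_refl e1)).
have [w [w1 Hw]] := axis_exists hd sf (fun e e1 =>
  dichotomy i0 e1 sf (Jpol e e1) (Jpol (- e) (etrans (enormN e) e1))).
exists w; split=> //; apply: (cap_symmetrisation_ae w1 hd (sq_meas sf)) => s e e1 ew.
apply: filterS (Hw e e1 ew) => x Hx Dx xe [_ fs]; split=> //=.
exact: lt_le_trans fs (Hx Dx xe).
Qed.
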